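(* Let $(M,\mathcal F,g_\intercal)$ be a transversely time-oriented Lorentzian foliation. If $(M,\mathcal F,g_\intercal)$ is causally leaf-regular and its leaf space $M/\mathcal F$ is Hausdorff, then its transverse Seifert relation $J^+_{S\intercal}$ is closed in $M/\mathcal F\times M/\mathcal F$. In particular, in this case, if $(M,\mathcal F,g_\intercal)$ is transversely stably causal, then it is transversely $K$-causal.
   Context: $M$ is a connected smooth manifold of dimension $n\ge 3$. $\mathcal F$ is a regular foliation of codimension $q\geq 2$: a partition of $M$ into connected immersed submanifolds (leaves), locally given by the fibers of a submersion. $T\mathcal F\subset TM$ is the (vertical) distribution tangent to the leaves; vectors in $T\mathcal F$, and vector fields with values in it, are called vertical. $M/\mathcal F$ is the leaf space with the quotient topology. A set is saturated if it contains every leaf it meets. A transverse Lorentzian metric on $(M,\mathcal F)$ is a smooth symmetric $(0,2)$-tensor field $g_\intercal$ on $M$ with $\mathcal L_Vg_\intercal=0$ for all vertical $V$, such that at each $x$ the bilinear form $g_\intercal(x)$ has index $1$ and its kernel is exactly $T_x\mathcal F$. $\mathcal{TL}(M,\mathcal F)$ is the set of these. The triple $(M,\mathcal F,g_\intercal)$ is then called a Lorentzian foliation. A nonvertical vector $v$ is transversely causal if $g_\intercal(v,v)\le 0$. The set of transversely causal vectors at $x$ has two connected components (causal wedges); a transverse time orientation is a continuous choice of one of them (the future causal wedge) at each point. A future-directed transversely causal curve is a piecewise smooth curve whose tangent vectors lie in the future causal wedges. For leaves $L,L'$, write $L<_{M/\mathcal F}L'$ if there is a future-directed transversely causal curve from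 a point of $L$ to a point of $L'$, and $L\le_{M/\mathcal F}L'$ if $L<_{M/\mathcal F}L'$ or $L=L'$. $J^+_{M/\mathcal F}=J^+_{M/\mathcal F,g_\intercal}:=\{(L,L'):L\le_{M/\mathcal F}L'\}\subset M/\mathcal F\times M/\mathcal F$. $(M,\mathcal F,g_\intercal)$ is transversely causal if $L\nless_{M/\mathcal F}L$ for every leaf $L$. For $g_\intercal,g'_\intercal\in\mathcal{TL}(M,\mathcal F)$, write $g_\intercal<g'_\intercal$ if for every $v\in TM\setminus T\mathcal F$, $g_\intercal(v,v)\le0\Rightarrow g'_\intercal(v,v)<0$; in that case $g'_\intercal$ is time-oriented so that its future wedges contain those of $g_\intercal$. $(M,\mathcal F,g_\intercal)$ is transversely stably causal if there is $g'_\intercal\in\mathcal{TL}(M,\mathcal F)$ with $g_\intercal<g'_\intercal$ and $(M,\mathcal F,g'_\intercal)$ transversely causal. Transverse Seifert relation: $J^+_{S\intercal}:=\bigcap_{g'_\intercal>g_\intercal}J^+_{M/\mathcal F,g'_\intercal}$, the intersection over transverse Lorentzian metrics $g'_\intercal$ with $g_\intercal<g'_\intercal$. Transverse $K^+$ relation $K^+_\intercal$: the smallest closed (in the product topology) and transitive relation on $M/\mathcal F$ containing $J^+_{M/\mathcal F}$. $\overline{\Delta_{M/\mathcal F}}$ is the closure of the diagonal in $M/\mathcal F\times M/\mathcal F$. Transversely $K$-causal: $(\hat x,\hat y),(\hat y,\hat x)\in K^+_\intercal$ implies $(\hat x,\hat y)\in\overline{\Delta_{M/\mathcal F}}$. Causal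 leaf-regularity: a leaf $L$ is causally regular if there is a saturated neighborhood $\mathcal B\supset L$ in $M$ with the following property: given nets $(L'_i)_{i\in I}$, $(L''_i)_{i\in I}$ of leaves contained in $\mathcal B$ such that (i) $L'_i\to L'\subset\mathcal B$ and $L''_i\to L''\subset\mathcal B$ in $M/\mathcal F$, and (ii) for each $i$, either $L'_i=L''_i$ or there is a future-directed transversely causal curve segment starting at $L'_i$, ending at $L''_i$ and entirely contained in $\mathcal B$; then either $L'=L''$ or there is a future-directed transversely causal curve segment in $\mathcal B$ from $L'$ to $L''$. $(M,\mathcal F,g_\intercal)$ is causally leaf-regular if every leaf is causally regular. *)

(* Defs.v *)
From HB Require Import structures.
From mathcomp Require Import all_boot all_order all_algebra.
From mathcomp Require Import all_classical all_reals all_analysis.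

Set Implicit Arguments.
Unset Strict Implicit.
Unset Printing Implicit Defensive.

Import Order.TTheory GRing.Theory Num.Theory.
Import numFieldNormedType.Exports.

Local Open Scope classical_set_scope.
Local Open Scope ring_scope.
Local Open Scope quotient_scope.

(* C^k on U, with all iterated directional derivatives in place of the partial
   ones: for finite-dimensional V this is the usual class C^k.  U is always
   open below. *)
Fixpoint Ck (R : realType) (V W : normedModType R) (k : nat) (U : set V)
    (f : V -> W) : Prop :=
  (forall x, U x -> {for x, continuous f}) /\
  if k is k'.+1 then
    forall v, (forall x, U x -> derivable f x v) /\ Ck k' U ('D_v f)
  else True.

Definition smooth_on (R : realType) (V W : normedModType R) (U : set V)
    (f : V -> W) : Prop :=
  forall k, Ck k U f.

(* cmap and cinv are total functions; only their restrictions to dom and to the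
   image of dom are meaningful. *)
Record chart (R : realType) (T : topologicalType) (n : nat) := Chart {
  dom : set T;
  cmap :> T -> 'rV[R]_n;
  cinv : 'rV[R]_n -> T;
  dom_open : open dom;
  cod_open : open [set cmap x | x in dom];
  cmapK : forall x, dom x -> cinv (cmap x) = x;
  cmap_continuous : forall x, dom x -> {for x, continuous cmap};
  cinv_continuous : forall x, dom x -> {for cmap x, continuous cinv}
}.

Definition cimg (R : realType) (T : topologicalType) (n : nat)
    (c : chart R T n) (U : set T) : set 'rV[R]_n :=
  [set c x | x in U `&` dom c].

Definition trans (R : realType) (T : topologicalType) (n : nat)
    (c d : chart R T n) : 'rV[R]_n -> 'rV[R]_n :=
  d \o cinv c.

Definition compatible (R : realType) (T : topologicalType) (n : nat)
    (c d : chart R T n) : Prop :=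
  smooth_on (cimg c (dom d)) (trans c d) /\
  smooth_on (cimg d (dom c)) (trans d c).

Record manifold (R : realType) (n : nat) := Manifold {
  carrier :> topologicalType;
  atlas : set (chart R carrier n);
  carrier_hausdorff : hausdorff_space carrier;
  carrier_second_countable : @second_countable carrier;
  atlas_cover : forall x, exists2 c, atlas c & dom c x;
  atlas_compatible : forall c d, atlas c -> atlas d -> compatible c d;
  atlas_maximal :
    forall c, (forall d, atlas d -> compatible c d) -> atlas c
}.

Arguments atlas {R n} m.

Section Maps.
Context {R : realType}.

(* Smoothness on the open set U of a map from a manifold to a vector space. *)
Definition smooth_from (n : nat) (M : manifold R n) (W : normedModType R)
    (U : set M) (f : M -> W) : Prop :=
  forall c, atlas M c -> smooth_on (cimg c U) (f \o cinv c).

(* Smoothness on the open set U of a map from a vector space to a manifold. *)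
Definition smooth_into (n : nat) (M : manifold R n) (V : normedModType R)
    (U : set V) (f : V -> M) : Prop :=
  (forall x, U x -> {for x, continuous f}) /\
  forall c, atlas M c -> smooth_on (U `&` f @^-1` dom c) (c \o f).

Definition smooth_map (m n : nat) (N : manifold R m) (M : manifold R n)
    (f : N -> M) : Prop :=
  forall b, atlas N b -> smooth_into (cimg b setT) (f \o cinv b).

(* The Jacobian acts on row vectors on the right: the differential is
   w |-> w *m Jac f b c z in the charts b and c. *)
Definition Jac (m n : nat) (N : manifold R m) (M : manifold R n)
    (f : N -> M) (b : chart R N m) (c : chart R M n) (z : N) : 'M[R]_(m, n) :=
  'J (c \o f \o cinv b) (b z).

Definition immersion (m n : nat) (N : manifold R m) (M : manifold R n)
    (f : N -> M) : Prop :=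
  smooth_map f /\
  forall b c z, atlas N b -> atlas M c -> dom b z -> dom c (f z) ->
    row_free (Jac f b c z).

(* f exhibits the subset L of M as a connected immersed submanifold. *)
Definition connected_immersed (m n : nat) (N : manifold R m)
    (M : manifold R n) (f : N -> M) (L : set M) : Prop :=
  [/\ connected [set: N], immersion f, injective f & range f = L].

Definition submersion_on (n q : nat) (M : manifold R n) (U : set M)
    (f : M -> 'rV[R]_q) : Prop :=
  smooth_from U f /\
  forall c x, atlas M c -> U x -> dom c x ->
    row_full ('J (f \o cinv c) (c x)).

End Maps.

(* The foliation is given by its partition into leaves, i.e. by an equivalence
   relation.  In leaf_local each fiber of the submersion lies in one leaf, and
   a leaf meets U in at most countably many fibers. *)
Record foliation (R : realType) (p q : nat) (M : manifold R (p + q)) :=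
  Foliation {
    same_leaf : equiv_rel M;
    leaf_immersed : forall x, exists (N : manifold R p) (f : N -> M),
      connected_immersed f [set y | same_leaf x y];
    leaf_local : forall x, exists (U : set M) (f : M -> 'rV[R]_q),
      [/\ open U, U x, submersion_on U f,
          forall y z, U y -> U z -> f y = f z -> same_leaf y z &
          forall y, countable [set f z | z in U `&` [set z | same_leaf y z]]]
  }.

Definition leaf_space (R : realType) (p q : nat) (M : manifold R (p + q))
    (F : foliation M) : topologicalType :=
  quotient_topology {eq_quot (same_leaf F)}.

Unset Implicit Arguments.

Section LorentzianFoliation.
Context {R : realType} {p q : nat} {M : manifold R (p + q)}.
Implicit Type F : foliation M.

Local Notation n := (p + q)%N.
Local Notation chartM := (chart R M n).

Definition leaf_of F (x : M) : leaf_space F :=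
  \pi_(quotient_topology {eq_quot (same_leaf F)}) x.

Definition leaf_set F (L : leaf_space F) : set M :=
  [set x | leaf_of F x = L].

Definition saturated F (B : set M) : Prop :=
  forall L : leaf_space F, leaf_set F L `&` B !=set0 -> leaf_set F L `<=` B.

(* Tangent vectors at x are represented by their components v in a chart c of
   the atlas around x; the components in another chart d are
   v *m 'J (trans c d) (c x).  Vector fields, tensor fields and fields of sets
   of tangent vectors are families of components indexed by the charts. *)

(* v is tangent at x to the leaf through x. *)
Definition vertical F (c : chartM) (x : M) (v : 'rV[R]_n) : Prop :=
  exists (N : manifold R p) (f : N -> M),
    connected_immersed f [set y | same_leaf F x y] /\
    exists (z : N) (b : chart R N p) (w : 'rV[R]_p),
      [/\ f z = x, atlas N b, dom b z & v = w *m Jac f b c z].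

Definition vector_field (X : chartM -> M -> 'rV[R]_n) : Prop :=
  (forall c, atlas M c -> smooth_on (cimg c setT) (X c \o cinv c)) /\
  forall c d x, atlas M c -> atlas M d -> dom c x -> dom d x ->
    X d x = X c x *m 'J (trans c d) (c x).

Definition vertical_field F (X : chartM -> M -> 'rV[R]_n) : Prop :=
  vector_field X /\
  forall c x, atlas M c -> dom c x -> vertical F c x (X c x).

Definition symmetric_tensor (g : chartM -> M -> 'M[R]_n) : Prop :=
  [/\ forall c, atlas M c -> smooth_on (cimg c setT) (g c \o cinv c),
      forall c d x, atlas M c -> atlas M d -> dom c x -> dom d x ->
        g c x = 'J (trans c d) (c x) *m g d x *m ('J (trans c d) (c x))^T &
      forall c x, atlas M c -> dom c x -> (g c x)^T = g c x].

(* Components of the Lie derivative: (L_X g)_ij is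
   X^k d_k g_ij + (d_i X^k) g_kj + g_ik (d_j X^k). *)
Definition Lie_derivative (X : chartM -> M -> 'rV[R]_n)
    (g : chartM -> M -> 'M[R]_n) (c : chartM) (x : M) : 'M[R]_n :=
  'D_(X c x) (g c \o cinv c) (c x) +
  'J (X c \o cinv c) (c x) *m g c x +
  g c x *m ('J (X c \o cinv c) (c x))^T.

Definition bil (G : 'M[R]_n) (v w : 'rV[R]_n) : R := (v *m G *m w^T) 0 0.

(* W stands for the subspace spanned by its rows. *)
Definition negative_definite_on (G W : 'M[R]_n) : Prop :=
  forall v : 'rV[R]_n, (v <= W)%MS -> v != 0 -> bil G v v < 0.

(* The index is the maximal dimension of a negative definite subspace. *)
Definition has_index (G : 'M[R]_n) (k : nat) : Prop :=
  (exists2 W, negative_definite_on G W & \rank W = k) /\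
  forall W, negative_definite_on G W -> (\rank W <= k)%N.

Definition transverse_lorentzian F (g : chartM -> M -> 'M[R]_n) : Prop :=
  [/\ symmetric_tensor g,
      forall X, vertical_field F X ->
        forall c x, atlas M c -> dom c x -> Lie_derivative X g c x = 0,
      forall c x, atlas M c -> dom c x -> has_index (g c x) 1 &
      forall c x, atlas M c -> dom c x -> forall v : 'rV[R]_n,
        (forall w, bil (g c x) v w = 0) <-> vertical F c x v].

Definition causal_vectors F (g : chartM -> M -> 'M[R]_n) (c : chartM) (x : M) :
    set 'rV[R]_n :=
  [set v | ~ vertical F c x v /\ bil (g c x) v v <= 0].

(* O picks at each point a connected component of the set of transversely
   causal vectors; continuity of the choice means that it locally contains a
   continuous vector field. *)
Definition time_orientation F (g : chartM -> M -> 'M[R]_n)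
    (O : chartM -> M -> set 'rV[R]_n) : Prop :=
  [/\ forall c x, atlas M c -> dom c x ->
        exists2 v, causal_vectors F g c x v &
          O c x = connected_component (causal_vectors F g c x) v,
      forall c d x, atlas M c -> atlas M d -> dom c x -> dom d x ->
        O d x = [set v *m 'J (trans c d) (c x) | v in O c x] &
      forall x, exists (c : chartM) (X : M -> 'rV[R]_n),
        [/\ atlas M c, dom c x &
            \forall y \near x, {for y, continuous X} /\ O c y (X y)]].

(* sigma is smooth on [a, b] (it extends smoothly to a neighborhood), and all
   its tangent vectors there, including the one-sided ones at the endpoints,
   lie in the future wedges O. *)
Definition future_piece (O : chartM -> M -> set 'rV[R]_n) (sigma : R -> M)
    (a b : R) : Prop :=
  exists (e : R) (tau : R -> M),
    [/\ 0 < e,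
        smooth_into [set t : R | a - e < t < b + e] tau,
        forall t, a <= t <= b -> tau t = sigma t &
        forall t c, a <= t <= b -> atlas M c -> dom c (tau t) ->
          O c (tau t) (derive1 (c \o tau) t)].

(* Future-directed transversely causal curve segments: piecewise smooth, hence
   continuous since consecutive closed pieces share an endpoint. *)
Definition future_curve (O : chartM -> M -> set 'rV[R]_n) (sigma : R -> M)
    (a b : R) : Prop :=
  exists (k : nat) (t : nat -> R),
    [/\ t 0%N = a, t k.+1 = b &
        forall i, (i <= k)%N ->
          t i < t i.+1 /\ future_piece O sigma (t i) (t i.+1)].

Definition future_connected F (O : chartM -> M -> set 'rV[R]_n) (B : set M)
    (L L' : leaf_space F) : Prop :=
  exists (sigma : R -> M) (a b : R),
    [/\ future_curve O sigma a b, leaf_set F L (sigma a),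
        leaf_set F L' (sigma b) & forall t, a <= t <= b -> B (sigma t)].

Definition leaf_lt F (O : chartM -> M -> set 'rV[R]_n) (L L' : leaf_space F) :
    Prop :=
  future_connected F O setT L L'.

Definition leaf_le F (O : chartM -> M -> set 'rV[R]_n) (L L' : leaf_space F) :
    Prop :=
  leaf_lt F O L L' \/ L = L'.

Definition Jplus F (O : chartM -> M -> set 'rV[R]_n) :
    set (leaf_space F * leaf_space F) :=
  [set z | leaf_le F O z.1 z.2].

Definition transversely_causal F (O : chartM -> M -> set 'rV[R]_n) : Prop :=
  forall L : leaf_space F, ~ leaf_lt F O L L.

Definition wider F (g g' : chartM -> M -> 'M[R]_n) : Prop :=
  forall c x v, atlas M c -> dom c x -> ~ vertical F c x v ->
    bil (g c x) v v <= 0 -> bil (g' c x) v v < 0.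

(* g' is a transverse Lorentzian metric with g < g', and O' is its time
   orientation whose wedges contain those of O. *)
Definition wider_oriented F (g : chartM -> M -> 'M[R]_n)
    (O : chartM -> M -> set 'rV[R]_n) (g' : chartM -> M -> 'M[R]_n)
    (O' : chartM -> M -> set 'rV[R]_n) : Prop :=
  [/\ transverse_lorentzian F g', wider F g g', time_orientation F g' O' &
      forall c x, atlas M c -> dom c x -> O c x `<=` O' c x].

Definition stably_causal F (g : chartM -> M -> 'M[R]_n)
    (O : chartM -> M -> set 'rV[R]_n) : Prop :=
  exists (g' : chartM -> M -> 'M[R]_n) (O' : chartM -> M -> set 'rV[R]_n),
    wider_oriented F g O g' O' /\ transversely_causal F O'.

Definition seifert F (g : chartM -> M -> 'M[R]_n)
    (O : chartM -> M -> set 'rV[R]_n) : set (leaf_space F * leaf_space F) :=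
  [set z | forall g' O', wider_oriented F g O g' O' -> Jplus F O' z].

Definition transitive_rel (T : Type) (S : set (T * T)) : Prop :=
  forall x y z, S (x, y) -> S (y, z) -> S (x, z).

Definition Kplus F (O : chartM -> M -> set 'rV[R]_n) :
    set (leaf_space F * leaf_space F) :=
  [set z | forall S : set (leaf_space F * leaf_space F),
     closed S -> transitive_rel _ S -> Jplus F O `<=` S -> S z].

Definition K_causal F (O : chartM -> M -> set 'rV[R]_n) : Prop :=
  forall x y : leaf_space F, Kplus F O (x, y) -> Kplus F O (y, x) ->
    closure [set z : leaf_space F * leaf_space F | z.1 = z.2] (x, y).

Definition directed (I : Type) (le : I -> I -> Prop) : Prop :=
  [/\ inhabited I, forall i, le i i,
      forall i j k, le i j -> le j k -> le i k &
      forall i j, exists2 k, le i k & le j k].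

Definition net_tail (I : Type) (le : I -> I -> Prop) : set_system I :=
  [set P | exists i, forall j, le i j -> P j].

Definition leaf_regular F (O : chartM -> M -> set 'rV[R]_n)
    (L : leaf_space F) : Prop :=
  exists B : set M,
    [/\ saturated F B, forall x, leaf_set F L x -> nbhs x B &
        forall (I : Type) (le : I -> I -> Prop), directed I le ->
        forall (u v : I -> leaf_space F) (L' L'' : leaf_space F),
          (forall i, leaf_set F (u i) `<=` B /\ leaf_set F (v i) `<=` B) ->
          leaf_set F L' `<=` B -> leaf_set F L'' `<=` B ->
          u i @[i --> net_tail I le] --> L' ->
          v i @[i --> net_tail I le] --> L'' ->
          (forall i, u i = v i \/ future_connected F O B (u i) (v i)) ->
          L' = L'' \/ future_connected F O B L' L''].

Definition causally_leaf_regular F (O : chartM -> M -> set 'rV[R]_n) : Prop :=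
  forall L : leaf_space F, leaf_regular F O L.

End LorentzianFoliation.

(* Main.v *)
(* A transverse metric g' > g leaves room for a chain of metrics
   g < a < b < c < d < g', obtained by averaging.  Let (L, L') be a limit of
   pairs (P, P') of the Seifert relation, with L and L' distinct, hence with
   disjoint neighborhoods V and V' in the leaf space.  Causal curves can be moved
   along the leaves, because the wedges are invariant under plaque translations
   and under adding vertical vectors.  A future a-causal curve from P, close to L,
   to P', outside V, must leave a small transverse disc around L; up to there it
   stays, read on the disc, in the translate of a fixed convex cone squeezed
   between the cones of a and c.  At the exit point the displacement is large
   compared with the distance from P to L, so that the straight segment from L to
   that point is c-causal.  Hence L <_c P', and the time-reversed argument at L'
   gives L <_g' L'.  A closed Seifert relation is also transitive, so that it
   contains K^+, and it is antisymmetric when g is stably causal. *)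

From HB Require Import structures.
Require Import Defs.
From mathcomp Require Import all_boot all_order all_algebra.
From mathcomp Require Import all_classical all_reals all_analysis.
From mathcomp Require Import perm ring lra.
Set Implicit Arguments.
Unset Strict Implicit.
Unset Printing Implicit Defensive.
Import Order.TTheory GRing.Theory Num.Theory.
Import numFieldNormedType.Exports.
Local Open Scope classical_set_scope.
Local Open Scope ring_scope.

(** * Differential calculus *)

(** The obstacle is that a causal curve from P need not stay in the chart around the disc: it may
    wander along its leaves, and a leaf may meet the disc many times, so the curve has no projection
    to the disc. Instead, [segment_push] follows the set of leaves that meet the part of the disc
    inside the translated cone. This set is compact, hence closed in the Hausdorff leaf space, so
    there is a last time at which the curve is in it. If the corresponding point of the disc is not
    on the boundary sphere, only the germ of the curve at that time has to be moved into the disc;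
    its velocity is interior to the cone, and convexity of the cone keeps the later points in the
    translate with the same apex. A cone with constant coefficients can be compared with varying
    wedges only if there is a strict gap on either side. Each use of [push_out] therefore takes
    three metrics: a < b < c at L and c < d < g' at L'. The Lie derivative condition speaks of
    global vertical fields, whereas what is needed is constancy of the metric along plaques; bump
    functions bridge the two. *)

Section CkBasics.
Context {R : realType} {V : normedModType R}.
Implicit Types (U : set V) (k : nat).

Lemma CkW (W : normedModType R) k U (f : V -> W) : Ck k.+1 U f -> Ck k U f.
Proof.
elim: k f => [|k IH] f [cf df]; first by split.
by split=> // v; have [dfv Cf] := df v; split=> //; exact: IH.
Qed.

Lemma Ck_sub (W : normedModType R) k U U' (f : V -> W) :
  U' `<=` U -> Ck k U f -> Ck k U' f.
Proof.
move=> sU; elim: k f => [|k IH] f [cf df]; split=> //.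
- by move=> x /sU; exact: cf.
- by move=> x /sU; exact: cf.
- move=> v; have [dfv Cf] := df v; split; last exact: IH.
  by move=> x /sU; exact: dfv.
Qed.

(** Every clause of [Ck] concerns the total function [f] at the points of [U], so the pieces [U']
    may be arbitrary sets. *)
Lemma Ck_local (W : normedModType R) k U (f : V -> W) :
  (forall x, U x -> exists2 U', U' x & Ck k U' f) -> Ck k U f.
Proof.
elim: k f => [|k IH] f H; split=> //.
- by move=> x /H [U' U'x [cf _]]; exact: cf.
- by move=> x /H [U' U'x [cf _]]; exact: cf.
- move=> v; split.
    by move=> x /H [U' U'x [_ /(_ v)[df _]]]; exact: df.
  by apply: IH => x /H [U' U'x [_ /(_ v)[_ Cf]]]; exists U'.
Qed.

Lemma open_near_eq (W : normedModType R) U (f g : V -> W) x :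
  open U -> {in U, f =1 g} -> U x -> \forall y \near x, f y = g y.
Proof.
move=> oU fg Ux; have := open_nbhs_nbhs (conj oU Ux); apply: filterS => y Uy.
by apply: fg; rewrite inE.
Qed.

Lemma near_eq_continuous (W : normedModType R) (f g : V -> W) x :
  (\forall y \near x, f y = g y) -> {for x, continuous f} -> {for x, continuous g}.
Proof.
move=> nfg cf; suff: g y @[y --> x] --> g x by [].
rewrite -(nbhs_singleton nfg).
apply: cvg_trans cf; apply: near_eq_cvg; exact: nfg.
Qed.

Lemma Ck_eq (W : normedModType R) k U (f g : V -> W) :
  open U -> {in U, f =1 g} -> Ck k U f -> Ck k U g.
Proof.
move=> oU; elim: k f g => [|k IH] f g fg [cf df].
  split=> // x Ux; have nfg := open_near_eq oU fg Ux.
  exact: near_eq_continuous nfg (cf x Ux).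
split.
  move=> x Ux; have nfg := open_near_eq oU fg Ux.
  exact: near_eq_continuous nfg (cf x Ux).
move=> v; have [dfv Cf] := df v; split.
  move=> x Ux; apply: near_eq_derivable (dfv x Ux).
  exact: open_near_eq oU fg Ux.
apply: IH Cf => x; rewrite inE => Ux.
by apply: near_eq_derive; exact: open_near_eq oU fg Ux.
Qed.

Lemma continuous_distP (W : normedModType R) (f : V -> W) (x : V) :
  {for x, continuous f} <->
  (forall e, 0 < e -> nbhs x [set y | `|f x - f y| <= e]).
Proof.
split=> [cf e e0|H]; first by have /cvgrPdist_le/(_ _ e0) := cf.
by apply/cvgrPdist_le => e /H.
Qed.

Lemma continuous_mxP a b (f : V -> 'M[R]_(a, b)) x :
  {for x, continuous f} <-> forall i j, {for x, continuous (fun y => f y i j)}.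
Proof.
split=> [cf i j|cf].
  exact: (continuous_comp cf (@coord_continuous _ a b i j (f x))).
apply/cvgrPdist_le => /= e e0; near=> y.
rewrite /Num.Def.normr/= mx_normrE (bigmax_le _ (ltW e0))//= => i _.
rewrite !mxE/=; move: i; near: y; apply: filter_forall => /= i.
exact: ((cvgrPdist_le _ _).1 (cf i.1 i.2)).
Unshelve. all: by end_near. Qed.

Lemma Ck_mxP a b k U (f : V -> 'M[R]_(a, b)) : open U ->
  Ck k U f <-> forall i j, Ck k U (fun y => f y i j).
Proof.
move=> oU; elim: k f => [|k IH] f.
  split=> [[cf _] i j|H]; first by split=> // x /cf /continuous_mxP; exact.
  by split=> // x Ux; apply/continuous_mxP => i j; have [+ _] := H i j; exact.
split=> [[cf df] i j|H].
  split; first by move=> x /cf /continuous_mxP; exact.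
  move=> v; have [dfv Cf] := df v; split.
    by move=> x /dfv /derivable_mxP; exact.
  have := (IH _).1 Cf i j; apply: Ck_eq => // x; rewrite inE => Ux.
  by rewrite derive_mx ?mxE//; exact: dfv.
split; first by move=> x Ux; apply/continuous_mxP => i j; have [+ _] := H i j; exact.
move=> v.
have D x : U x -> derivable f x v.
  by move=> Ux; apply/derivable_mxP => i j; have [_ /(_ v)[+ _]] := H i j; exact.
split=> //; apply/IH => i j; have [_ /(_ v)[_]] := H i j.
apply: Ck_eq => // x; rewrite inE => Ux.
by rewrite derive_mx ?mxE//; exact: D.
Qed.

Lemma Ck_cst (W : normedModType R) k U (w : W) : Ck k U (cst w).
Proof.
elim: k w => [|k IH] w; split=> //.
- by move=> x _; exact: cvg_cst.
- by move=> x _; exact: cvg_cst.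
move=> v; split; first by move=> x _; exact: derivable_cst.
suff -> : 'D_v (cst w) = cst (0 : W) by exact: IH.
by apply/funext => x; rewrite derive_cst.
Qed.

Lemma Ck_add (W : normedModType R) k U (f g : V -> W) : open U ->
  Ck k U f -> Ck k U g -> Ck k U (fun x => f x + g x).
Proof.
move=> oU; elim: k f g => [|k IH] f g [cf df] [cg dg]; split=> //.
- by move=> x Ux; apply: cvgD; [exact: cf|exact: cg].
- by move=> x Ux; apply: cvgD; [exact: cf|exact: cg].
move=> v; have [dfv Cf] := df v; have [dgv Cg] := dg v; split.
  by move=> x Ux; apply: derivableD; [exact: dfv|exact: dgv].
apply: Ck_eq (IH _ _ Cf Cg) => // x; rewrite inE => Ux.
by rewrite (_ : (fun _ => _) = f + g)// deriveD//; [exact: dfv|exact: dgv].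
Qed.

Lemma Ck_mul k U (f g : V -> R) : open U ->
  Ck k U f -> Ck k U g -> Ck k U (fun x => f x * g x).
Proof.
move=> oU; elim: k f g => [|k IH] f g Cf0 Cg0; move: (Cf0) (Cg0) => [cf df] [cg dg].
  by split=> // x Ux; apply: cvgM; [exact: cf|exact: cg].
split; first by move=> x Ux; apply: cvgM; [exact: cf|exact: cg].
move=> v; have [dfv Cf] := df v; have [dgv Cg] := dg v; split.
  by move=> x Ux; apply: derivableM; [exact: dfv|exact: dgv].
have := Ck_add oU (IH _ _ (CkW Cf0) Cg) (IH _ _ (CkW Cg0) Cf).
apply: Ck_eq => // x; rewrite inE => Ux.
by rewrite (_ : (fun _ => _) = f * g)// deriveM//; [exact: dfv|exact: dgv].
Qed.

Lemma Ck_sum (I : Type) (r : seq I) (P : pred I) k U (f : I -> V -> R) :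
  open U -> (forall i, Ck k U (f i)) -> Ck k U (fun x => \sum_(i <- r | P i) f i x).
Proof.
move=> oU H; elim: r => [|i r IH].
  by apply: Ck_eq (Ck_cst k U (0:R)) => // x _; rewrite big_nil.
case Pi: (P i).
  by apply: Ck_eq (Ck_add oU (H i) IH) => // x _; rewrite big_cons Pi.
by apply: Ck_eq IH => // x _; rewrite big_cons Pi.
Qed.

Lemma Ck_prod (I : Type) (r : seq I) (P : pred I) k U (f : I -> V -> R) :
  open U -> (forall i, Ck k U (f i)) -> Ck k U (fun x => \prod_(i <- r | P i) f i x).
Proof.
move=> oU H; elim: r => [|i r IH].
  by apply: Ck_eq (Ck_cst k U (1:R)) => // x _; rewrite big_nil.
case Pi: (P i).
  by apply: Ck_eq (Ck_mul oU (H i) IH) => // x _; rewrite big_cons Pi.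
by apply: Ck_eq IH => // x _; rewrite big_cons Pi.
Qed.

Lemma Ck_inv k U (f : V -> R) : open U -> (forall x, U x -> f x != 0) ->
  Ck k U f -> Ck k U (fun x => (f x)^-1).
Proof.
move=> oU f0; elim: k f f0 => [|k IH] f f0 Cf0; move: (Cf0) => [cf df].
  by split=> // x Ux; apply: cvgV; [exact: f0|exact: cf].
split; first by move=> x Ux; apply: cvgV; [exact: f0|exact: cf].
move=> v; have [dfv Cf] := df v; split.
  by move=> x Ux; apply: derivableV; [exact: f0|exact: dfv].
have C1 := IH _ f0 (CkW Cf0).
have := Ck_mul oU (Ck_cst k U (-1:R)) (Ck_mul oU (Ck_mul oU C1 C1) Cf).
apply: Ck_eq => // x; rewrite inE => Ux.
rewrite [RHS](deriveV (f0 x Ux) (dfv x Ux)) /cst /= mulN1r -mulNr /GRing.scale /=.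
by rewrite expr2 invfM mulNr.
Qed.

Lemma Ck_scale (W : normedModType R) k U (c : R) (f : V -> W) : open U ->
  Ck k U f -> Ck k U (fun x => c *: f x).
Proof.
move=> oU; elim: k f => [|k IH] f [cf df]; split=> //.
- by move=> x Ux; exact: (cvgZ (cvg_cst _) (cf x Ux)).
- by move=> x Ux; exact: (cvgZ (cvg_cst _) (cf x Ux)).
move=> v; have [dfv Cf] := df v; split.
  by move=> x Ux; apply: derivableZ; exact: dfv.
apply: Ck_eq (IH _ Cf) => // x; rewrite inE => Ux.
by rewrite (_ : (fun _ => _) = c \*: f)// deriveZ//; exact: dfv.
Qed.

Lemma Ck_id k U : Ck k U (id : V -> V).
Proof.
case: k => [|k]; (split; first by move=> x _; exact: cvg_id) => //.
move=> v; split; first by move=> x _; exact: derivable_id.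
suff -> : 'D_v (id : V -> V) = cst v by exact: Ck_cst.
by apply/funext => x; rewrite derive_id.
Qed.

Lemma Ck_mulmx a b c k U (f : V -> 'M[R]_(a, b)) (g : V -> 'M[R]_(b, c)) :
  open U -> Ck k U f -> Ck k U g -> Ck k U (fun x => f x *m g x).
Proof.
move=> oU /(Ck_mxP _ _ oU) Cf /(Ck_mxP _ _ oU) Cg; apply/Ck_mxP => // i j.
have H := Ck_sum (index_enum 'I_b) xpredT oU (fun l => Ck_mul oU (Cf i l) (Cg l j)).
by apply: Ck_eq H => // x _; rewrite mxE.
Qed.

Lemma Ck_opp (W : normedModType R) k U (f : V -> W) : open U ->
  Ck k U f -> Ck k U (fun x => - f x).
Proof.
move=> oU /(Ck_scale (-1) oU); apply: Ck_eq => // x _; exact: scaleN1r.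
Qed.

Lemma Ck_det n k U (f : V -> 'M[R]_n) : open U -> Ck k U f ->
  Ck k U (fun x => \det (f x)).
Proof.
move=> oU /(Ck_mxP _ _ oU) Cf.
have H := Ck_sum (index_enum _) xpredT oU (fun s : {perm 'I_n} =>
   Ck_mul oU (Ck_cst k U ((-1) ^+ s : R))
     (Ck_prod (index_enum 'I_n) xpredT oU (fun i => Cf i (s i)))).
by apply: Ck_eq H => // x _.
Qed.

Lemma Ck_invmx n k U (f : V -> 'M[R]_n) : open U ->
  (forall x, U x -> f x \in unitmx) -> Ck k U f ->
  Ck k U (fun x => invmx (f x)).
Proof.
move=> oU fu Cf; have Cf' := (Ck_mxP _ _ oU).1 Cf; apply/Ck_mxP => // i j.
have C1 : Ck k U (fun x => (\det (f x))^-1).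
  apply: Ck_inv => //; last exact: Ck_det.
  by move=> x /fu; rewrite unitmxE unitfE.
have C2 : Ck k U (fun x => (-1) ^+ (j + i) * \det (row' j (col' i (f x)))).
  apply: Ck_mul => //; first exact: Ck_cst.
  apply: Ck_det => //; apply/Ck_mxP => // a b.
  by apply: Ck_eq (Cf' (lift j a) (lift i b)) => // x _; rewrite !mxE.
apply: Ck_eq (Ck_mul oU C1 C2) => // x; rewrite inE => Ux.
by rewrite /invmx fu//= !mxE.
Qed.

End CkBasics.

Lemma diff_crit (R : realType) (V W : normedModType R) (f : V -> W)
    (df : {linear V -> W}) (x : V) :
  continuous df ->
  (forall e, 0 < e -> \forall h \near (0 : V), `|f (h + x) - f x - df h| <= e * `|h|) ->
  differentiable f x /\ 'd f x = df :> (V -> W).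
Proof.
move=> cdf H.
have E : f \o shift x = cst (f x) + df +o_ (0 : V) id.
  apply/eqaddoP => e e0; have := H e e0; apply: filterS => h /=.
  by rewrite opprD addrA.
have D := diff_unique cdf E; split=> //.
by apply/diff_locallyP; rewrite D.
Qed.

Section lines.
Context {R : realType} {V W : normedModType R}.
Implicit Types (f : V -> W) (a v : V).

Lemma line_continuous a v : continuous (fun t : R => t *: v + a).
Proof. by move=> t; exact: (cvgD (cvgZ cvg_id (cvg_cst v)) (cvg_cst a)). Qed.

Lemma near_line (S : set V) a v : nbhs a S -> \forall t \near (0 : R)^', S (t *: v + a).
Proof.
move=> Sa; apply: cvg_within.
have := @line_continuous a v (0 : R); rewrite /continuous_at scale0r add0r => H.
exact: (H S Sa).
Qed.

Lemma near_line_image (f : V -> W) (P : set W) a v : {for a, continuous f} -> nbhs 0 P ->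
  \forall t \near (0 : R)^', P (f (t *: v + a) - f a).
Proof.
move=> cf P0; apply: (near_line (S := fun y => P (f y - f a))).
have : f y - f a @[y --> a] --> f a - f a by exact: (cvgB cf (cvg_cst (f a))).
by rewrite subrr; apply.
Qed.

Lemma derivable_lineP f a v (s : R) :
  derivable f (a + s *: v) v <-> derivable (fun t : R => f (a + t *: v)) s 1.
Proof.
rewrite /derivable; set g1 := fun h => h^-1 *: _; set g2 := fun h => h^-1 *: _.
suff -> : g1 = g2 by [].
apply/funext => h; rewrite /g1 /g2 /=; congr (_ *: (f _ - _)).
by rewrite [h%:A]mulr1 scalerDl addrCA.
Qed.

Lemma derive_line f a v (s : R) :
  'D_v f (a + s *: v) = 'D_1 (fun t : R => f (a + t *: v)) s.
Proof.
rewrite /derive; set g1 := fun h => h^-1 *: _; set g2 := fun h => h^-1 *: _.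
suff -> : g1 = g2 by [].
apply/funext => h; rewrite /g1 /g2 /=; congr (_ *: (f _ - _)).
by rewrite [h%:A]mulr1 scalerDl addrCA.
Qed.

Lemma is_derive_line f a v (s : R) : derivable f (a + s *: v) v ->
  is_derive s 1 (fun t : R => f (a + t *: v)) ('D_v f (a + s *: v)).
Proof.
by move=> df; apply: DeriveDef; [exact/derivable_lineP|rewrite derive_line].
Qed.

(** Homogeneity in the direction needs no differentiability of [f] at [a]: on the line through [a]
    the map has one real variable, where derivable and differentiable agree. *)
Lemma derivable_scale_dir f a v (c : R) : derivable f a v ->
  derivable f a (c *: v) /\ 'D_(c *: v) f a = c *: 'D_v f a.
Proof.
move=> df; pose g := fun t : R => f (a + t *: v).
have dg : differentiable g 0.
  by apply/derivable1_diffP/derivable_lineP; rewrite scale0r addr0.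
have E : (fun t : R => f (a + t *: (c *: v))) = g \o ( *:%R c : R -> R).
  by apply/funext => t; rewrite /g /= scalerA mulrC.
have dl : differentiable ( *:%R c : R -> R) (0 : R).
  by apply: linear_differentiable => x; exact: scaler_continuous.
have dg' : differentiable g (c *: (0 : R)) by rewrite scaler0.
have dc := differentiable_comp dl dg'.
have Ea w : a = a + (0 : R) *: w by rewrite scale0r addr0.
split.
  by rewrite [a](Ea (c *: v)); apply/derivable_lineP; rewrite E; apply/derivable1_diffP.
rewrite [X in 'D_(c *: v) f X = _](Ea (c *: v)) derive_line E deriveE//.
rewrite diff_comp//= diff_lin; last by move=> x; exact: scaler_continuous.
rewrite scaler0 [X in _ = _ *: 'D_v f X](Ea v) derive_line deriveE// -linearZ//.
Qed.

End lines.

Section C1diff.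
Context {R : realType} {n : nat}.
Implicit Types v x : 'rV[R]_n.

Definition trunc_row (j : nat) v : 'rV[R]_n := \row_i (if (i < j)%N then v 0 i else 0).

Lemma rV_norm_le (a : nat) (M : 'rV[R]_a) (e : R) : 0 <= e ->
  `|M| <= e <-> forall i, `|M 0 i| <= e.
Proof.
move=> e0; split=> [He i|H].
  apply: le_trans He; rewrite [leRHS]/Num.Def.normr/= mx_normrE.
  by apply: le_trans; last exact: (le_bigmax _ _ (ord0, i)).
rewrite /Num.Def.normr/= mx_normrE; apply: bigmax_le => //= -[i j] _ /=.
by rewrite ord1; exact: H.
Qed.

Lemma rV_norm_ge (a : nat) (M : 'rV[R]_a) i : `|M 0 i| <= `|M|.
Proof. exact: (rV_norm_le M (normr_ge0 M)).1. Qed.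

(* Telescoping over the coordinates, each step by the mean value theorem. *)
Lemma telescope_bound (f : 'rV[R]_n -> R) x r e : 0 < r ->
  (forall i y, `|y - x| < r -> derivable f y (delta_mx 0 i)) ->
  (forall i y, `|y - x| < r ->
     `|'D_(delta_mx 0 i) f y - 'D_(delta_mx 0 i) f x| <= e) ->
  forall v, `|v| < r ->
  `|f (x + v) - f x - \sum_i v 0 i * 'D_(delta_mx 0 i) f x| <= n%:R * e * `|v|.
Proof.
move=> r0 df dfe v vr.
have e0 : (0 < n)%N -> 0 <= e.
  move=> n0; have := dfe (Ordinal n0) x; rewrite subrr normr0 => /(_ r0).
  exact: le_trans.
have trn : trunc_row n v = v by apply/rowP => i; rewrite mxE ltn_ord.
have tr0 : trunc_row 0 v = 0 by apply/rowP => i; rewrite !mxE.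
have trS (j : 'I_n) : trunc_row j.+1 v = trunc_row j v + v 0 j *: delta_mx 0 j.
  apply/rowP => i; rewrite !mxE eqxx /= ltnS leq_eqVlt.
  have [ij|ij] := eqVneq i j.
    by rewrite ij eqxx ltnn /= mulr1 add0r.
  by rewrite -val_eqE in ij; rewrite (negbTE ij) /= mulr0 addr0.
have trb (j : 'I_n) s : 0 <= s <= 1 ->
    `|trunc_row j v + (s * v 0 j) *: delta_mx 0 j| <= `|v|.
  move=> /andP[s0 s1]; apply/(rV_norm_le _ (normr_ge0 v)) => i; rewrite !mxE eqxx /=.
  have [ij|ij] := eqVneq i j.
    rewrite ij ltnn add0r mulr1 normrM ger0_norm//.
    by apply: le_trans (rV_norm_ge v j); rewrite ler_piMl.
  by rewrite mulr0 addr0; case: ifP => _; rewrite ?normr0// rV_norm_ge.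
have step (j : 'I_n) :
   `|f (x + trunc_row j.+1 v) - f (x + trunc_row j v) - v 0 j * 'D_(delta_mx 0 j) f x| <= e * `|v|.
  have e0' : 0 <= e by apply: e0; apply: leq_trans (ltn_ord j).
  pose w : 'rV[R]_n := v 0 j *: delta_mx 0 j; pose a := x + trunc_row j v.
  have aE (s : R) : a + s *: w = x + (trunc_row j v + (s * v 0 j) *: delta_mx 0 j).
    by rewrite /w scalerA addrA.
  have ab (s : R) : 0 <= s <= 1 -> `|a + s *: w - x| < r.
    by move=> s01; rewrite aE addrAC subrr add0r; apply: le_lt_trans vr; exact: trb.
  have dfw (s : R) : 0 <= s <= 1 -> derivable f (a + s *: w) w.
    by move=> s01; apply: (derivable_scale_dir _ _).1; apply: df; exact: ab.
  pose h (s : R) := f (a + s *: w).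
  have dh (s : R) : s \in `]0, 1[%R -> is_derive s 1 h ('D_w f (a + s *: w)).
    rewrite in_itv/= => /andP[/ltW s0 /ltW s1]; apply: is_derive_line.
    by apply: dfw; rewrite s0.
  have ch : {within `[(0:R), 1], continuous h}.
    apply: derivable_within_continuous => s; rewrite in_itv/= => s01.
    by apply/derivable_lineP; exact: dfw.
  have [s s01] := MVT ltr01 dh ch.
  have {}s01 : 0 <= s <= 1.
    by move: s01; rewrite in_itv/= => /andP[/ltW-> /ltW->].
  rewrite subr0 mulr1 {1 2}/h scale1r scale0r addr0.
  rewrite -{1}[w]scale1r {1}aE mul1r -trS => ->.
  rewrite (derivable_scale_dir _ _).2; last by apply: df; exact: ab.
  rewrite -[X in `|X - _|]/(v 0 j * _) -mulrBr normrM mulrC ler_pM// ?rV_norm_ge//.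
  by apply: dfe; exact: ab.
have tele (j : nat) : (j <= n)%N ->
   `|f (x + trunc_row j v) - f x - \sum_(i < n | (i < j)%N) v 0 i * 'D_(delta_mx 0 i) f x|
     <= j%:R * e * `|v|.
  elim: j => [|j IH] jn.
    by rewrite tr0 addr0 subrr big1 ?subrr ?normr0 ?mul0r.
  have := step (Ordinal jn); have {IH} := IH (ltnW jn).
  set A := f (x + trunc_row j v); set B := f (x + trunc_row j.+1 v) => /= IH ST.
  rewrite (bigD1 (Ordinal jn))//=.
  rewrite (eq_bigl (fun i : 'I_n => (i < j)%N)); last first.
    move=> i; rewrite -val_eqE /= ltnS ltn_neqAle andbC.
    by case: (_ <= _)%N.
  rewrite (_ : _ - _ = (B - A - v 0 (Ordinal jn) * 'D_(delta_mx 0 (Ordinal jn)) f x)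
    + (A - f x - \sum_(i < n | (i < j)%N) v 0 i * 'D_(delta_mx 0 i) f x)); last by ring.
  apply: le_trans (ler_normD _ _) _; rewrite -natr1 !mulrDl addrC mul1r.
  exact: lerD.
have := tele n (leqnn n); rewrite trn.
by rewrite (eq_bigl xpredT)// => i; rewrite ltn_ord.
Qed.

Lemma linear_comb_proof (c : 'I_n -> R) : linear (fun v : 'rV[R]_n => \sum_i v 0 i * c i).
Proof.
move=> k u v; rewrite scaler_sumr -big_split /=; apply: eq_bigr => i _.
by rewrite !mxE mulrDl -[_ *: (_ * _)]/(_ * (_ * _)) mulrA.
Qed.

(** Continuous partial derivatives give a differential, by [telescope_bound]. This links [Ck],
    stated with directional derivatives, to Jacobians and the chain rule. *)
Lemma C1_differentiable_scalar (f : 'rV[R]_n -> R) (U : set 'rV[R]_n) x :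
  open U -> U x -> Ck 1 U f -> differentiable f x.
Proof.
move=> oU Ux [_ dF].
have [r r0 rU] : exists2 r, 0 < r & forall y, `|y - x| < r -> U y.
  have /nbhs_ballP[r /= r0 rU] := open_nbhs_nbhs (conj oU Ux).
  by exists r => // y yr; apply: rU; rewrite -ball_normE /= distrC.
pose c i := 'D_(delta_mx 0 i) f x.
pose lM := GRing.isLinear.Build _ _ _ _ _ (linear_comb_proof c).
pose L : {linear 'rV[R]_n -> R} := HB.pack (fun v : 'rV[R]_n => \sum_i v 0 i * c i) lM.
have cL : continuous L.
  have H0 (i : 'I_n) : Ck 0 [set: 'rV[R]_n] (fun v => v 0 i * c i).
    apply: Ck_mul; [exact: openT| |exact: Ck_cst].
    by split=> // y _; exact: coord_continuous.
  by have [H _] := Ck_sum (index_enum 'I_n) xpredT openT H0; move=> y; exact: H.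
suff H : forall e, 0 < e -> \forall h \near (0 : 'rV[R]_n), `|f (h + x) - f x - L h| <= e * `|h|.
  by have [] := diff_crit cL H.
(* [telescope_bound] multiplies the oscillation of the partial derivatives by n; dividing by n + 1
   also covers n = 0. *)
move=> e e0; pose e1 := e / n.+1%:R; have e10 : 0 < e1 by rewrite divr_gt0.
have : \forall y \near x, forall i, `|'D_(delta_mx 0 i) f y - c i| <= e1.
  have N (i : 'I_n) : nbhs x [set y | `|'D_(delta_mx 0 i) f y - c i| <= e1].
    have [_ [cD _]] := dF (delta_mx 0 i).
    by have /cvgrPdist_le/(_ _ e10) := cD x Ux; apply: filterS => y; rewrite distrC.
  exact: (filter_forall _ N).
move=> /nbhs_ballP[r' /= r'0 r'U].
pose rr := Num.min r r'; have rr0 : 0 < rr by rewrite lt_min r0.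
apply/nbhs_ballP; exists rr => //= h; rewrite -ball_normE /= sub0r normrN => hrr.
rewrite (addrC h x).
have le1 : n%:R * e1 * `|h| <= e * `|h|.
  rewrite ler_wpM2r// /e1 mulrA ler_pdivrMr// mulrC ler_wpM2l ?(ltW e0)//.
  by rewrite ler_nat.
apply: le_trans le1; apply: (@telescope_bound f x rr) => //.
- move=> i y yr; have [dfi _] := dF (delta_mx 0 i); apply: dfi; apply: rU.
  by apply: lt_le_trans yr _; rewrite ge_min lexx.
- move=> i y yr; apply: r'U; rewrite -ball_normE /= distrC.
  by apply: lt_le_trans yr _; rewrite ge_min lexx orbT.
Qed.

End C1diff.

Section MatrixCalculus.
Context {R : realType}.

Lemma differentiable_mxP (V : normedModType R) a b (f : V -> 'M[R]_(a, b)) x :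
  (forall i j, differentiable (fun y => f y i j) x) -> differentiable f x.
Proof.
move=> H.
have -> : f = \sum_(ij : 'I_a * 'I_b) (fun y => f y ij.1 ij.2 *: (delta_mx ij.1 ij.2 : 'M[R]_(a, b))).
  apply/funext => y; rewrite fct_sumE {1}[f y]matrix_sum_delta pair_big.
  by apply: eq_bigr => -[].
have S (r : seq ('I_a * 'I_b)) : differentiable (\sum_(ij <- r) (fun y => f y ij.1 ij.2 *: (delta_mx ij.1 ij.2 : 'M[R]_(a, b)))) x.
  elim: r => [|ij r IH]; first by rewrite big_nil; exact: differentiable_cst.
  by rewrite big_cons; apply: differentiableD => //; apply: differentiableZl; exact: H.
exact: S.
Qed.

Lemma C1_differentiable n a b (f : 'rV[R]_n -> 'M[R]_(a, b)) (U : set 'rV[R]_n) x :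
  open U -> U x -> Ck 1 U f -> differentiable f x.
Proof.
move=> oU Ux /(Ck_mxP _ _ oU) H; apply: differentiable_mxP => i j.
exact: C1_differentiable_scalar (H i j).
Qed.

Lemma rV_delta n (v : 'rV[R]_n) : v = \sum_i v 0 i *: delta_mx 0 i.
Proof. by rewrite {1}[v]matrix_sum_delta big_ord1. Qed.

(** Only the outer map has to be differentiable: restricting to the line through [x] turns the inner
    one into a function of a real variable. *)
Lemma derive_comp (V V' W : normedModType R) (f : V -> V') (g : V' -> W) x v :
  derivable f x v -> differentiable g (f x) ->
  is_derive x v (g \o f) ('D_('D_v f x) g (f x)).
Proof.
move=> df dg; pose l := fun t : R => f (x + t *: v).
have E : (fun t : R => (g \o f) (x + t *: v)) = g \o l by [].
have x0 : x = x + (0 : R) *: v by rewrite scale0r addr0.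
have dl : differentiable l 0.
  by apply/derivable1_diffP/derivable_lineP; rewrite -x0.
have l0 : l 0 = f x by rewrite /l -x0.
have dgl : differentiable g (l 0) by rewrite l0.
have dc := differentiable_comp dl dgl.
apply: DeriveDef.
  by rewrite x0; apply/derivable_lineP; rewrite E; exact/derivable1_diffP.
rewrite [X in 'D_v _ X = _]x0 derive_line E deriveE// diff_comp//= l0.
rewrite (deriveE _ dg); congr ('d g (f x) _).
by rewrite -(deriveE _ dl) /l -derive_line -x0.
Qed.

Lemma derive_coord_sum n (W : normedModType R) (g : 'rV[R]_n -> W) x v :
  differentiable g x -> 'D_v g x = \sum_i v 0 i *: 'D_(delta_mx 0 i) g x.
Proof.
move=> dg; rewrite deriveE// {1}(rV_delta v) linear_sum; apply: eq_bigr => i _.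
by rewrite linearZ deriveE.
Qed.

(** The source is any normed space, so that the same lemma serves coordinate changes and curves. The
    derivative of the composite is the sum of the coordinates of ['D_v f] times the partial
    derivatives of [g] along [f], to which the induction applies. *)
Lemma Ck_comp (V : normedModType R) m k (U : set V) (U' : set 'rV[R]_m)
    (f : V -> 'rV[R]_m) (g : 'rV[R]_m -> R) : open U -> open U' ->
  (forall x, U x -> U' (f x)) -> Ck k U f -> Ck k U' g -> Ck k U (g \o f).
Proof.
move=> oU oU' fU; elim: k f g fU => [|k IH] f g fU Cf Cg.
  by split=> // x Ux; apply: continuous_comp; [exact: Cf.1|exact: (Cg.1 _ (fU _ Ux))].
have dg y : U' y -> differentiable g y.
  move=> U'y; apply: (C1_differentiable_scalar oU' U'y).
  by elim: (k) Cg => [//|k' IH'] Cg; apply: IH'; exact: CkW.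
split; first by move=> x Ux; apply: continuous_comp; [exact: Cf.1|exact: (Cg.1 _ (fU _ Ux))].
have [_ dF] := Cf; have [_ dG] := Cg.
move=> v; have [dfv Cfv] := dF v; split.
  by move=> x Ux; have [] := derive_comp (dfv x Ux) (dg _ (fU _ Ux)).
have H := Ck_sum (index_enum 'I_m) xpredT oU (fun i =>
  Ck_mul oU ((Ck_mxP _ _ oU).1 Cfv 0 i)
    (IH f ('D_(delta_mx 0 i) g) fU (CkW Cf) (dG (delta_mx 0 i)).2)).
apply: Ck_eq H => // x; rewrite inE => Ux /=.
have [_ ->] := derive_comp (dfv x Ux) (dg _ (fU _ Ux)).
by rewrite (derive_coord_sum _ (dg _ (fU _ Ux))).
Qed.

Lemma Ck_comp_mx (V : normedModType R) m a b k (U : set V) (U' : set 'rV[R]_m)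
    (f : V -> 'rV[R]_m) (g : 'rV[R]_m -> 'M[R]_(a, b)) : open U -> open U' ->
  (forall x, U x -> U' (f x)) -> Ck k U f -> Ck k U' g -> Ck k U (g \o f).
Proof.
move=> oU oU' fU Cf /(Ck_mxP _ _ oU') Cg; apply/Ck_mxP => // i j.
exact: (Ck_comp oU oU' fU Cf (Cg i j)).
Qed.

Lemma Ck_jacobian n m k (U : set 'rV[R]_n) (f : 'rV[R]_n -> 'rV[R]_m) :
  open U -> Ck k.+1 U f -> Ck k U (jacobian f).
Proof.
move=> oU Cf; apply/Ck_mxP => // i j.
have [_ dF] := Cf; have [_ Cfi] := dF (delta_mx 0 i).
apply: Ck_eq ((Ck_mxP _ _ oU).1 Cfi 0 j) => // x; rewrite inE => Ux.
have dfx : differentiable f x.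
  apply: (C1_differentiable oU Ux).
  by elim: (k) Cf => [//|k' IH'] Cg; apply: IH'; exact: CkW.
by rewrite deriveEjacobian// -rowE mxE.
Qed.

Lemma jacobian_comp n m l (f : 'rV[R]_n -> 'rV[R]_m) (g : 'rV[R]_m -> 'rV[R]_l) x :
  differentiable f x -> differentiable g (f x) ->
  'J (g \o f) x = 'J f x *m 'J g (f x).
Proof.
move=> df dg; apply/row_matrixP => i; rewrite !rowE.
rewrite -deriveEjacobian; last exact: differentiable_comp.
have [_ ->] := derive_comp (v := delta_mx 0 i) (diff_derivable df) dg.
by rewrite !deriveEjacobian// mulmxA.
Qed.

Lemma near_eq_jacobian n m (f g : 'rV[R]_n -> 'rV[R]_m) x :
  (\forall y \near x, f y = g y) -> differentiable f x -> differentiable g x /\ 'J g x = 'J f x.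
Proof.
move=> fg df; have dg : differentiable g x.
  have H e : 0 < e -> \forall h \near (0 : 'rV[R]_n), `|g (h + x) - g x - 'd f x h| <= e * `|h|.
    move=> e0; have := diff_locally df; move/eqaddoP => /(_ e e0).
    have : \forall h \near (0 : 'rV[R]_n), f (h + x) = g (h + x).
      by move: fg; rewrite (near_shift 0) /= subr0.
    apply: filterS2 => h <- /=; rewrite -(nbhs_singleton fg) opprD addrA.
    exact.
  by have [] := diff_crit (diff_continuous df) H.
split; first exact: dg.
apply/row_matrixP => i.
transitivity ('D_(delta_mx 0 i) g x); first by rewrite rowE (deriveEjacobian _ dg).
transitivity ('D_(delta_mx 0 i) f x); last by rewrite rowE (deriveEjacobian _ df).
exact: (esym (near_eq_derive _ fg)).
Qed.

End MatrixCalculus.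

(** * The inverse function theorem *)

Section InverseFunction.
Context {R : realType} {n : nat}.
Implicit Types (x y z v : 'rV[R]_n) (U : set 'rV[R]_n) (f : 'rV[R]_n -> 'rV[R]_n).

Lemma smooth_differentiable m a b (U : set 'rV[R]_m) (g : 'rV[R]_m -> 'M[R]_(a, b)) (x : 'rV[R]_m) :
  open U -> U x -> smooth_on U g -> differentiable g x.
Proof. by move=> oU Ux sg; exact: (C1_differentiable oU Ux (sg 1%N)). Qed.

Lemma mulmx_norm_le (a b : nat) (v : 'rV[R]_a) (A : 'M[R]_(a, b)) :
  `|v *m A| <= a%:R * `|A| * `|v|.
Proof.
apply/rV_norm_le; first by rewrite !mulr_ge0.
move=> j; rewrite mxE; apply: le_trans (ler_norm_sum _ _ _) _.
have -> : a%:R * `|A| * `|v| = \sum_(i < a) `|A| * `|v|.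
  by rewrite sumr_const card_ord -mulrA mulr_natl.
apply: ler_sum => i _; rewrite normrM mulrC ler_pM//; last exact: rV_norm_ge.
rewrite [leRHS]/Num.Def.normr/= mx_normrE.
by apply: le_trans; last exact: (le_bigmax _ _ (i, j)).
Qed.

(** The map x - f x has Jacobian 0 at [x0], hence a small one nearby; the mean value theorem on
    segments, one coordinate at a time, makes it a contraction. *)
Lemma contraction_near_identity U f x0 : open U -> U x0 -> Ck 1 U f ->
  'J f x0 = 1%:M ->
  exists2 r, 0 < r & (forall x, `|x - x0| <= r -> U x /\ 'J f x \in unitmx) /\
  forall x y, `|x - x0| <= r -> `|y - x0| <= r ->
    `|(x - f x) - (y - f y)| <= 2^-1 * `|x - y|.
Proof.
move=> oU Ux0 Cf J1.
have df x : U x -> differentiable f x by move=> Ux; exact: (C1_differentiable oU Ux Cf).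
have [cJ _] := Ck_jacobian oU Cf.
(* [mulmx_norm_le] costs a factor n in the sup norm, so this bound on the Jacobian gives the ratio
   1/2. *)
pose e : R := (n.+1%:R * 2)^-1.
have e0 : 0 < e by rewrite invr_gt0 mulr_gt0.
have N1 : nbhs x0 [set x | `|'J f x0 - 'J f x| <= e].
  by have /cvgrPdist_le/(_ _ e0) := cJ x0 Ux0.
have N2 : nbhs x0 [set x | \det ('J f x) != 0].
  have [cd _] := Ck_det oU (Ck_jacobian oU Cf).
  have /cvgrPdist_lt/(_ _ ltr01) := cd x0 Ux0.
  apply: filterS => x /=; rewrite J1 det1 => H.
  by apply: contraTneq H => ->; rewrite subr0 normr1 ltxx.
have N3 := open_nbhs_nbhs (conj oU Ux0).
have [r /= r0 rB] := (nbhs_ballP _ _).1 (filterI N1 (filterI N2 N3)).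
have B x : `|x - x0| <= r / 2 -> [/\ `|'J f x0 - 'J f x| <= e, \det ('J f x) != 0 & U x].
  move=> xr; have /rB[/= ? [? ?]] : ball x0 r x.
    by rewrite -ball_normE /= distrC; lra.
  by split.
exists (r / 2); first by rewrite divr_gt0.
split.
  by move=> x /B[_ d0 Ux]; split=> //; rewrite unitmxE unitfE.
move=> x y xr yr; have [v vE] : exists v, v = x - y by exists (x - y).
have seg (s : R) : 0 <= s <= 1 -> `|y + s *: v - x0| <= r / 2.
  move=> /andP[s0 s1].
  have -> : y + s *: v - x0 = (1 - s) *: (y - x0) + s *: (x - x0).
    by rewrite vE; apply/rowP => i; rewrite !mxE; ring.
  apply: le_trans (ler_normD _ _) _; rewrite !normrZ !ger0_norm ?subr_ge0//.
  apply: (@le_trans _ _ ((1 - s) * (r / 2) + s * (r / 2))); last by lra.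
  by apply: lerD; rewrite ler_wpM2l// subr_ge0.
apply/rV_norm_le; first by rewrite mulr_ge0.
move=> i.
pose phi := fun z : 'rV[R]_n => z 0 i - f z 0 i.
have dphi s : 0 <= s <= 1 -> differentiable phi (y + s *: v).
  move=> /seg/B[_ _ Uz]; apply: differentiableB; first exact: differentiable_coord.
  exact: (differentiable_comp (df _ Uz) (differentiable_coord _ _ _)).
have Dphi s : 0 <= s <= 1 -> 'D_v phi (y + s *: v) = (v *m ('J f x0 - 'J f (y + s *: v))) 0 i.
  move=> s01; have [_ _ Uz] := B _ (seg _ s01).
  have dfz := diff_derivable (v := v) (df _ Uz).
  have dfi := (derivable_mxP _ _ _).1 dfz 0 i.
  have did : derivable (fun z : 'rV[R]_n => z 0 i) (y + s *: v) v.
    have : derivable (id : 'rV[R]_n -> 'rV[R]_n) (y + s *: v) v by exact: derivable_id.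
    by move=> /derivable_mxP/(_ 0 i).
  rewrite /phi (_ : (fun _ => _) = (fun z : 'rV[R]_n => z 0 i) - (fun z => f z 0 i))//.
  rewrite deriveB// mulmxBr J1 mulmx1 !mxE; congr (_ - _).
    have did' : derivable (id : 'rV[R]_n -> 'rV[R]_n) (y + s *: v) v by exact: derivable_id.
    have := derive_mx did' => /matrixP/(_ 0 i).
    by rewrite mxE derive_id => ->.
  have := derive_mx dfz => /matrixP/(_ 0 i).
  by rewrite mxE (deriveEjacobian _ (df _ Uz)) mxE => ->.
have dh (s : R) : s \in `]0, 1[%R ->
    is_derive s 1 (fun t : R => phi (y + t *: v)) ('D_v phi (y + s *: v)).
  rewrite in_itv/= => /andP[/ltW s0 /ltW s1]; apply: is_derive_line.
  by apply: diff_derivable; apply: dphi; rewrite s0.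
have ch : {within `[(0:R), 1], continuous (fun t : R => phi (y + t *: v))}.
  apply: derivable_within_continuous => s; rewrite in_itv/= => s01.
  by apply/derivable_lineP; apply: diff_derivable; exact: dphi.
have [s s01] := MVT ltr01 dh ch.
have {}s01 : 0 <= s <= 1.
  by move: s01; rewrite in_itv/= => /andP[/ltW-> /ltW->].
have xE : x = y + v by rewrite vE addrC subrK.
rewrite -vE subr0 mulr1 /= scale1r scale0r addr0 -xE.
rewrite {1 2}/phi => E; rewrite !mxE E Dphi//.
have [Je _ _] := B _ (seg _ s01).
apply: le_trans (rV_norm_ge _ i) _; apply: le_trans (mulmx_norm_le _ _) _.
rewrite ler_wpM2r//; apply: (@le_trans _ _ (n%:R * e)).
  by rewrite ler_wpM2l.
rewrite /e invfM mulrA ler_piMl ?invr_ge0//.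
by rewrite ler_pdivrMr// mul1r ler_nat.
Qed.

Lemma compact_closed_ball x0 r : compact [set x : 'rV[R]_n | `|x - x0| <= r].
Proof.
apply: bounded_closed_compact.
  exists (`|x0| + r); split; first by rewrite num_real.
  move=> M hM x /= xr; apply: le_trans (ltW hM).
  by rewrite -[x](subrK x0) addrC (le_trans (ler_normD _ _))// lerD.
rewrite (_ : [set _ | _] = (fun x => `|x - x0|) @^-1` [set s | s <= r])//.
apply: preimage_closed; last exact: closed_le.
by move=> x _; exact: (cvg_norm (cvgB cvg_id (cvg_cst x0))).
Qed.

(** Solving f x = z amounts to finding a fixed point of x |-> z + (x - f x), a contraction of the
    ball. The normalization of the Jacobian is arranged by the caller. *)
Lemma local_inverse U f x0 : open U -> U x0 -> smooth_on U f -> 'J f x0 = 1%:M ->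
  exists (r s : R) (h : 'rV[R]_n -> 'rV[R]_n),
  0 < r /\ 0 < s /\ [/\ (forall x, `|x - x0| <= r -> U x),
    (forall z, `|z - f x0| < s -> `|h z - x0| < r /\ f (h z) = z),
    (forall x, `|x - x0| <= r -> `|f x - f x0| < s -> h (f x) = x) &
    smooth_on [set z | `|z - f x0| < s] h].
Proof.
move=> oU Ux0 sf J1.
have [r r0 [rU ctr]] := contraction_near_identity oU Ux0 (sf 1%N) J1.
have df x : `|x - x0| <= r -> differentiable f x.
  by move=> /rU[Ux _]; exact: (smooth_differentiable oU Ux).
have inj x y : `|x - x0| <= r -> `|y - x0| <= r -> `|x - y| <= 2 * `|f x - f y|.
  move=> xr yr; have := ctr x y xr yr.
  have : `|x - y| <= `|(x - f x) - (y - f y)| + `|f x - f y|.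
    apply: le_trans (ler_normD _ _); rewrite le_eqVlt; apply/orP; left; apply/eqP; congr (`|_|).
    by apply/rowP => i; rewrite !mxE; ring.
  by lra.
(* The contraction moves points by at most r/2 from the image of the centre, so targets within r/2
   of f x0 keep it inside the ball. *)
pose s := r / 2; have s0 : 0 < s by rewrite divr_gt0.
have fix_ z : `|z - f x0| < s -> exists x, `|x - x0| < r /\ f x = z.
  move=> zs; pose T x := z + (x - f x).
  have Tr x : `|x - x0| <= r -> `|T x - x0| < r.
    move=> xr; have := ctr x x0 xr; rewrite subrr normr0 => /(_ (ltW r0)) H.
    have -> : T x - x0 = (z - f x0) + ((x - f x) - (x0 - f x0)).
      by apply/rowP => i; rewrite !mxE; ring.
    apply: le_lt_trans (ler_normD _ _) _; move: zs; rewrite /s => zs.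
    by lra.
  have Tc x y : `|x - x0| <= r -> `|y - x0| <= r -> `|T x - T y| <= 2^-1 * `|x - y|.
    move=> xr yr; rewrite (_ : T x - T y = (x - f x) - (y - f y)); first exact: ctr.
    by apply/rowP => i; rewrite !mxE; ring.
  pose B := [set x : 'rV[R]_n | `|x - x0| <= r].
  have cT : {within B, continuous (fun x => `|T x - x|)}.
    apply: continuous_in_subspaceT => x; rewrite inE => xr.
    have cfx := differentiable_continuous (df _ xr).
    have c1 : T y @[y --> x] --> T x.
      exact: (cvgD (cvg_cst z) (cvgB cvg_id cfx)).
    exact: (cvg_norm (cvgB c1 cvg_id)).
  (* The fixed point is a minimizer of the displacement on the compact ball: applying the
     contraction once more would halve a nonzero minimum. *)
  have [|p] := EVT_min_rV _ (@compact_closed_ball x0 r) cT.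
    by exists x0; rewrite /= subrr normr0 ltW.
  rewrite inE /= => pr pmin; exists p.
  have Tp : T p = p.
    have := pmin (T p); rewrite inE /= => /(_ (ltW (Tr _ pr))).
    have := Tc (T p) p (ltW (Tr _ pr)) pr.
    move=> H1 H2; apply/eqP; rewrite -subr_eq0 -normr_eq0 eq_le normr_ge0 andbT.
    by lra.
  split; first by rewrite -Tp; exact: Tr.
  have E : z - f p = T p - p by apply/rowP => i; rewrite !mxE; ring.
  by apply/esym/eqP; rewrite -subr_eq0 E Tp subrr.
pose h z := xget x0 [set x | `|x - x0| < r /\ f x = z].
have hP z : `|z - f x0| < s -> `|h z - x0| < r /\ f (h z) = z.
  by move=> /fix_[x Hx]; exact: (xgetPex x0 (ex_intro [set x | `|x - x0| < r /\ f x = z] x Hx)).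
have hf x : `|x - x0| <= r -> `|f x - f x0| < s -> h (f x) = x.
  move=> xr /hP[/ltW hr E]; have := inj _ _ hr xr; rewrite E subrr normr0 mulr0.
  by rewrite normr_le0 subr_eq0 => /eqP.
exists r, s, h; split=> //; split=> //; split=> //; first by move=> x /rU[].
pose S := [set z | `|z - f x0| < s].
have oS : open S.
  rewrite (_ : S = (fun z => `|z - f x0|) @^-1` [set t | t < s])//.
  apply: open_comp; last exact: open_lt.
  by move=> z _; exact: (cvg_norm (cvgB cvg_id (cvg_cst (f x0)))).
have lip z w : S z -> S w -> `|h z - h w| <= 2 * `|z - w|.
  move=> /hP[/ltW h1 E1] /hP[/ltW h2 E2]; have := inj _ _ h1 h2.
  by rewrite E1 E2.
have ch (z : 'rV[R]_n) : S z -> h w @[w --> z] --> h z.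
  move=> Sz; apply/(continuous_distP h) => e e0.
  have N := open_nbhs_nbhs (conj oS Sz).
  have : nbhs z [set w | `|z - w| <= e / 2].
    by apply/(nbhs_ballP z); exists (e / 2); rewrite /= ?divr_gt0// => w; rewrite -ball_normE => /ltW.
  by apply: filterS2 N => w Sw /= zw; have := lip _ _ Sz Sw; lra.
have su x : `|x - x0| <= r -> 'J f x \in unitmx by move=> /rU[].
(* The linearization error of [f] at h z is small compared with the increment of [h], which is at
   most twice the increment of z by [lip]; applying the inverse Jacobian gives the derivative of
   [h]. *)
have dh z v : S z -> is_derive z v h (v *m invmx ('J f (h z))).
  move=> Sz; have [/ltW xr fx] := hP _ Sz.
  set x := h z in xr fx *; set A := 'J f x; have Au : A \in unitmx by exact: su.
  suff L : t^-1 *: (h (t *: v + z) - h z) @[t --> (0:R)^'] --> v *m invmx A.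
    by apply: DeriveDef; [apply/cvg_ex; exists (v *m invmx A)|exact: cvg_lim].
  pose C := n%:R * `|invmx A| * (2 * `|v|) + 1.
  have C0 : 0 < C by rewrite ltr_wpDl// !mulr_ge0.
  apply/cvgrPdist_le => e e0; pose e' := e / C; have e'0 : 0 < e' by rewrite divr_gt0.
  have := diff_locally (df _ xr); move/eqaddoP => /(_ e' e'0) N1.
  have N2 : \forall t \near (0:R)^', S (t *: v + z).
    by apply: near_line; exact: open_nbhs_nbhs.
  have N3 : \forall t \near (0:R)^', `|(f \o shift x - (cst (f x) + 'd f x)) (h (t *: v + z) - x)| <= e' * `|h (t *: v + z) - x|.
    pose P : set 'rV[R]_n := [set k : 'rV[R]_n | `|(f \o shift x - (cst (f x) + 'd f x)) k| <= e' * `|k|].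
    have P0 : nbhs (0 : 'rV[R]_n) P by exact: N1.
    exact: (near_line_image (f := h) (P := P) (a := z) v (ch z Sz) P0).
  near=> t; have t0 : t != 0 by near: t; exact: nbhs_dnbhs_neq.
  have St : S (t *: v + z) by near: t.
  have : `|(f \o shift x - (cst (f x) + 'd f x)) (h (t *: v + z) - x)| <= e' * `|h (t *: v + z) - x|.
    by near: t.
  set w := h (t *: v + z) - x => H.
  have := lip _ _ St Sz; rewrite addrK normrZ -/x -/w => H2.
  have [hr fh] := hP _ St.
  have E : (f \o shift x - (cst (f x) + 'd f x)) w = t *: v - w *m A.
    rewrite /= -[LHS]/(f (w + x) - (f x + 'd f x w)) /w subrK fh fx -/w.
    rewrite opprD addrA addrK; congr (_ - _).
    by rewrite -deriveE ?deriveEjacobian//; exact: df.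
  rewrite E in H; set rho := t *: v - w *m A in H.
  have W : w = t *: (v *m invmx A) - rho *m invmx A.
    by rewrite /rho mulmxBl -scalemxAl opprB addrC subrK mulmxK.
  have -> : v *m invmx A - t^-1 *: w = t^-1 *: (rho *m invmx A).
    by rewrite W scalerBr scalerA mulVf// scale1r opprB addrC subrK.
  rewrite normrZ normfV ler_pdivrMl ?normr_gt0//.
  apply: le_trans (mulmx_norm_le _ _) _.
  have H3 : `|rho| <= e' * (2 * (`|t| * `|v|)) by apply: le_trans H _; rewrite ler_wpM2l// ltW.
  apply: (@le_trans _ _ (n%:R * `|invmx A| * (e' * (2 * (`|t| * `|v|))))).
    by rewrite ler_wpM2l// mulr_ge0.
  rewrite (_ : n%:R * `|invmx A| * (e' * (2 * (`|t| * `|v|))) = `|t| * (e' * (n%:R * `|invmx A| * (2 * `|v|)))); last by ring.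
  rewrite ler_wpM2l// /e' mulrAC ler_pdivrMr// ler_wpM2l ?ltW//.
  by rewrite /C ltrDl.
(* Bootstrapping: the derivative of [h] is a smooth function composed with [h], so [h] gains one
   class of smoothness at each step. *)
elim=> [|k IH]; first by split.
split=> // v; split; first by move=> z Sz; have [] := dh z v Sz.
pose B := [set x : 'rV[R]_n | `|x - x0| < r].
have oB : open B.
  rewrite (_ : B = (fun z => `|z - x0|) @^-1` [set t | t < r])//.
  apply: open_comp; last exact: open_lt.
  by move=> z _; exact: (cvg_norm (cvgB cvg_id (cvg_cst x0))).
have BU : B `<=` U by move=> x /ltW/rU[].
have CJ : Ck k B (fun x => v *m invmx ('J f x)).
  apply: Ck_mulmx => //; first exact: Ck_cst.
  apply: Ck_invmx => //; first by move=> x /ltW/su.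
  by apply: Ck_jacobian => //; apply: Ck_sub (sf _).
apply: Ck_eq (Ck_comp_mx oS oB _ IH CJ) => //.
  by move=> z; rewrite inE => Sz; have [_ ->] := dh z v Sz.
by move=> z /hP[].
Unshelve. all: by end_near.
Qed.

End InverseFunction.

(** * Charts and adapted charts *)

Section Charts.
Context {R : realType}.

Lemma open_norm_lt (V : normedModType R) (a : V) (r : R) : open [set w : V | `|w - a| < r].
Proof.
rewrite (_ : [set _ | _] = (fun w => `|w - a|) @^-1` [set t | t < r])//.
apply: open_comp; last exact: open_lt.
by move=> w _; exact: (cvg_norm (cvgB cvg_id (cvg_cst a))).
Qed.

Lemma open_norm_lt0 (V : normedModType R) (r : R) : open [set w : V | `|w| < r].
Proof.
rewrite (_ : [set w : V | `|w| < r] = [set w : V | `|w - 0| < r]); first exact: open_norm_lt.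
by apply/seteqP; split=> w /=; rewrite subr0.
Qed.

Lemma chart_preimage_open (T : topologicalType) n (c : chart R T n) (W : set 'rV[R]_n) :
  open W -> open (dom c `&` c @^-1` W).
Proof.
move=> oW; rewrite openE => x [dx Wx]; apply: filterI.
  exact: open_nbhs_nbhs (conj (dom_open c) dx).
by apply: (cmap_continuous dx); exact: open_nbhs_nbhs.
Qed.

Lemma cmap_cinv (T : topologicalType) n (c : chart R T n) w :
  [set c x | x in dom c] w -> dom c (cinv c w) /\ c (cinv c w) = w.
Proof. by move=> [x dx <-]; rewrite cmapK. Qed.

Lemma cinv_continuous_at (T : topologicalType) n (c : chart R T n) w :
  [set c x | x in dom c] w -> {for w, continuous (cinv c)}.
Proof. by move=> [x dx <-]; exact: cinv_continuous. Qed.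

Lemma cimg_open (T : topologicalType) n (c : chart R T n) (U : set T) :
  open U -> open (cimg c U).
Proof.
move=> oU; rewrite openE => w [x [Ux dx] <-].
have cx : [set c x | x in dom c] (c x) by exists x.
have N1 := open_nbhs_nbhs (conj (@cod_open _ _ _ c) cx).
have N2 : nbhs (c x) (cinv c @^-1` U).
  by apply: (cinv_continuous dx); rewrite cmapK//; exact: open_nbhs_nbhs.
apply: filterS2 N1 N2 => w' /cmap_cinv[dw cw] Uw'.
by exists (cinv c w').
Qed.

Lemma cimgP (T : topologicalType) n (c : chart R T n) (U : set T) w :
  cimg c U w <-> [set c x | x in dom c] w /\ U (cinv c w).
Proof.
split=> [[x [Ux dx] <-]|[[x dx <-]]].
  by rewrite cmapK//; split=> //; exists x.
by rewrite cmapK// => Ux; exists x.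
Qed.

Lemma jacobianP m n (f : 'rV[R]_m -> 'rV[R]_n) x (B : 'M[R]_(m, n)) :
  differentiable f x -> (forall v, 'D_v f x = v *m B) -> 'J f x = B.
Proof.
move=> df H; apply/row_matrixP => i.
by rewrite !rowE -H (deriveEjacobian _ df).
Qed.

Lemma mulmx_Ck m n k (U : set 'rV[R]_m) (A : 'M[R]_(m, n)) : open U ->
  Ck k U (fun z : 'rV[R]_m => z *m A).
Proof. by move=> oU; apply: Ck_mulmx => //; [exact: Ck_id|exact: Ck_cst]. Qed.

Lemma derive_mulmx (V : normedModType R) m n (f : V -> 'rV[R]_m) (A : 'M[R]_(m, n)) x v :
  derivable f x v -> is_derive x v (fun y => f y *m A) ('D_v f x *m A).
Proof.
move=> df.
have dg : differentiable (fun z : 'rV[R]_m => z *m A) (f x).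
  by apply: (smooth_differentiable openT) => // k; apply: mulmx_Ck; exact: openT.
have := derive_comp df dg.
suff -> : 'D_('D_v f x) (fun z : 'rV[R]_m => z *m A) (f x) = 'D_v f x *m A by [].
set w := 'D_v f x.
rewrite -[f x]addr0 -(scale0r w) derive_line.
have -> : (fun t : R => (f x + t *: w) *m A) = cst (f x *m A) + (fun t : R => t *: (w *m A)).
  by apply/funext => t; rewrite mulmxDl -scalemxAl.
have dl : is_derive (0:R) 1 (fun t : R => t *: (w *m A)) (w *m A).
  have -> : (fun t : R => t *: (w *m A)) = (fun t : R => id (0 + t *: (w *m A))).
    by apply/funext => t; rewrite add0r.
  have := @is_derive_line _ _ _ id 0 (w *m A) 0; rewrite derive_id; apply.
  exact: derivable_id.
by rewrite deriveD// derive_cst add0r derive_val.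
Qed.

Lemma is_derive_subcst (V W : normedModType R) (f : V -> W) (a : W) x v :
  derivable f x v -> is_derive x v (fun y => f y - a) ('D_v f x).
Proof.
move=> df; have dc := derivable_cst a x v.
by apply: DeriveDef; [exact: derivableB|rewrite (deriveB df dc) derive_cst subr0].
Qed.

(** The missing p columns are a basis of a complement of the column space. The cast is there because
    the rank of that complement is p only propositionally. *)
Lemma row_full_completion p q (J : 'M[R]_(p + q, q)) : row_full J ->
  exists A : 'M[R]_(p + q, p), row_mx A J \in unitmx.
Proof.
move=> fJ.
have rT : \rank (J^T) = q by rewrite mxrank_tr; apply/eqP.
have rC : \rank ((J^T)^C)%MS = p by rewrite mxrank_compl rT addnK.
pose A' := castmx (rC, erefl (p + q)%N) (row_base ((J^T)^C)%MS).
have eA : (A' :=: (J^T)^C)%MS.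
  by apply: eqmx_trans (eq_row_base _); exact: eqmx_cast.
exists (A'^T).
rewrite -unitmx_tr tr_row_mx trmxK -row_full_unit.
rewrite -sub1mx -addsmxE; apply: submx_trans (addsmxS _ (submx_refl _)); last first.
  by rewrite eA; exact: submx_refl.
by rewrite addsmxC sub1mx; exact: addsmx_compl_full.
Qed.

End Charts.

Section Rechart.
Context {R : realType} {n : nat} {M : manifold R n}.

(** Maximality of the atlas enters here: a chart followed by a diffeomorphism of open sets of
    coordinates is compatible with every chart, hence is itself in the atlas. *)
Lemma rechart (c : chart R M n) (Phi G : 'rV[R]_n -> 'rV[R]_n) (D E : set 'rV[R]_n) :
  atlas M c -> open D -> open E -> D `<=` [set c x | x in dom c] ->
  smooth_on D Phi -> smooth_on E G ->
  (forall z, D z -> E (Phi z) /\ G (Phi z) = z) ->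
  (forall w, E w -> D (G w) /\ Phi (G w) = w) ->
  exists d : chart R M n, [/\ atlas M d, dom d = dom c `&` c @^-1` D,
    cmap d = Phi \o c, cinv d = cinv c \o G & [set d x | x in dom d] = E].
Proof.
move=> ac oD oE Dc sP sG PG GP.
pose dm := dom c `&` c @^-1` D.
have odm : open dm by exact: chart_preimage_open.
have codE : [set (Phi \o c) x | x in dm] = E.
  apply/seteqP; split=> [w [x [dx Dx] <-]|w Ew]; first by have [] := PG _ Dx.
  have [DG PGw] := GP _ Ew; have [dw cw] := cmap_cinv (Dc _ DG).
  by exists (cinv c (G w)); rewrite /dm /= ?cw.
have K x : dm x -> (cinv c \o G) ((Phi \o c) x) = x.
  by move=> [dx Dx] /=; rewrite (PG _ Dx).2 cmapK.
have cc x : dm x -> {for x, continuous (Phi \o c)}.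
  move=> [dx Dx]; apply: continuous_comp; first exact: cmap_continuous.
  by have [+ _] := sP 0%N; exact.
have ci x : dm x -> {for (Phi \o c) x, continuous (cinv c \o G)}.
  move=> [dx Dx]; have [Ex Gx] := PG _ Dx; apply: continuous_comp.
    by have [+ _] := sG 0%N; exact.
  by rewrite Gx; exact: cinv_continuous.
have oc : open [set (Phi \o c) x | x in dm] by rewrite codE.
pose d := Chart odm oc K cc ci.
exists d; split=> //; apply: atlas_maximal => e ae.
have [s1 s2] := atlas_compatible ac ae.
have doe := dom_open e; have doc := dom_open c.
split=> k.
  have Ck1 : Ck k (cimg d (dom e)) G.
    apply: Ck_sub (sG k) => w [x [ex dx] <-]; exact: (PG _ dx.2).1.
  have fU w : cimg d (dom e) w -> cimg c (dom e) (G w).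
    by move=> [x [ex dx] <-]; exists x; [split=> //; exact: dx.1|rewrite /= (PG _ dx.2).2].
  have E1 : trans d e = trans c e \o G by [].
  rewrite E1.
  exact: (Ck_comp_mx (cimg_open (c := d) doe) (cimg_open (c := c) doe) fU Ck1 (s1 k)).
have Ck1 : Ck k (cimg e (dom d)) (trans e c).
  apply: Ck_sub (s2 k) => w [x [dx ex] <-]; exists x => //; split=> //; exact: dx.1.
have fU w : cimg e (dom d) w -> D (trans e c w).
  by move=> [x [dx ex] <-]; rewrite /trans /= cmapK//; exact: dx.2.
have E1 : trans e d = Phi \o trans e c by [].
rewrite E1; exact: (Ck_comp_mx (cimg_open (c := e) odm) oD fU Ck1 (sP k)).
Qed.

End Rechart.

Section Adapted.
Context {R : realType} {p q : nat} {M : manifold R (p + q)}.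
Implicit Types (F : foliation M) (c : chart R M (p + q)).

Record adapted F c (r : R) : Prop := Adapted {
  adapted_atlas : atlas M c;
  adapted_gt0 : 0 < r;
  adapted_cod : [set c y | y in dom c] = [set w | `|w| < r];
  adapted_plaque : forall y z, dom c y -> dom c z ->
    rsubmx (c y) = rsubmx (c z) -> same_leaf F y z;
  adapted_countable : forall y,
    countable [set rsubmx (c z) | z in dom c `&` [set z | same_leaf F y z]]
}.

Lemma adapted_cinv F c r w : adapted F c r -> `|w| < r ->
  dom c (cinv c w) /\ c (cinv c w) = w.
Proof. by move=> ad wr; apply: cmap_cinv; rewrite (adapted_cod ad). Qed.

Lemma adapted_norm F c r y : adapted F c r -> dom c y -> `|c y| < r.
Proof.
move=> ad dy; have : [set c y | y in dom c] (c y) by exists y.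
by rewrite (adapted_cod ad).
Qed.

(* A submersion is completed to a local diffeomorphism by p linear functions;
   the inverse function theorem straightens its fibers. *)
Lemma adapted_exists F x (B : set M) : open B -> B x ->
  exists c r, [/\ adapted F c r, dom c `<=` B, dom c x & c x = 0].
Proof.
move=> oB Bx; have [U [f [oU Ux [sf fJ] fl fc]]] := leaf_local F x.
have [c ac dx] := atlas_cover x.
pose c0 := c x; pose ff := f \o cinv c; pose W := cimg c (U `&` B).
have oW : open W by apply: cimg_open; exact: openI.
have Wc0 : W c0 by exists x.
have sff : smooth_on W ff.
  move=> k; apply: Ck_sub (sf c ac k) => w [y [[Uy By] dy] <-].
  by exists y.
have dff : differentiable ff c0 := smooth_differentiable oW Wc0 sff.
have [A uB] := row_full_completion (fJ c x ac Ux dx).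
set J := 'J _ _ in uB; pose BB := row_mx A J.
pose Phi0 (z : 'rV[R]_(p + q)) : 'rV[R]_(p + q) := row_mx ((z - c0) *m A) (ff z - f x).
have Phi0E : Phi0 = fun z => (z - c0) *m row_mx A 0 + (ff z - f x) *m row_mx 0 1%:M.
  apply/funext => z; rewrite !mul_mx_row mulmx1 !mulmx0 add_row_mx addr0 add0r //.
have CPhi0 k : Ck k W Phi0.
  rewrite Phi0E; apply: Ck_add => //.
    apply: Ck_mulmx => //; last exact: Ck_cst.
    by apply: Ck_add => //; [exact: Ck_id|exact: Ck_cst].
  apply: Ck_mulmx => //; last exact: Ck_cst.
  by apply: Ck_add => //; exact: Ck_cst.
(* [Phi0] has the submersion as its last coordinates and becomes the chart; [Psi] only rescales it
   linearly so that its Jacobian at the centre is the identity, as [local_inverse] requires. *)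
pose Psi z := Phi0 z *m invmx BB.
have sPsi : smooth_on W Psi.
  by move=> k; apply: Ck_mulmx => //; exact: Ck_cst.
have dPhi0 : differentiable Phi0 c0 := smooth_differentiable oW Wc0 CPhi0.
have JPhi0 v : 'D_v Phi0 c0 = v *m BB.
  have d0 : derivable (id : 'rV[R]_(p + q) -> 'rV[R]_(p + q)) c0 v by exact: derivable_id.
  have [d1 D1] := is_derive_subcst c0 d0.
  have [d2 D2] := is_derive_subcst (f x) (diff_derivable (v := v) dff).
  have [e1 E1] := derive_mulmx (row_mx A 0 : 'M[R]_(p + q, p + q)) d1.
  have [e2 E2] := derive_mulmx (row_mx 0 1%:M : 'M[R]_(q, p + q)) d2.
  rewrite Phi0E (deriveD e1 e2) E1 E2.
  rewrite D1 D2 derive_id.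
  rewrite (deriveEjacobian _ dff) -/J !mul_mx_row mulmx1 !mulmx0 add_row_mx addr0 add0r.
  by rewrite -?mul_mx_row.
have J1 : 'J Psi c0 = 1%:M.
  apply: jacobianP; first exact: (smooth_differentiable oW Wc0 sPsi).
  move=> v; have [_ ->] := derive_mulmx (invmx BB) (diff_derivable (v := v) dPhi0).
  by rewrite JPhi0 mulmxK// mulmx1.
have Phi00 : Phi0 c0 = 0.
  by rewrite /Phi0 subrr mul0mx /ff /= cmapK// subrr row_mx0.
have Psi0 : Psi c0 = 0 by rewrite /Psi Phi00 mul0mx.
have [r [s [h [r0 [s0 [rW hP hK sh]]]]]] := local_inverse oW Wc0 sPsi J1.
rewrite Psi0 in hP hK sh.
pose b : R := (p + q)%:R * `|invmx BB| + 1.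
have b0 : 0 < b by rewrite ltr_wpDl// mulr_ge0.
pose rho := s / b; have rho0 : 0 < rho by rewrite divr_gt0.
have wB (w : 'rV[R]_(p + q)) : `|w| < rho -> `|w *m invmx BB - 0| < s.
  rewrite subr0 => wr; have H := mulmx_norm_le w (invmx BB); apply: (le_lt_trans H).
  apply: (@le_lt_trans _ _ (b * `|w|)); first by rewrite ler_wpM2r// /b lerDl.
  by rewrite mulrC -ltr_pdivlMr.
pose G w := h (w *m invmx BB).
pose D := W `&` [set z | `|z - c0| < r] `&` Phi0 @^-1` [set w | `|w| < rho].
have oD : open D.
  rewrite openE => z [[Wz zr] zrho]; apply: filterI.
    by apply: open_nbhs_nbhs; split=> //; apply: openI => //; exact: open_norm_lt.
  have [+ _] := CPhi0 0%N; move=> /(_ z Wz); apply.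
  by apply: open_nbhs_nbhs; split=> //; exact: open_norm_lt0.
pose E := [set w : 'rV[R]_(p + q) | `|w| < rho].
have oE : open E by exact: open_norm_lt0.
have Dc : D `<=` [set c y | y in dom c].
  by move=> z [[[y [_ dy] <-] _] _]; exists y.
have sP : smooth_on D Phi0 by move=> k; apply: Ck_sub (CPhi0 k) => z [[]].
have sG : smooth_on E G.
  move=> k; have H := mulmx_Ck k (invmx BB) oE.
  have oS : open [set z : 'rV[R]_(p + q) | `|z - 0| < s] by exact: open_norm_lt.
  exact: (Ck_comp_mx oE oS wB H (sh k)).
have PsiPhi z : Phi0 z = Psi z *m BB by rewrite /Psi mulmxKV.
have PG z : D z -> E (Phi0 z) /\ G (Phi0 z) = z.
  move=> [[Wz zr] zrho]; split=> //; rewrite /G -/(Psi z).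
  by apply: hK; [exact: ltW|exact: wB].
have GP w : E w -> D (G w) /\ Phi0 (G w) = w.
  move=> Ew; have [Gr PG'] := hP _ (wB _ Ew).
  have PGw : Phi0 (G w) = w by rewrite PsiPhi /G PG' mulmxKV.
  split=> //; split; first by split=> //; apply: rW; exact: ltW.
  by rewrite /= PGw.
have [d [ad ddom dE diE dcod]] := rechart ac oD oE Dc sP sG PG GP.
have dmU y : dom d y -> U y /\ B y.
  by rewrite ddom => -[dy [[[y' [Uy' dy'] E'] _] _]]; rewrite -(cmapK dy) -E' cmapK.
have dmc y : dom d y -> dom c y by rewrite ddom => -[].
have rsE y : dom d y -> rsubmx (d y) = f y - f x.
  by move=> dy; rewrite dE /= /Phi0 row_mxKr /ff /= cmapK//; exact: dmc.
exists d, rho; split=> //.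
- split=> //.
  + move=> y z dy dz; rewrite !rsE// => /addIr fyz.
    by apply: fl => //; [exact: (dmU y dy).1|exact: (dmU z dz).1].
  + move=> y; have := fc y => /(sub_countable _); apply.
    have -> : [set rsubmx (d z) | z in dom d `&` [set z | same_leaf F y z]] =
      (fun w => w - f x) @` [set f z | z in dom d `&` [set z | same_leaf F y z]].
      apply/seteqP; split.
        move=> w [z [dz yz] <-]; exists (f z); first by exists z.
        by rewrite rsE.
      by move=> _ [_ [z [dz yz] <-] <-]; exists z => //; rewrite rsE.
    apply: card_le_trans (card_image_le _ _) _; apply: subset_card_le.
    by move=> _ [z [dz yz] <-]; exists z => //; split=> //; exact: (dmU z dz).1.
- by move=> y /dmU[].
- by rewrite ddom; split=> //; split; [split=> //|]; rewrite /= ?subrr ?normr0// Phi00 normr0.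
- by rewrite dE.
Qed.

End Adapted.

(** * Bump functions *)

Section Flat.
Context {R : realType}.
Implicit Types P : {poly R}.

Lemma poly_expR_bound P : exists2 C : R, 0 <= C & forall x, 0 <= x -> `|P.[x]| <= C * expR x.
Proof.
exists (\sum_(i < size P) `|P`_i| * i`!%:R); first by apply: sumr_ge0 => i _; rewrite mulr_ge0.
move=> x x0; rewrite horner_coef mulr_suml; apply: le_trans (ler_norm_sum _ _ _) _.
apply: ler_sum => i _; rewrite normrM normrX (ger0_norm x0) -mulrA ler_wpM2l//.
case: (nat_of_ord i) => [|k].
  by rewrite expr0 fact0 mul1r; apply: le_trans (expR_ge1Dx _); rewrite lerDl.
have := expR_ge1Dxn k x0; set E := expR x => H.
have f0 : 0 < (k.+1)`!%:R :> R by rewrite ltr0n fact_gt0.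
rewrite mulrC -ler_pdivrMr//; apply: le_trans H; by rewrite lerDr.
Qed.

(** The polynomial factor closes the family under differentiation, with [flat_deriv] as the action
    on polynomials; smoothness is then one induction over all [P] at once. *)
Definition flat P (s : R) : R := if 0 < s then P.[s^-1] * expR (- s^-1) else 0.

Lemma flat_bound P : exists2 C : R, 0 <= C & forall s, `|flat P s| <= C * `|s|.
Proof.
have [C C0 HC] := poly_expR_bound ('X * P).
exists C => // s; rewrite /flat; case: ifP => s0; last by rewrite normr0 mulr_ge0.
have si0 : 0 <= s^-1 by rewrite invr_ge0 ltW.
have := HC _ si0; rewrite hornerM hornerX normrM (ger0_norm si0) => H.
rewrite (gtr0_norm s0) normrM (ger0_norm (expR_ge0 _)) expRN.
rewrite ler_pdivrMr ?expR_gt0// mulrAC -ler_pdivrMr// mulrC//.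
Qed.

Definition flat_deriv P : {poly R} := 'X^2 * (P - P^`()).

Lemma is_derive_flat P (s : R) : is_derive s 1 (flat P) (flat (flat_deriv P) s).
Proof.
have [s0|s0|s0] := ltgtP s 0.
- have N : \forall t \near s, cst 0 t = flat P t.
    near=> t; rewrite /flat ltNge ltW//; near: t.
    exact: (open_nbhs_nbhs (conj (@open_lt _ (0:R)) s0)).
  rewrite [flat _ s]/flat ltNge (ltW s0) /=.
  by apply: near_eq_is_derive N _.
- pose g := (fun t : R => P.[t^-1]) * (fun t : R => expR (- t^-1)).
  have N : \forall t \near s, g t = flat P t.
    near=> t; rewrite /flat ifT//; near: t.
    exact: (open_nbhs_nbhs (conj (@open_gt _ (0:R)) s0)).
  apply: near_eq_is_derive N _.
  have sn0 : s != 0 by rewrite gt_eqF.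
  have dV : is_derive s 1 (fun t : R => t^-1) (- s ^- 2 *: (1 : R)) by exact: is_deriveV.
  have dP : is_derive (s^-1) 1 (horner P) (P^`()).[s^-1].
    apply: DeriveDef; first exact: derivable_horner.
    by rewrite -derive1E -derivE.
  have d1 := is_derive1_comp dP dV.
  have dN : is_derive s 1 (fun t : R => - t^-1) (- (- s ^- 2 *: (1:R))) by exact: is_deriveN.
  have d2 := @is_derive1_comp R expR (fun t : R => - t^-1) s _ _ (is_derive_expR (- s^-1)) dN.
  apply: (is_derive_eq (is_deriveM d1 d2)).
  rewrite /flat s0 /flat_deriv hornerM hornerXn hornerD hornerN /= -![_ *: _]/(_ * _) exprVn.
  by ring.
- rewrite s0 [flat _ 0]/flat ltxx.
  have [C C0 HC] := flat_bound ('X * P).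
  (* At 0 the difference quotient is again a flat function, which tends to 0 by [flat_bound]. *)
  have E (t : R) : flat P t = t * flat ('X * P) t.
    rewrite /flat; case: ifP => t0; last by rewrite mulr0.
    by rewrite hornerM hornerX !mulrA divff ?mul1r// gt_eqF.
  suff L : h^-1 *: (flat P (h *: (1:R) + 0) - flat P 0) @[h --> (0:R)^'] --> (0:R).
    by apply: DeriveDef; [apply/cvg_ex; exists 0|exact: cvg_lim].
  apply/cvgrPdist_le => e e0; near=> h.
  have h0 : h != 0 by near: h; exact: nbhs_dnbhs_neq.
  rewrite sub0r normrN addr0 [X in flat P X]mulr1 {2}/flat ltxx subr0 E.
  rewrite -[_ *: _]/(_ * _) mulrA mulVf// mul1r; apply: le_trans (HC _) _.
  have he : `|h| <= e / (C + 1).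
    near: h; apply: dnbhs0_le; by rewrite divr_gt0// ltr_wpDl.
  apply: (@le_trans _ _ ((C + 1) * `|h|)); first by rewrite ler_wpM2r// lerDl.
  by rewrite mulrC -ler_pdivlMr// ltr_wpDl.
Unshelve. all: by end_near. Qed.

Lemma Ck_flat_comp (V : normedModType R) k (U : set V) (f : V -> R) P : open U ->
  Ck k U f -> Ck k U (fun x => flat P (f x)).
Proof.
move=> oU; elim: k P f => [|k IH] P f Cf.
  split=> // x Ux; apply: (@continuous_comp _ _ _ f (flat P)); first exact: Cf.1.
  by apply/differentiable_continuous/derivable1_diffP; have [] := is_derive_flat P (f x).
split.
  move=> x Ux; apply: (@continuous_comp _ _ _ f (flat P)); first exact: Cf.1.
  by apply/differentiable_continuous/derivable1_diffP; have [] := is_derive_flat P (f x).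
move=> v; have [_ /(_ v)[dfv Cfv]] := Cf.
have dc x : U x -> is_derive x v (flat P \o f) ('D_v f x * flat (flat_deriv P) (f x)).
  move=> Ux; have [dF DF] := is_derive_flat P (f x).
  apply: (is_derive_eq (derive_comp (dfv x Ux) ((derivable1_diffP _ _).1 dF))).
  by rewrite -[X in 'D_X _ _ = _]mulr1 -[X in 'D_X _ _ = _]/(_ *: _) (derivable_scale_dir _ dF).2 DF.
split; first by move=> x Ux; have [] := dc x Ux.
apply: Ck_eq (Ck_mul oU Cfv (IH (flat_deriv P) f (CkW Cf))) => // x; rewrite inE => Ux.
by have [_ ->] := dc x Ux.
Qed.

(** The norm is the sup norm, so a product of one-variable bumps is supported in the ball: outside
    it some coordinate annihilates its factor. *)
Lemma bump_exists n (a : 'rV[R]_n) (r : R) : 0 < r -> exists beta : 'rV[R]_n -> R,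
  [/\ smooth_on setT beta, beta a != 0 & forall z, r <= `|z - a| -> beta z = 0].
Proof.
move=> r0.
pose beta (z : 'rV[R]_n) := \prod_i (flat 1 (r - (z 0 i - a 0 i)) * flat 1 (r + (z 0 i - a 0 i))).
exists beta; split.
- move=> k.
  have Cc i : Ck k [set: 'rV[R]_n] (fun z => z 0 i - a 0 i).
    apply: Ck_add; [exact: openT| |exact: Ck_cst].
    exact: (Ck_mxP k (fun z => z) openT).1 (Ck_id k setT) 0 i.
  apply: Ck_prod; first exact: openT.
  move=> i; apply: Ck_mul; first exact: openT.
    apply: Ck_flat_comp; first exact: openT.
    apply: Ck_add; [exact: openT|exact: Ck_cst|].
    by apply: Ck_opp; [exact: openT|].
  apply: Ck_flat_comp; first exact: openT.
  by apply: Ck_add; [exact: openT|exact: Ck_cst|].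
- rewrite /beta prodf_seq_neq0; apply/allP => i _ /=.
  by rewrite subrr subr0 addr0 /flat r0 hornerC mul1r mulf_neq0// gt_eqF// expR_gt0.
- move=> z rz; have [i ri] : exists i, r <= `|z 0 i - a 0 i|.
    have zn : mx_norm (z - a) != 0 by rewrite gt_eqF// (lt_le_trans r0 rz).
    have [[i j] E] := mx_norm_neq0 zn; exists j.
    by move: rz; rewrite [X in _ <= X]E ord1 !mxE.
  rewrite /beta (bigD1 i)//=.
  have [H|H] := leP 0 (z 0 i - a 0 i).
    rewrite (ger0_norm H) in ri.
    by rewrite {1}/flat ltNge subr_le0 ri /= !mul0r.
  rewrite (ltr0_norm H) in ri.
  have -> : flat 1 (r + (z 0 i - a 0 i)) = 0.
    by rewrite /flat ifF//; apply/negbTE; rewrite -leNgt -lerBrDl sub0r lerNr.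
  by rewrite mulr0 mul0r.
Qed.

End Flat.

(** * Leaves and plaques *)

Section CountableImage.
Context {R : realType}.

(** A nondegenerate interval has positive Lebesgue measure, a countable set has measure zero. *)
Lemma countable_itv_eq (a b : R) (A : set R) : countable A ->
  (forall v, Num.min a b <= v <= Num.max a b -> A v) -> a = b.
Proof.
move=> cA H; apply: contrapT => /eqP ab.
have lt : Num.min a b < Num.max a b by rewrite lt_max !gt_min !ltxx /= orbF orbC -neq_lt.
have cI : countable [set` `[Num.min a b, Num.max a b]].
  apply: sub_countable cA; apply: subset_card_le => v /=.
  by rewrite in_itv/=; exact: H.
have := countable_lebesgue_measure0 cI.
rewrite lebesgue_measure_itv /= lte_fin lt -EFinB => /eqP.
by rewrite eqe subr_eq0 gt_eqF.
Qed.

Lemma countable_image_const n (f : R -> 'rV[R]_n) (A : set 'rV[R]_n) :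
  countable A -> (forall t, 0 <= t <= 1 -> A (f t)) ->
  (forall t, 0 <= t <= 1 -> {for t, continuous f}) -> f 0 = f 1.
Proof.
move=> cA Af cf; apply/rowP => i.
apply: (@countable_itv_eq _ _ ((fun v : 'rV[R]_n => v 0 i) @` A)).
  exact: card_le_trans (card_image_le _ _) cA.
move=> v v01; have c1 : {within `[(0:R), 1], continuous (fun t => f t 0 i)}.
  apply: continuous_in_subspaceT => t; rewrite inE/= in_itv/= => /cf c.
  exact: (continuous_comp c (@coord_continuous _ _ _ 0 i (f t))).
have [t t01 <-] := IVT ler01 c1 v01.
by exists (f t) => //; apply: Af; move: t01; rewrite in_itv/=.
Qed.

End CountableImage.

Lemma rsubmx_continuous (R : realType) (n1 n2 : nat) :
  continuous (rsubmx : 'rV[R]_(n1 + n2) -> 'rV[R]_n2).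
Proof. by move=> v; exact/differentiable_continuous/differentiable_rsubmx. Qed.

Section ChartCalculus.
Context {R : realType} {n : nat} {M : manifold R n}.
Implicit Types (c d e : chart R M n) (x : M).

Lemma trans_smooth c d : atlas M c -> atlas M d -> smooth_on (cimg c (dom d)) (trans c d).
Proof. by move=> ac ad; have [] := atlas_compatible ac ad. Qed.

Lemma trans_differentiable c d x : atlas M c -> atlas M d -> dom c x -> dom d x ->
  differentiable (trans c d) (c x).
Proof.
move=> ac ad cx dx.
apply: (smooth_differentiable (cimg_open (c := c) (dom_open d)) _ (trans_smooth ac ad)).
by exists x.
Qed.

Lemma transE c d x : dom c x -> trans c d (c x) = d x.
Proof. by move=> cx; rewrite /trans /= cmapK. Qed.

Lemma trans_jacobian_comp c d e x : atlas M c -> atlas M d -> atlas M e ->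
  dom c x -> dom d x -> dom e x ->
  'J (trans c e) (c x) = 'J (trans c d) (c x) *m 'J (trans d e) (d x).
Proof.
move=> ac ad ae cx dx ex.
have D1 := trans_differentiable ac ad cx dx.
have D2 : differentiable (trans d e) (trans c d (c x)).
  by rewrite transE//; exact: trans_differentiable.
have W : cimg c (dom d) (c x) by exists x.
have N : \forall y \near c x, (trans d e \o trans c d) y = trans c e y.
  have := open_nbhs_nbhs (conj (cimg_open (c := c) (dom_open d)) W).
  by apply: filterS => _ [y [dy cy] <-] /=; rewrite !transE.
have [_ ->] := near_eq_jacobian N (differentiable_comp D1 D2).
by rewrite (jacobian_comp D1 D2) (transE d cx).
Qed.

Lemma trans_jacobian_id c x : dom c x -> 'J (trans c c) (c x) = 1%:M.
Proof.
move=> cx.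
have did : differentiable (id : 'rV[R]_n -> 'rV[R]_n) (c x).
  by apply: (smooth_differentiable openT) => // k; exact: Ck_id.
have W : cimg c (dom c) (c x) by exists x.
have N : \forall y \near c x, id y = trans c c y.
  have := open_nbhs_nbhs (conj (cimg_open (c := c) (dom_open c)) W).
  by apply: filterS => _ [y [dy cy] <-] /=; rewrite !transE.
have [_ ->] := near_eq_jacobian N did.
by apply: (jacobianP did) => v; rewrite derive_id mulmx1.
Qed.

Lemma trans_jacobianK c d x : atlas M c -> atlas M d -> dom c x -> dom d x ->
  'J (trans c d) (c x) *m 'J (trans d c) (d x) = 1%:M.
Proof. by move=> ac ad cx dx; rewrite -trans_jacobian_comp// trans_jacobian_id. Qed.

End ChartCalculus.

Section LeafMaps.
Context {R : realType} {p n : nat} {N : manifold R p} {M : manifold R n}.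
Implicit Types (f : N -> M).

Lemma smooth_map_continuous f : smooth_map f -> continuous f.
Proof.
move=> sf z; have [b ab bz] := atlas_cover z.
have [cf _] := sf b ab.
have H1 : {for z, continuous ((f \o cinv b) \o b)}.
  apply: continuous_comp; first exact: cmap_continuous.
  by apply: cf; exists z.
suff : f y @[y --> z] --> f z by [].
have N1 : \forall y \near z, (f \o cinv b \o b) y = f y.
  have := open_nbhs_nbhs (conj (dom_open b) bz).
  by apply: filterS => y dy /=; rewrite cmapK.
rewrite -[X in _ --> X](nbhs_singleton N1).
by apply: cvg_trans H1; apply: near_eq_cvg; exact: N1.
Qed.

Lemma smooth_map_chart f (b : chart R N p) (c : chart R M n) : smooth_map f ->
  atlas N b -> atlas M c ->
  open (cimg b (f @^-1` dom c)) /\ smooth_on (cimg b (f @^-1` dom c)) (c \o f \o cinv b).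
Proof.
move=> sf ab ac; have cf := smooth_map_continuous sf; split.
  by apply: cimg_open; apply: open_comp; [move=> z _; exact: cf|exact: dom_open].
move=> k; have [_ /(_ c ac k)] := sf b ab; apply: Ck_sub.
move=> _ [z [cz bz] <-]; split; first by exists z.
by rewrite /= cmapK.
Qed.

End LeafMaps.

Section Plaques.
Context {R : realType} {p q : nat} {M : manifold R (p + q)} (F : foliation M).
Implicit Types (c : chart R M (p + q)) (x y : M).

Lemma same_leaf_refl x : same_leaf F x x.
Proof. by apply: (generic_quotient.equiv_refl (same_leaf F)). Qed.

Lemma same_leafC x y : same_leaf F x y -> same_leaf F y x.
Proof. by rewrite (generic_quotient.equiv_sym (same_leaf F)). Qed.

Lemma same_leaf_trans x y z : same_leaf F x y -> same_leaf F y z -> same_leaf F x z.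
Proof. by move=> xy; apply: (generic_quotient.equiv_trans xy). Qed.

(* A leaf meets an adapted chart in countably many plaques, so that a connected
   piece of the leaf stays in one plaque. *)
Lemma leaf_locally_plaque x (N : manifold R p) (f : N -> M) c r (z : N) :
  connected_immersed f [set y | same_leaf F x y] -> adapted F c r -> dom c (f z) ->
  exists B : set N, [/\ open B, B z &
    forall z', B z' -> dom c (f z') /\ rsubmx (c (f z')) = rsubmx (c (f z))].
Proof.
move=> [_ [sf _] _ rf] adc dz.
have [b ab bz] := atlas_cover z.
have [oW sW] := smooth_map_chart sf ab (adapted_atlas adc).
set W := cimg b _ in oW sW.
have Wz : W (b z) by exists z.
have [e /= e0 eW] := (nbhs_ballP _ _).1 (open_nbhs_nbhs (conj oW Wz)).
exists (dom b `&` b @^-1` [set w | `|w - b z| < e]); split.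
- by apply: chart_preimage_open; exact: open_norm_lt.
- by split=> //=; rewrite subrr normr0.
move=> z' [bz' /= ze].
pose path (t : R) := b z + t *: (b z' - b z).
have pW t : 0 <= t <= 1 -> W (path t).
  move=> /andP[t0 t1]; apply: eW; rewrite -ball_normE /= /path opprD addrA subrr sub0r normrN.
  by rewrite normrZ ger0_norm//; apply: le_lt_trans ze; rewrite ler_piMl.
pose h (t : R) := rsubmx ((c \o f \o cinv b) (path t)).
pose A := [set rsubmx (c y) | y in dom c `&` [set y | same_leaf F x y]].
have Ah t : 0 <= t <= 1 -> A (h t).
  move=> /pW[z1 [dz1 bz1] E]; rewrite /h -E /= cmapK//.
  exists (f z1) => //; split=> //.
  by rewrite -rf; exists z1.
have ch t : 0 <= t <= 1 -> {for t, continuous h}.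
  move=> /pW Wt; have [+ _] := sW 0%N; move=> /(_ _ Wt) cW.
  have cp : {for t, continuous path}.
    have := @line_continuous _ _ (b z) (b z' - b z) t.
    rewrite (_ : (fun t : R => t *: (b z' - b z) + b z) = path)//.
    by apply/funext => s; rewrite /path addrC.
  have cr := @rsubmx_continuous R p q ((c \o f \o cinv b) (path t)).
  exact: (continuous_comp cp (continuous_comp cW cr)).
have := countable_image_const (adapted_countable adc x) Ah ch.
have p0 : path 0 = b z by rewrite /path scale0r addr0.
have p1 : path 1 = b z' by rewrite /path scale1r addrC subrK.
rewrite /h p0 p1 /= !cmapK// => ->; split=> //.
have := pW 1; rewrite p1 ler01 lexx => /(_ isT)[z1 [dz1 bz1] E].
by rewrite -(cmapK bz') -E cmapK.
Qed.

(** A property invariant within the plaques of some adapted chart at each point is locally constant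
    on the manifold that parametrizes a leaf, by [leaf_locally_plaque], and this manifold is
    connected. All later transport along leaves, of neighborhoods, of endpoints and of germs of
    curves, goes through this lemma. *)
Lemma plaque_induction (P : M -> Prop) :
  (forall x, exists c r, [/\ adapted F c r, dom c x &
    forall y z, dom c y -> dom c z -> rsubmx (c y) = rsubmx (c z) -> P y -> P z]) ->
  forall x y, same_leaf F x y -> P x -> P y.
Proof.
move=> H x y xy Px; have [N [f cf]] := leaf_immersed F x; have [cN _ _ rf] := cf.
have [z _ fz] : range f x by rewrite rf; exact: same_leaf_refl.
have [z' _ fz'] : range f y by rewrite rf.
pose A := [set w : N | P (f w)].
have loc w : exists B : set N, [/\ open B, B w & forall w', B w' -> (P (f w') <-> P (f w))].
  have [c [r [adc dw HP]]] := H (f w).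
  have [B [oB Bw HB]] := leaf_locally_plaque cf adc dw.
  exists B; split=> // w' /HB[dw' E]; split; first exact: HP.
  by apply: HP => //; rewrite E.
have oA : open A.
  rewrite openE => w Aw; have [B [oB Bw HB]] := loc w.
  by have := open_nbhs_nbhs (conj oB Bw); apply: filterS => w' /HB[_]; apply.
have cA : closed A.
  rewrite -[A]setCK; apply: open_closedC; rewrite openE => w nAw.
  have [B [oB Bw HB]] := loc w.
  have := open_nbhs_nbhs (conj oB Bw); apply: filterS => w' /HB[+ _] Aw'.
  by move=> /(_ Aw')/nAw.
have AT : A = setT.
  apply: cN; first by exists z; rewrite /A /= fz.
    by exists A => //; rewrite setTI.
  by exists A => //; rewrite setTI.
have : A z' by rewrite AT.
by rewrite /A /= fz'.
Qed.

End Plaques.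

(** * Invariance of the metric along the leaves *)

Section Vertical.
Context {R : realType} {p q : nat} {M : manifold R (p + q)} (F : foliation M).
Implicit Types (c : chart R M (p + q)) (x y : M).

Lemma leaf_jacobian_vertical x (N : manifold R p) (f : N -> M) c r (z : N) b (w : 'rV[R]_p) :
  connected_immersed f [set y | same_leaf F x y] -> adapted F c r -> dom c (f z) ->
  atlas N b -> dom b z -> rsubmx (w *m Jac f b c z) = 0.
Proof.
move=> cf adc dz ab bz; have [_ [sf _] _ _] := cf.
have [oW sW] := smooth_map_chart sf ab (adapted_atlas adc).
set W := cimg b _ in oW sW.
have Wz : W (b z) by exists z.
have dh := smooth_differentiable oW Wz sW.
rewrite /Jac -(deriveEjacobian w dh).
have [B [oB Bz HB]] := leaf_locally_plaque cf adc dz.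
have BW : cimg b B (b z) by exists z.
have N1 : \forall u \near b z, rsubmx ((c \o f \o cinv b) u) = rsubmx (c (f z)).
  have := open_nbhs_nbhs (conj (cimg_open (c := b) oB) BW).
  by apply: filterS => _ [y [By dy] <-] /=; rewrite cmapK//; have [] := HB y By.
have dd := diff_derivable (v := w) dh.
apply/rowP => j; rewrite !mxE (derive_mx dd) mxE.
have N2 : \forall u \near b z, (c \o f \o cinv b) u 0 (rshift p j) = cst (c (f z) 0 (rshift p j)) u.
  by apply: filterS N1 => u /rowP/(_ j); rewrite !mxE.
by rewrite (near_eq_derive _ N2) derive_cst.
Qed.

Lemma vertical_adapted c r x v : adapted F c r -> dom c x ->
  vertical F c x v <-> rsubmx v = 0.
Proof.
move=> adc dx; split.
  move=> [N [f [cf [z [b [w [fz ab bz ->]]]]]]].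
  by apply: (leaf_jacobian_vertical w cf adc _ ab bz); rewrite fz.
move=> v0; have [N [f cf]] := leaf_immersed F x; have [_ [sf iJ] _ rf] := cf.
have [z _ fz] : range f x by rewrite rf; exact: same_leaf_refl.
have [b ab bz] := atlas_cover z.
exists N, f; split=> //; exists z, b.
have dz : dom c (f z) by rewrite fz.
have rJ := iJ b c z ab (adapted_atlas adc) bz dz.
set J := Jac f b c z in rJ *.
have J0 : rsubmx J = 0.
  apply/row_matrixP => i; rewrite row0.
  have -> : row i (rsubmx J) = rsubmx (delta_mx 0 i *m J).
    by rewrite -rowE; apply/rowP => k; rewrite !mxE.
  exact: (leaf_jacobian_vertical _ cf adc dz ab bz).
(* Conversely, the Jacobian of the immersion has rank p and no transverse part, so its vertical p by
   p block is invertible and every vertical vector is hit. *)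
have uJ : lsubmx J \in unitmx.
  rewrite -row_free_unit -row_leq_rank.
  move: rJ; rewrite -row_leq_rank => /leq_trans; apply.
  by rewrite -{1}[J]hsubmxK J0 rank_row_mx0.
exists (lsubmx v *m invmx (lsubmx J)); split=> //.
have JE : J = row_mx (lsubmx J) 0 by rewrite -{1}[J]hsubmxK J0.
rewrite {2}JE mul_mx_row mulmx0 mulmxKV//.
by rewrite -[LHS]hsubmxK v0.
Qed.

End Vertical.

Section Metric.
Context {R : realType} {p q : nat} {M : manifold R (p + q)} (F : foliation M).
Local Notation n := (p + q)%N.
Implicit Types (c d e : chart R M n) (x y : M) (g : chart R M n -> M -> 'M[R]_n).

Lemma bilDl (G : 'M[R]_n) u v w : bil G (u + v) w = bil G u w + bil G v w.
Proof. by rewrite /bil !mulmxDl mxE. Qed.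

Lemma bilZl (G : 'M[R]_n) a u w : bil G (a *: u) w = a * bil G u w.
Proof. by rewrite /bil -!scalemxAl mxE. Qed.

Lemma bil_ker_row (G : 'M[R]_n) v : (forall w, bil G v w = 0) -> v *m G = 0.
Proof.
move=> H; apply/rowP => i; have := H (delta_mx 0 i).
by rewrite /bil trmx_delta -colE !mxE.
Qed.

Lemma metric_vertical_row g c x v : transverse_lorentzian F g -> atlas M c -> dom c x ->
  vertical F c x v -> v *m g c x = 0.
Proof. by move=> [_ _ _ K] ac dx vv; apply: bil_ker_row; apply/K. Qed.

Lemma lorentzian_sym g c x : transverse_lorentzian F g -> atlas M c -> dom c x ->
  (g c x)^T = g c x.
Proof. by move=> [[_ _ S] _ _ _] ac dx; exact: S. Qed.

Lemma metric_change g c d x u w : transverse_lorentzian F g -> atlas M c -> atlas M d ->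
  dom c x -> dom d x ->
  bil (g d x) (u *m 'J (trans c d) (c x)) (w *m 'J (trans c d) (c x)) = bil (g c x) u w.
Proof.
move=> [[_ T _] _ _ _] ac ad cx dx.
by rewrite /bil (T c d x ac ad cx dx) trmx_mul !mulmxA.
Qed.

Lemma vertical_change g c d x v : transverse_lorentzian F g -> atlas M c -> atlas M d ->
  dom c x -> dom d x ->
  vertical F c x v -> vertical F d x (v *m 'J (trans c d) (c x)).
Proof.
move=> tg ac ad cx dx vv; have [_ _ _ K] := tg; apply/K => // w.
have -> : w = (w *m 'J (trans d c) (d x)) *m 'J (trans c d) (c x).
  by rewrite -mulmxA trans_jacobianK// mulmx1.
by rewrite (metric_change _ _ tg)//; move: (_ *m _); apply/K.
Qed.

(** The constant vertical field of an adapted chart, cut off and extended by 0, so as to be a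
    legitimate test field in [transverse_lorentzian]. *)
Definition bump_field c (beta : 'rV[R]_n -> R) (v : 'rV[R]_p) e x : 'rV[R]_n :=
  if pselect (dom c x) then beta (c x) *: (row_mx v 0 *m 'J (trans c e) (c x)) else 0.

Lemma bump_field_in c beta v e x : dom c x ->
  bump_field c beta v e x = beta (c x) *: (row_mx v 0 *m 'J (trans c e) (c x)).
Proof. by rewrite /bump_field; case: pselect. Qed.

Lemma bump_field_out c beta v e x : ~ dom c x -> bump_field c beta v e x = 0.
Proof. by rewrite /bump_field; case: pselect. Qed.

(** The support lies in the image of a closed ball of coordinates, which is compact, hence closed in
    the Hausdorff [M]. Thus every point has a neighborhood inside the chart domain or one where the
    field is zero. *)
Lemma bump_field_vertical g c r beta a r1 (v : 'rV[R]_p) :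
  transverse_lorentzian F g -> adapted F c r ->
  smooth_on setT beta -> `|a| + r1 < r -> 0 < r1 ->
  (forall z, r1 <= `|z - a| -> beta z = 0) ->
  vertical_field F (bump_field c beta v).
Proof.
move=> tg adc sb ar r10 b0; have ac := adapted_atlas adc.
have [_ _ _ K] := tg.
pose Kc : set M := cinv c @` [set z | `|z - a| <= r1].
have ball_cod z : `|z - a| <= r1 -> `|z| < r.
  move=> zr; rewrite -[z](subrK a) addrC; apply: le_lt_trans (ler_normD _ _) _.
  by apply: le_lt_trans ar; rewrite lerD2l.
have cK : closed Kc.
  apply: compact_closed; first exact: carrier_hausdorff.
  apply: continuous_compact; last exact: compact_closed_ball.
  apply: continuous_in_subspaceT => z; rewrite inE => /ball_cod zr.
  by apply: cinv_continuous_at; rewrite (adapted_cod adc).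
have X0 e x : ~ Kc x -> bump_field c beta v e x = 0.
  rewrite /bump_field; case: pselect => // dx nK.
  rewrite b0 ?scale0r//; apply: contrapT => /negP; rewrite -ltNge => H; apply: nK.
  by exists (c x); [exact: ltW|rewrite cmapK].
split; [split|].
- move=> e ae k; apply: Ck_local => w [x [_ ex] wE].
  have [dx|ndx] := pselect (dom c x).
    have oU := cimg_open (c := e) (dom_open c); set U := cimg e (dom c) in oU.
    have oU' := cimg_open (c := c) (dom_open e).
    exists U; first by exists x.
    have UU' z : U z -> cimg c (dom e) (trans e c z).
      by move=> [y [cy ey] <-]; rewrite transE//; exists y.
    have st := trans_smooth ae ac k.
    have C1 : Ck k U (fun z => beta (trans e c z)).
      exact: (Ck_comp oU openT (fun _ _ => I) st (sb k)).
    have C2 : Ck k U (fun z => 'J (trans c e) (trans e c z)).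
      exact: (Ck_comp_mx oU oU' UU' st (Ck_jacobian oU' (trans_smooth ac ae k.+1))).
    have C3 := Ck_mulmx oU (Ck_cst k U (row_mx v 0 : 'rV[R]_n)) C2.
    have C4 : Ck k U (fun z => beta (trans e c z) *: (row_mx v 0 *m 'J (trans c e) (trans e c z))).
      apply/Ck_mxP => // i j; have C5 := (Ck_mxP k _ oU).1 C3 i j.
      by apply: Ck_eq (Ck_mul oU C1 C5) => // z _; rewrite [in RHS]mxE.
    apply: Ck_eq C4 => // z; rewrite inE => -[y [cy ey] <-].
    by rewrite /= cmapK// transE// bump_field_in.
  have oV : open (~` Kc) by exact: closed_openC.
  have oU := cimg_open (c := e) oV; exists (cimg e (~` Kc)).
    exists x => //; split=> // -[z /ball_cod zr zx]; apply: ndx.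
    by rewrite -zx; have [] := adapted_cinv adc zr.
  apply: Ck_eq (Ck_cst k _ (0 : 'rV[R]_n)) => // z; rewrite inE => -[y [cy ey] <-].
  by rewrite /= cmapK// X0.
- move=> e d x ae ad ex dx; have [cx|ncx] := pselect (dom c x).
    by rewrite !bump_field_in// -scalemxAl -mulmxA -trans_jacobian_comp.
  by rewrite !bump_field_out// mul0mx.
- move=> e x ae ex; have [cx|ncx] := pselect (dom c x).
    rewrite bump_field_in// scalemxAl; apply: (vertical_change tg) => //.
    by apply/(vertical_adapted _ adc cx); rewrite linearZ /= row_mxKr scaler0.
  apply/K => // w; rewrite bump_field_out//.
  by rewrite /bil !mul0mx mxE.
Qed.

Lemma metric_derive_vertical g c r x (v : 'rV[R]_p) :
  transverse_lorentzian F g -> adapted F c r -> dom c x ->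
  'D_(row_mx v 0) (g c \o cinv c) (c x) = 0.
Proof.
move=> tg adc dx; have ac := adapted_atlas adc.
have xr := adapted_norm adc dx.
pose r1 := (r - `|c x|) / 2; have r10 : 0 < r1 by rewrite divr_gt0// subr_gt0.
have ar : `|c x| + r1 < r by rewrite /r1; lra.
have [beta [sb b0 bz]] := bump_exists (c x) r10.
have vf := bump_field_vertical v tg adc sb ar r10 bz.
have [[sg _ _] L _ _] := tg.
pose X := bump_field c beta v; set G := g c x.
have oS : open (cimg c [set: M]) := cimg_open (c := c) openT.
have Sx : cimg c setT (c x) by exists x.
have [[sX _] _] := vf.
have dX := smooth_differentiable oS Sx (sX c ac).
have kv : row_mx v 0 *m G = 0.
  by apply: (metric_vertical_row tg) => //; apply/(vertical_adapted _ adc dx); rewrite row_mxKr.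
(* With [G] frozen at x, the product of the field with [G] vanishes near x because the field is a
   multiple of a fixed kernel vector. So both derivative-of-field terms drop out of the Lie
   derivative, and only the derivative of the metric is left. *)
have XG : 'J (X c \o cinv c) (c x) *m G = 0.
  apply/row_matrixP => i; rewrite row0 rowE mulmxA -(deriveEjacobian _ dX).
  have [_ <-] := derive_mulmx G (diff_derivable (v := delta_mx 0 i) dX).
  have N : \forall u \near c x, (X c \o cinv c) u *m G = cst 0 u.
    have := open_nbhs_nbhs (conj oS Sx); apply: filterS => _ [y [_ cy] <-] /=.
    rewrite /X cmapK// bump_field_in// trans_jacobian_id// mulmx1 -scalemxAl kv scaler0//.
  by rewrite (near_eq_derive _ N) derive_cst.
have Gs : G^T = G by exact: (lorentzian_sym tg).
have := L _ vf c x ac dx; rewrite /Lie_derivative -/G XG.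
rewrite -[X in _ + X]trmxK trmx_mul trmxK Gs XG trmx0 !addr0.
rewrite bump_field_in// trans_jacobian_id// mulmx1.
have dg : derivable (g c \o cinv c) (c x) (row_mx v 0).
  exact: (diff_derivable (smooth_differentiable oS Sx (sg c ac))).
rewrite (derivable_scale_dir _ dg).2 => /eqP; rewrite scaler_eq0 (negbTE b0) => /eqP.
by [].
Qed.

(** The segment between two points of a plaque has a vertical direction, along which the components
    of the metric have derivative 0. *)
Lemma metric_plaque g c r x y :
  transverse_lorentzian F g -> adapted F c r -> dom c x -> dom c y ->
  rsubmx (c x) = rsubmx (c y) -> g c x = g c y.
Proof.
move=> tg adc dx dy exy; have ac := adapted_atlas adc.
pose w := c y - c x; have w0 : rsubmx w = 0 by rewrite /w linearB /= exy subrr.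
have wE : w = row_mx (lsubmx w) 0 by rewrite -[LHS]hsubmxK w0.
have seg t : 0 <= t <= 1 -> `|c x + t *: w| < r.
  move=> /andP[t0 t1].
  have -> : c x + t *: w = (1 - t) *: c x + t *: c y.
    by apply/rowP => i; rewrite !mxE; ring.
  apply: le_lt_trans (ler_normD _ _) _; rewrite !normrZ !ger0_norm ?subr_ge0//.
  have := adapted_norm adc dx; have := adapted_norm adc dy.
  set A := `|c x|; set B := `|c y| => Br Ar.
  have [->|t1'] := eqVneq t 1; first by rewrite subrr mul0r add0r mul1r.
  have t1s : t < 1 by rewrite lt_neqAle t1'.
  apply: (@lt_le_trans _ _ ((1 - t) * r + t * r)); last by lra.
  by apply: ltr_leD; [rewrite ltr_pM2l// subr_gt0|rewrite ler_wpM2l// ltW].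
have [[sg _ _] _ _ _] := tg.
have oS : open (cimg c [set: M]) := cimg_open (c := c) openT.
have D t : 0 <= t <= 1 -> derivable (g c \o cinv c) (c x + t *: w) w /\
    'D_w (g c \o cinv c) (c x + t *: w) = 0.
  move=> /seg/(adapted_cinv adc)[dz cz].
  have Sz : cimg c setT (c x + t *: w) by exists (cinv c (c x + t *: w)).
  split; first exact: (diff_derivable (smooth_differentiable oS Sz (sg c ac))).
  by have := metric_derive_vertical (lsubmx w) tg adc dz; rewrite cz -wE.
apply/matrixP => i j; pose phi (t : R) : R := (g c \o cinv c) (c x + t *: w) i j.
have dphi (t : R) : 0 <= t <= 1 -> is_derive t 1 phi 0.
  move=> /D[dg Dg]; have dij := (derivable_mxP _ _ _).1 dg i j.
  have [a1 a2] := is_derive_line dij; apply: DeriveDef; first exact: a1.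
  by rewrite a2; have := derive_mx dg; rewrite Dg => /matrixP/(_ i j); rewrite !mxE.
have ch : {within `[(0:R), 1], continuous phi}.
  by apply: derivable_within_continuous => s; rewrite in_itv/= => /dphi[].
have dh (s : R) : s \in `]0, 1[%R -> is_derive s 1 phi 0.
  by rewrite in_itv/= => /andP[/ltW s0 /ltW s1]; apply: dphi; rewrite s0.
have [s _] := MVT ltr01 dh ch.
have wy : c x + w = c y by rewrite /w addrC subrK.
rewrite /= mul0r /phi /= scale1r scale0r addr0 wy !cmapK// => /eqP.
by rewrite subr_eq0 => /eqP ->.
Qed.

End Metric.

(** * Degenerate Lorentz forms *)

Section LorentzForms.
Context {R : realType} {p q : nat}.
Local Notation n := (p + q)%N.
Implicit Types (G : 'M[R]_n) (u v w e : 'rV[R]_n).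

Lemma addr_npos (x y : R) : x <= 0 -> y <= 0 -> x + y <= 0.
Proof. by move=> x0 y0; lra. Qed.

Lemma bilDr G u v w : bil G u (v + w) = bil G u v + bil G u w.
Proof. by rewrite /bil linearD /= mulmxDr mxE. Qed.

Lemma bilZr G a u w : bil G u (a *: w) = a * bil G u w.
Proof. by rewrite /bil linearZ /= -scalemxAr mxE. Qed.

Lemma bilC G u v : G^T = G -> bil G u v = bil G v u.
Proof.
move=> Gs; rewrite /bil; have -> : u *m G *m v^T = (v *m G *m u^T)^T.
  by rewrite !trmx_mul trmxK Gs mulmxA.
by rewrite mxE.
Qed.

Lemma bil_lin2 G a b u v : G^T = G ->
  bil G (a *: u + b *: v) (a *: u + b *: v) =
  a ^+ 2 * bil G u u + 2 * a * b * bil G u v + b ^+ 2 * bil G v v.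
Proof.
move=> Gs; rewrite !bilDl !bilDr !bilZl !bilZr (bilC v u Gs).
by ring.
Qed.

Lemma index1_timelike G : has_index G 1 -> exists e, bil G e e < 0.
Proof.
move=> [[W nW rW] _]; exists (nz_row W); apply: nW; first exact: nz_row_sub.
by rewrite nz_row_eq0 -mxrank_eq0 rW.
Qed.

Lemma index1_no_plane G a b : has_index G 1 ->
  ~ (forall s t : R, (s != 0) || (t != 0) -> bil G (s *: a + t *: b) (s *: a + t *: b) < 0).
Proof.
move=> [_ H] N.
have prod (D : 'rV[R]_(1 + 1)) : D *m col_mx a b = (D 0 0) *: a + (D 0 1) *: b.
  rewrite -{1}[D]hsubmxK mul_row_col; congr (_ + _).
    by rewrite [lsubmx D]mx11_scalar mul_scalar_mx mxE; congr (D _ _ *: _); apply: val_inj.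
  by rewrite [rsubmx D]mx11_scalar mul_scalar_mx mxE; congr (D _ _ *: _); apply: val_inj.
have Dnz (D : 'rV[R]_(1 + 1)) : D != 0 -> (D 0 0 != 0) || (D 0 1 != 0).
  apply: contraNT; rewrite negb_or !negbK => /andP[/eqP d0 /eqP d1].
  apply/eqP/rowP => i; rewrite mxE; case: i => -[|[|//]] i2.
    by rewrite -d0; congr (D _ _); exact: val_inj.
  by rewrite -d1; congr (D _ _); exact: val_inj.
have bil00 : bil G 0 0 = 0 by rewrite /bil !mul0mx mxE.
have rf : row_free (col_mx a b).
  rewrite -kermx_eq0; apply/rowV0P => D; rewrite sub_kermx prod => /eqP D0.
  apply/eqP; apply: contraT => /Dnz/N; by rewrite D0 bil00 ltxx.
have := H <<col_mx a b>>%MS; rewrite mxrank_gen (eqP rf).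
suff nd : negative_definite_on G <<col_mx a b>>%MS by move=> /(_ nd).
move=> v; rewrite genmxE => /submxP[D ->] nz; rewrite prod; apply: N; apply: Dnz.
by apply: contraNN nz => /eqP ->; rewrite mul0mx.
Qed.

(** Otherwise u and e would span a negative definite plane. As [G] may be degenerate, this replaces
    the diagonal form in all that follows. *)
Lemma orthogonal_timelike_ge0 G e u : G^T = G -> has_index G 1 ->
  bil G e e < 0 -> bil G u e = 0 -> 0 <= bil G u u.
Proof.
move=> Gs i1 ee ue; rewrite leNgt; apply/negP => uu.
apply: (@index1_no_plane _ u e i1) => s t st.
rewrite bil_lin2// ue mulr0 addr0.
have [s0|s0] := eqVneq s 0.
  have t0 : t != 0 by move: st; rewrite s0 eqxx.
  by rewrite s0 expr0n mul0r add0r pmulr_rlt0// exprn_even_gt0.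
apply: ltr_wnDr; last by rewrite pmulr_rlt0// exprn_even_gt0.
by rewrite mulr_ge0_le0// ?sqr_ge0// ltW.
Qed.

Lemma orthogonal_timelike_ker G e u : G^T = G -> has_index G 1 ->
  bil G e e < 0 -> bil G u e = 0 -> bil G u u <= 0 -> forall w, bil G u w = 0.
Proof.
move=> Gs i1 ee ue uu w.
have {}uu : bil G u u = 0.
  by apply/eqP; rewrite eq_le uu (orthogonal_timelike_ge0 Gs i1 ee ue).
apply: contrapT => /eqP uw.
pose w' := w + (- (bil G w e / bil G e e)) *: e.
have w'e : bil G w' e = 0 by rewrite bilDl bilZl mulNr divfK ?subrr// lt_eqF.
have uw' : bil G u w' = bil G u w by rewrite bilDr bilZr ue mulr0 addr0.
(* Chosen so that s u + w' has square -1 although it is orthogonal to e. *)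
pose s := - (bil G w' w' + 1) / (2 * bil G u w).
have : 0 <= bil G (s *: u + 1 *: w') (s *: u + 1 *: w').
  by apply: (orthogonal_timelike_ge0 Gs i1 ee); rewrite bilDl !bilZl ue w'e !mulr0 addr0.
rewrite bil_lin2// uu mulr0 add0r mulr1 expr1n mul1r uw'.
have -> : 2 * s * bil G u w = - (bil G w' w' + 1) by rewrite /s; field.
by rewrite opprD addrAC addNr add0r leNgt ltrN10.
Qed.

Definition form_ker G v := forall w, bil G v w = 0.

Lemma causal_timelike_neq0 G e v : G^T = G -> has_index G 1 -> bil G e e < 0 ->
  ~ form_ker G v -> bil G v v <= 0 -> bil G v e != 0.
Proof.
move=> Gs i1 ee nk vv; apply/eqP => ve; apply: nk.
exact: (orthogonal_timelike_ker Gs i1 ee ve vv).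
Qed.

Lemma notker_of_neq0 G v e : bil G v e != 0 -> ~ form_ker G v.
Proof. by move=> ve /(_ e) /eqP; rewrite (negbTE ve). Qed.

Lemma cone_bil_le0 G e u v : G^T = G -> has_index G 1 -> bil G e e < 0 ->
  bil G u u <= 0 -> bil G u e <= 0 -> bil G v v <= 0 -> bil G v e <= 0 ->
  bil G u v <= 0.
Proof.
move=> Gs i1 ee uu ue vv ve.
have [u0|un] := eqVneq (bil G u e) 0.
  by rewrite (orthogonal_timelike_ker Gs i1 ee u0 uu).
have [v0|vn] := eqVneq (bil G v e) 0.
  by rewrite (bilC u v Gs) (orthogonal_timelike_ker Gs i1 ee v0 vv).
have {un}ue : bil G u e < 0 by rewrite lt_neqAle un.
have {vn}ve : bil G v e < 0 by rewrite lt_neqAle vn.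
rewrite leNgt; apply/negP => uv.
(* This combination of u and v is orthogonal to e; the coefficients have opposite signs, so a
   positive product of u and v would make its square negative. *)
pose a := - bil G v e; pose b := bil G u e.
have a0 : 0 < a by rewrite oppr_gt0.
have := orthogonal_timelike_ge0 Gs i1 ee (u := a *: u + b *: v).
rewrite bilDl !bilZl /a /b mulNr mulrC addNr => /(_ erefl).
rewrite bil_lin2// -/a -/b leNgt => /negP; apply.
apply: (@le_lt_trans _ _ (2 * a * b * bil G u v)).
  rewrite -addrA addrCA gerDl; apply: addr_npos; by rewrite mulr_ge0_le0// sqr_ge0.
by rewrite pmulr_llt0// nmulr_llt0// mulr_gt0.
Qed.

Lemma cone_add G e u v : G^T = G -> has_index G 1 -> bil G e e < 0 ->
  bil G u u <= 0 -> bil G u e <= 0 -> bil G v v <= 0 -> bil G v e <= 0 ->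
  bil G (u + v) (u + v) <= 0 /\ bil G (u + v) e <= 0.
Proof.
move=> Gs i1 ee uu ue vv ve; have uv := cone_bil_le0 Gs i1 ee uu ue vv ve.
have := bil_lin2 1 1 u v Gs; rewrite !scale1r => ->; rewrite bilDl; split; last by lra.
by rewrite expr1n; lra.
Qed.

Lemma cone_segment G e v s : G^T = G -> bil G e e < 0 -> bil G v v <= 0 -> bil G v e < 0 ->
  0 <= s <= 1 ->
  bil G ((1 - s) *: v + s *: e) ((1 - s) *: v + s *: e) <= 0 /\
  bil G ((1 - s) *: v + s *: e) e < 0.
Proof.
move=> Gs ee vv ve /andP[s0 s1]; split.
  rewrite bil_lin2//; apply: addr_npos; last by rewrite mulr_ge0_le0 ?sqr_ge0// ltW.
  apply: addr_npos; first by rewrite mulr_ge0_le0 ?sqr_ge0.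
  by rewrite mulr_ge0_le0 ?mulr_ge0 ?subr_ge0// ltW.
rewrite bilDl !bilZl; have [->|sn] := eqVneq s 0; first by rewrite subr0 mul1r mul0r addr0.
apply: ltr_wnDl; first by rewrite mulr_ge0_le0 ?subr_ge0// ltW.
by rewrite pmulr_rlt0// lt_neqAle eq_sym sn.
Qed.

(** The strict comparison concerns squares only; that the same e still separates future from past
    for the wider form follows because the whole segment from v to e is [G2]-timelike, so the
    product with e cannot vanish on it. *)
Lemma wider_cone G1 G2 e v : G1^T = G1 -> G2^T = G2 -> has_index G2 1 ->
  (forall u, ~ form_ker G1 u -> bil G1 u u <= 0 -> bil G2 u u < 0) ->
  bil G1 e e < 0 -> bil G1 v v <= 0 -> bil G1 v e < 0 ->
  bil G2 v v < 0 /\ bil G2 v e < 0.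
Proof.
move=> s1 s2 i2 W ee vv ve.
have tl s : 0 <= s <= 1 -> bil G2 ((1 - s) *: v + s *: e) ((1 - s) *: v + s *: e) < 0.
  move=> s01; have [z1 z2] := cone_segment s1 ee vv ve s01; apply: W => //.
  by apply: (@notker_of_neq0 _ _ e); rewrite lt_eqF.
have ee2 : bil G2 e e < 0.
  have := tl 1; rewrite subrr scale0r add0r scale1r; apply.
  by rewrite ler01 lexx.
split.
  have := tl 0; rewrite subr0 scale1r scale0r addr0; apply.
  by rewrite ler01 lexx.
rewrite ltNge; apply/negP => a0; set a := bil G2 v e in a0.
(* The parameter at which the point of the segment is [G2]-orthogonal to e. *)
pose s := a / (a - bil G2 e e).
have d0 : 0 < a - bil G2 e e by lra.
have s01 : 0 <= s <= 1.
  rewrite /s divr_ge0//; last exact: ltW.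
  by rewrite ler_pdivrMr// mul1r; lra.
have := tl s s01; rewrite ltNge => /negP; apply.
apply: (orthogonal_timelike_ge0 s2 i2 ee2).
rewrite bilDl !bilZl -/a /s; field.
by rewrite gt_eqF.
Qed.

(** A mean of Lorentz forms need not be Lorentzian; here every negative direction of the mean is
    negative for [G2], which bounds the index. A new kernel vector would span with e a plane on
    which [G2] is negative definite. *)
Lemma interpolate_index G1 G2 s : G1^T = G1 -> G2^T = G2 -> has_index G1 1 -> has_index G2 1 ->
  (forall v, form_ker G1 v <-> form_ker G2 v) ->
  (forall u, ~ form_ker G1 u -> bil G1 u u <= 0 -> bil G2 u u < 0) ->
  0 < s < 1 -> let G := (1 - s) *: G1 + s *: G2 in
  [/\ has_index G 1, forall v, form_ker G v <-> form_ker G1 v,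
      forall u, ~ form_ker G1 u -> bil G1 u u <= 0 -> bil G u u < 0 &
      forall u, ~ form_ker G1 u -> bil G u u <= 0 -> bil G2 u u < 0].
Proof.
move=> s1 s2 i1 i2 kk W /andP[sp sl] G.
have GE u v : bil G u v = (1 - s) * bil G1 u v + s * bil G2 u v.
  by rewrite /bil /G mulmxDr mulmxDl -!scalemxAr -!scalemxAl !mxE.
have sl' : 0 < 1 - s by rewrite subr_gt0.
have GW u : ~ form_ker G1 u -> bil G1 u u <= 0 -> bil G u u < 0.
  move=> nk uu; rewrite GE; apply: ltr_wnDl.
    by rewrite pmulr_rle0.
  by rewrite pmulr_rlt0//; exact: W.
have GW2 u : ~ form_ker G1 u -> bil G u u <= 0 -> bil G2 u u < 0.
  move=> nk; have [uu _|uu] := leP (bil G1 u u) 0; first exact: W.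
  rewrite GE; apply: contraTT; rewrite -leNgt -ltNge => u2.
  by apply: ltr_wpDr; [rewrite mulr_ge0// ltW|rewrite mulr_gt0].
have kerG u : form_ker G1 u -> form_ker G u.
  by move=> k1 w; rewrite GE k1 (kk u).1// !mulr0 addr0.
have nd u : bil G u u < 0 -> bil G2 u u < 0.
  move=> uu; apply: GW2; last exact: ltW.
  by move=> /kerG/(_ u) E; rewrite E ltxx in uu.
have [e e1] := index1_timelike i1.
have nke : ~ form_ker G1 e by move=> /(_ e) E; rewrite E ltxx in e1.
have eG : bil G e e < 0 by apply: GW => //; exact: ltW.
have Gs : G^T = G by rewrite /G linearD !linearZ /= s1 s2.
split=> //.
- split.
    exists <<e>>%MS; last first.
      rewrite mxrank_gen rank_rV; have -> // : e != 0.
      by apply: contraTneq e1 => ->; rewrite /bil !mul0mx mxE ltxx.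
    move=> v; rewrite genmxE => /sub_rVP[a ->] nz; rewrite bilZl bilZr mulrA pmulr_rlt0//.
    rewrite -expr2 exprn_even_gt0//=; by apply: contraNneq nz => ->; rewrite scale0r.
  move=> Wm nW; apply: i2.2 => v vW vn; apply: nd; exact: nW.
- move=> v; split; last exact: kerG.
  move=> kv; apply: contrapT => nk.
  apply: (@index1_no_plane G2 v e i2) => a b ab;
  have [b0|bn] := eqVneq b 0.
    rewrite b0 scale0r addr0 bilZl bilZr mulrA pmulr_rlt0.
      by apply: GW2 => //; rewrite kv.
    by rewrite -expr2 exprn_even_gt0//=; move: ab; rewrite b0 eqxx orbF.
  apply: nd; rewrite bil_lin2// !kv !mulr0 !add0r pmulr_rlt0//.
  by rewrite exprn_even_gt0.
Qed.

Lemma continuous_bil G e : continuous (fun v => bil G v e).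
Proof.
have [+ _] : Ck 0 [set: 'rV[R]_n] (fun v => bil G v e).
  have C1 := mulmx_Ck 0 (G *m e^T) (@openT 'rV[R]_n).
  apply: Ck_eq ((Ck_mxP 0 _ openT).1 C1 0 0); first exact: openT.
  by move=> v _; rewrite /bil mulmxA.
by move=> H v; exact: H.
Qed.

Lemma connected_sign (A : set 'rV[R]_n) (f : 'rV[R]_n -> R) u v :
  connected A -> continuous f -> (forall w, A w -> f w != 0) -> A u -> A v ->
  f u < 0 -> f v < 0.
Proof.
move=> cA cf f0 Au Av fu; rewrite ltNge le_eqVlt negb_or eq_sym f0//=; apply/negP => fv.
have cI : connected (f @` A).
  by apply: connected_continuous_connected => //; exact: continuous_subspaceT.
have := (connected_intervalP _).1 cI (f u) (f v) (ex_intro2 _ _ u Au erefl) (ex_intro2 _ _ v Av erefl) 0.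
rewrite (ltW fu) (ltW fv) => /(_ isT)[w Aw fw].
by have := f0 w Aw; rewrite fw eqxx.
Qed.

Lemma rV_segment_connected (u v : 'rV[R]_n) :
  connected [set (1 - s) *: u + s *: v | s in `[(0:R), 1]].
Proof.
apply: connected_continuous_connected; first exact: segment_connected.
apply: continuous_subspaceT => s.
have -> : (fun s : R => (1 - s) *: u + s *: v) = (fun s : R => s *: (v - u) + u).
  by apply/funext => t; apply/rowP => i; rewrite !mxE; ring.
exact: line_continuous.
Qed.

Definition causal_set G := [set v | ~ form_ker G v /\ bil G v v <= 0].

(** The half with negative product is star-shaped about e, and the product cannot vanish on a causal
    vector, so its sign is constant on connected sets. *)
Lemma causal_component G e v : G^T = G -> has_index G 1 -> bil G e e < 0 ->
  causal_set G v -> bil G v e < 0 ->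
  connected_component (causal_set G) v = [set u | causal_set G u /\ bil G u e < 0].
Proof.
move=> Gs i1 ee cv ve.
have reach u : causal_set G u -> bil G u e < 0 -> connected_component (causal_set G) e u.
  move=> [nk uu] ue; exists [set (1 - s) *: u + s *: e | s in `[(0:R), 1]].
    split.
    - by exists 1; rewrite /= ?in_itv/= ?ler01 ?lexx// subrr scale0r add0r scale1r.
    - move=> _ [s /= + <-]; rewrite in_itv/= => s01.
      have [h1 h2] := cone_segment Gs ee uu ue s01; split=> //.
      by apply: (@notker_of_neq0 _ _ e); rewrite lt_eqF.
    - exact: rV_segment_connected.
  by exists 0; rewrite /= ?in_itv/= ?ler01 ?lexx// subr0 scale0r addr0 scale1r.
have -> : connected_component (causal_set G) v = connected_component (causal_set G) e.
  by apply/esym/same_connected_component; exact: reach.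
apply/seteqP; split=> u.
  move=> [A [Ae Asub cA] Au]; split; first exact: Asub.
  apply: (@connected_sign A (fun w => bil G w e) e u) => //; first exact: continuous_bil.
  by move=> w /Asub[nk ww]; exact: causal_timelike_neq0.
by move=> [cu ue]; exact: reach.
Qed.

End LorentzForms.

(** * Time orientations and intermediate metrics *)

Section CvgBil.
Context {R : realType} {p q : nat}.
Local Notation n := (p + q)%N.

Lemma cvg_sumr (T : Type) (Fi : set_system T) (FF : Filter Fi) (I : Type) (r : seq I)
    (f : I -> T -> R) (a : I -> R) :
  (forall i, f i t @[t --> Fi] --> a i) ->
  \sum_(i <- r) f i t @[t --> Fi] --> \sum_(i <- r) a i.
Proof.
move=> H; elim: r => [|i r IH].
  rewrite big_nil; under eq_fun do rewrite big_nil; exact: cvg_cst.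
rewrite big_cons; under eq_fun do rewrite big_cons.
exact: (cvgD (H i) IH).
Qed.

Lemma cvg_lt0 (T : Type) (Fi : set_system T) (f : T -> R) (a : R) :
  f t @[t --> Fi] --> a -> a < 0 -> \forall t \near Fi, f t < 0.
Proof.
by move=> cf a0; exact: (cf _ (open_nbhs_nbhs (conj (@open_lt _ (0 : R)) a0))).
Qed.

Lemma cvg_gt0 (T : Type) (Fi : set_system T) (f : T -> R) (a : R) :
  f t @[t --> Fi] --> a -> 0 < a -> \forall t \near Fi, 0 < f t.
Proof.
by move=> cf a0; exact: (cf _ (open_nbhs_nbhs (conj (@open_gt _ (0 : R)) a0))).
Qed.

Lemma cvg_mx (T : Type) (Fi : set_system T) (FF : Filter Fi) a b (f : T -> 'M[R]_(a, b))
    (A : 'M[R]_(a, b)) :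
  (forall i j, f t i j @[t --> Fi] --> A i j) -> f t @[t --> Fi] --> A.
Proof.
move=> H; apply/cvgrPdist_le => e e0; near=> t.
rewrite [leLHS]/Num.Def.normr/= mx_normrE (bigmax_le _ (ltW e0))//= => i _.
rewrite !mxE/=; move: i; near: t; apply: filter_forall => /= -[i j] /=.
exact: ((cvgrPdist_le _ _).1 (H i j) _ e0).
Unshelve. all: by end_near. Qed.

Lemma bilE (G : 'M[R]_n) u w : bil G u w = \sum_j \sum_i u 0 i * G i j * w 0 j.
Proof.
rewrite /bil mxE; apply: eq_bigr => j _; rewrite !mxE mulr_suml.
by apply: eq_bigr => i _.
Qed.

Lemma cvg_bil (T : Type) (Fi : set_system T) (FF : Filter Fi) (G_ : T -> 'M[R]_n)
   (u_ w_ : T -> 'rV[R]_n) G u w :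
  G_ t @[t --> Fi] --> G -> u_ t @[t --> Fi] --> u -> w_ t @[t --> Fi] --> w ->
  bil (G_ t) (u_ t) (w_ t) @[t --> Fi] --> bil G u w.
Proof.
move=> cG cu cw; rewrite bilE; under eq_fun do rewrite bilE.
have E a b (A_ : T -> 'M[R]_(a, b)) (A : 'M[R]_(a, b)) i j : A_ t @[t --> Fi] --> A -> A_ t i j @[t --> Fi] --> A i j.
  by move=> cA; exact: (cvg_comp _ _ cA (@coord_continuous _ _ _ i j A)).
apply: cvg_sumr => j; apply: cvg_sumr => i.
by apply: cvgM; [apply: cvgM; exact: E|exact: E].
Qed.

End CvgBil.

Section Orientation.
Context {R : realType} {p q : nat} {M : manifold R (p + q)} (F : foliation M).
Local Notation n := (p + q)%N.
Implicit Types (c d : chart R M n) (x y : M) (e : 'rV[R]_n) (g : chart R M n -> M -> 'M[R]_n)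
  (O : chart R M n -> M -> set 'rV[R]_n).

Lemma metric_continuous g c x : transverse_lorentzian F g -> atlas M c -> dom c x ->
  {for x, continuous (g c)}.
Proof.
move=> [[sg _ _] _ _ _] ac dx; have [cg _] := sg c ac 0%N.
have H1 : {for x, continuous ((g c \o cinv c) \o c)}.
  apply: continuous_comp; first exact: cmap_continuous.
  by apply: cg; exists x.
suff : g c y @[y --> x] --> g c x by [].
have N1 : \forall y \near x, (g c \o cinv c \o c) y = g c y.
  have := open_nbhs_nbhs (conj (dom_open c) dx).
  by apply: filterS => y dy /=; rewrite cmapK.
rewrite -[X in _ --> X](nbhs_singleton N1).
by apply: cvg_trans H1; apply: near_eq_cvg; exact: N1.
Qed.

Lemma jacobian_trans_continuous c d x : atlas M c -> atlas M d -> dom c x -> dom d x ->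
  {for x, continuous (fun y => 'J (trans c d) (c y))}.
Proof.
move=> ac ad cx dx.
have [cJ _] := Ck_jacobian (cimg_open (c := c) (dom_open d)) (trans_smooth ac ad 1%N).
apply: (@continuous_comp _ _ _ c (jacobian (trans c d))); first exact: cmap_continuous.
by apply: cJ; exists x.
Qed.

Lemma vertical_kernel g c x v : transverse_lorentzian F g -> atlas M c -> dom c x ->
  vertical F c x v <-> form_ker (g c x) v.
Proof. by move=> [_ _ _ K] ac dx; rewrite -K. Qed.

Lemma causal_vectorsE g c x : transverse_lorentzian F g -> atlas M c -> dom c x ->
  causal_vectors F g c x = causal_set (g c x).
Proof.
move=> tg ac dx; apply/seteqP; split=> v [nv vv]; split=> //.
  by move=> /(vertical_kernel _ tg ac dx).
by move=> /(vertical_kernel _ tg ac dx).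
Qed.

Lemma orientation_component g O c x v : time_orientation F g O -> atlas M c -> dom c x ->
  O c x v -> O c x = connected_component (causal_vectors F g c x) v.
Proof.
move=> [H _ _] ac dx Ov; have [u cu E] := H c x ac dx.
by rewrite E; apply: same_connected_component; rewrite -E.
Qed.

Lemma orientation_causal g O c x : time_orientation F g O -> atlas M c -> dom c x ->
  O c x `<=` causal_vectors F g c x.
Proof.
move=> [H _ _] ac dx; have [u cu ->] := H c x ac dx.
exact: connected_component_sub.
Qed.

Lemma orientation_char g O c x v e : transverse_lorentzian F g -> time_orientation F g O ->
  atlas M c -> dom c x -> bil (g c x) e e < 0 -> O c x v -> bil (g c x) v e < 0 ->
  O c x = [set u | causal_set (g c x) u /\ bil (g c x) u e < 0].
Proof.
move=> tg tO ac dx ee Ov ve.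
rewrite (orientation_component tO ac dx Ov) (causal_vectorsE tg ac dx).
have [_ _ I _] := tg.
apply: (causal_component (lorentzian_sym tg ac dx) (I c x ac dx) ee _ ve).
by rewrite -(causal_vectorsE tg ac dx); exact: (orientation_causal tO ac dx).
Qed.

(** Turns the choice of a component into two inequalities with a vector e that is the same for all
    points near x. The continuous section of the orientation fixes the sign of e. *)
Lemma orientation_near g O c x : transverse_lorentzian F g -> time_orientation F g O ->
  atlas M c -> dom c x -> exists e : 'rV[R]_n, \forall y \near x, [/\ dom c y, bil (g c y) e e < 0, O c y e &
    O c y = [set u | causal_set (g c y) u /\ bil (g c y) u e < 0]].
Proof.
move=> tg tO ac dx; have [_ T C] := tO; have [_ _ I _] := tg.
have [c1 [X [ac1 c1x NX]]] := C x.
pose Y y := X y *m 'J (trans c1 c) (c1 y).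
have [cX OX] := nbhs_singleton NX.
have cY : Y y @[y --> x] --> Y x.
  have cJ := jacobian_trans_continuous ac1 ac c1x dx.
  have E a b (A_ : M -> 'M[R]_(a, b)) i j : {for x, continuous A_} -> A_ t i j @[t --> x] --> A_ x i j.
    by move=> cA; exact: (cvg_comp _ _ cA (@coord_continuous _ _ _ i j (A_ x))).
  apply: cvg_mx => i j; under eq_fun do rewrite /Y mxE.
  by rewrite mxE; apply: cvg_sumr => k; apply: cvgM; exact: E.
have OY : \forall y \near x, dom c y /\ O c y (Y y).
  have N1 := open_nbhs_nbhs (conj (dom_open c) dx).
  have N2 := open_nbhs_nbhs (conj (dom_open c1) c1x).
  apply: filterS3 N1 N2 NX => y cy c1y [_ OXy]; split=> //.
  by rewrite (T c1 c y ac1 ac c1y cy); exists (X y).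
have [_ OYx] := nbhs_singleton OY.
have [e0 e0e] := index1_timelike (I c x ac dx).
have cyx : causal_set (g c x) (Y x).
  by rewrite -(causal_vectorsE tg ac dx); exact: (orientation_causal tO ac dx).
have Y0 : bil (g c x) (Y x) e0 != 0.
  by case: cyx => nk yy; apply: causal_timelike_neq0 => //; [exact: (lorentzian_sym tg)|exact: I].
have [e [ee Ye]] : exists e, bil (g c x) e e < 0 /\ bil (g c x) (Y x) e < 0.
  have [H|H] := ltP (bil (g c x) (Y x) e0) 0; first by exists e0.
  exists ((-1) *: e0); rewrite bilZl !bilZr !mulN1r opprK; split=> //.
  by rewrite oppr_lt0 lt_neqAle eq_sym Y0.
exists e; have cg := metric_continuous tg ac dx.
have N1 : \forall y \near x, bil (g c y) e e < 0.
  exact: (cvg_lt0 (cvg_bil _ cg (cvg_cst e) (cvg_cst e)) ee).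
have N2 : \forall y \near x, bil (g c y) (Y y) e < 0.
  exact: (cvg_lt0 (cvg_bil _ cg cY (cvg_cst e)) Ye).
apply: filterS3 OY N1 N2 => y [cy Oy] ey Yy.
have E := orientation_char tg tO ac cy ey Oy Yy.
split=> //; rewrite E; split=> //; split; last exact: ltW.
by apply: (@notker_of_neq0 _ _ _ _ _ e); rewrite lt_eqF.
Unshelve. all: by end_near. Qed.

Definition mid_metric g g' c x : 'M[R]_n := (1 - 2^-1) *: g c x + 2^-1 *: g' c x.

Lemma mid_lorentzian g g' : transverse_lorentzian F g -> transverse_lorentzian F g' ->
  wider F g g' -> [/\ transverse_lorentzian F (mid_metric g g'),
    wider F g (mid_metric g g') & wider F (mid_metric g g') g'].
Proof.
move=> tg tg' wd; have [[sm T S] L I K] := tg; have [[sm' T' S'] L' I' K'] := tg'.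
have half : 0 < (2^-1 : R) < 1 by rewrite invr_gt0 ltr0n invf_lt1 ?ltr1n.
have ip c x (ac : atlas M c) (dx : dom c x) := @interpolate_index _ _ _ (g c x) (g' c x) 2^-1
   (S c x ac dx) (S' c x ac dx) (I c x ac dx) (I' c x ac dx).
have kk c x (ac : atlas M c) (dx : dom c x) v : form_ker (g c x) v <-> form_ker (g' c x) v.
  by rewrite -(vertical_kernel _ tg ac dx) -(vertical_kernel _ tg' ac dx).
have W c x (ac : atlas M c) (dx : dom c x) u : ~ form_ker (g c x) u ->
    bil (g c x) u u <= 0 -> bil (g' c x) u u < 0.
  by move=> nk; apply: wd => // /(vertical_kernel _ tg ac dx).
have {}ip c x (ac : atlas M c) (dx : dom c x) := ip c x ac dx (kk c x ac dx) (W c x ac dx) half.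
split.
- split; [split| | |].
  + move=> c ac k; have oS : open (cimg c [set: M]) := cimg_open (c := c) openT.
    apply: (@Ck_add _ _ _ _ _ (fun w => (1 - 2^-1) *: (g c \o cinv c) w)
       (fun w => 2^-1 *: (g' c \o cinv c) w)) => //.
      by apply: Ck_scale => //; exact: sm.
    by apply: Ck_scale => //; exact: sm'.
  + move=> c d x ac ad cx dx; rewrite /mid_metric (T c d)// (T' c d)//.
    by rewrite mulmxDr mulmxDl -!scalemxAr -!scalemxAl.
  + by move=> c x ac dx; rewrite /mid_metric linearD !linearZ /= S// S'.
  + move=> X vX c x ac dx; have := L X vX c x ac dx; have := L' X vX c x ac dx.
    rewrite /Lie_derivative; set J := 'J _ _ => E' E.
    have oS : open (cimg c [set: M]) := cimg_open (c := c) openT.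
    have Sx : cimg c setT (c x) by exists x.
    have d1 := diff_derivable (v := X c x) (smooth_differentiable oS Sx (sm c ac)).
    have d2 := diff_derivable (v := X c x) (smooth_differentiable oS Sx (sm' c ac)).
    have -> : 'D_(X c x) (mid_metric g g' c \o cinv c) (c x) =
      (1 - 2^-1) *: 'D_(X c x) (g c \o cinv c) (c x) + 2^-1 *: 'D_(X c x) (g' c \o cinv c) (c x).
      rewrite -(deriveZ _ d1) -(deriveZ _ d2).
      have z1 : derivable ((1 - 2^-1) \*: (g c \o cinv c)) (c x) (X c x) by exact: derivableZ.
      have z2 : derivable (2^-1 \*: (g' c \o cinv c)) (c x) (X c x) by exact: derivableZ.
      by rewrite -(deriveD z1 z2).
    rewrite /mid_metric mulmxDr mulmxDl -!scalemxAr -!scalemxAl.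
    transitivity ((1 - 2^-1) *: ('D_(X c x) (g c \o cinv c) (c x) + J *m g c x + g c x *m J^T)
      + 2^-1 *: ('D_(X c x) (g' c \o cinv c) (c x) + J *m g' c x + g' c x *m J^T)).
      by rewrite !scalerDr; apply/matrixP => i j; rewrite !mxE; ring.
    by rewrite E E' !scaler0 addr0.
  + by move=> c x ac dx; have [] := ip c x ac dx.
  + move=> c x ac dx v; have [_ H _ _] := ip c x ac dx.
    by rewrite (vertical_kernel _ tg ac dx) -H.
- move=> c x v ac dx nv; have [_ _ H _] := ip c x ac dx; apply: H.
  by move=> /(vertical_kernel _ tg ac dx).
- move=> c x v ac dx nv; have [_ _ _ H] := ip c x ac dx; apply: H.
  by move=> /(vertical_kernel _ tg ac dx).
Qed.

(** Here [g] is the wider metric and [O] orients the narrower one; by [wide_orientationE] the union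
    is a single wedge. *)
Definition wide_orientation O g c x : set 'rV[R]_n :=
  [set u | exists2 v, O c x v & connected_component (causal_vectors F g c x) v u].

Lemma wider_causal g g' c x : atlas M c -> dom c x -> wider F g g' ->
  causal_vectors F g c x `<=` causal_vectors F g' c x.
Proof. by move=> ac dx wd v [nv vv]; split=> //; apply/ltW; exact: wd. Qed.

Lemma wide_orientationE O g g' c x v : time_orientation F g O -> wider F g g' ->
  atlas M c -> dom c x -> O c x v ->
  wide_orientation O g' c x = connected_component (causal_vectors F g' c x) v.
Proof.
move=> tO wd ac dx Ov; apply/seteqP; split=> u; last by exists v.
move=> [v' Ov' uv']; suff <- : connected_component (causal_vectors F g' c x) v' =
  connected_component (causal_vectors F g' c x) v by [].
apply: same_connected_component.
move: Ov; rewrite (orientation_component tO ac dx Ov') => -[A [Av' As cA] Av].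
exists A => //; split=> //; apply: subset_trans As _; exact: wider_causal.
Qed.

Lemma connected_component_mulmx (A B : set 'rV[R]_n) (J : 'M[R]_n) v u :
  (forall w, A w -> B (w *m J)) -> connected_component A v u ->
  connected_component B (v *m J) (u *m J).
Proof.
move=> AB [C [Cv CA cC] Cu]; exists [set w *m J | w in C]; last by exists u.
split; [by exists v|by move=> _ [w /CA/AB Bw <-]|].
apply: connected_continuous_connected => //; apply: continuous_subspaceT => w.
by have [+ _] := mulmx_Ck 0 J (@openT 'rV[R]_n); exact.
Qed.

Lemma causal_change g c d x v : transverse_lorentzian F g -> atlas M c -> atlas M d ->
  dom c x -> dom d x ->
  causal_vectors F g c x v -> causal_vectors F g d x (v *m 'J (trans c d) (c x)).
Proof.
move=> tg ac ad cx dx [nv vv]; split; last by rewrite (metric_change _ _ tg).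
move=> /(vertical_change tg ad ac dx cx); rewrite -mulmxA trans_jacobianK// mulmx1.
exact: nv.
Qed.

Lemma wide_time_orientation O g g' : transverse_lorentzian F g' ->
  time_orientation F g O -> wider F g g' -> time_orientation F g' (wide_orientation O g').
Proof.
move=> tg' tO wd; have [H T C] := tO.
have Os c x : atlas M c -> dom c x -> O c x `<=` wide_orientation O g' c x.
  move=> ac dx v Ov; exists v => //; apply: connected_component_refl.
  by apply: wider_causal wd _ _ => //; exact: (orientation_causal tO ac dx).
have ne c x : atlas M c -> dom c x -> exists v, O c x v.
  move=> ac dx; have [v cv E] := H c x ac dx; exists v; rewrite E.
  exact: connected_component_refl.
have half c d x : atlas M c -> atlas M d -> dom c x -> dom d x -> forall u,
    wide_orientation O g' c x u -> wide_orientation O g' d x (u *m 'J (trans c d) (c x)).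
  move=> ac ad cx dx u [v Ov vu]; exists (v *m 'J (trans c d) (c x)).
    by rewrite (T c d x)//; exists v.
  by apply: connected_component_mulmx vu => w; exact: (causal_change tg').
split.
- move=> c x ac dx; have [v Ov] := ne c x ac dx; exists v.
    by apply: wider_causal wd _ _ => //; exact: (orientation_causal tO ac dx).
  exact: (wide_orientationE tO wd).
- move=> c d x ac ad cx dx; apply/seteqP; split; last by move=> _ [u Ou <-]; exact: half.
  move=> u Ou; exists (u *m 'J (trans d c) (d x)); first exact: half.
  by rewrite -mulmxA trans_jacobianK// mulmx1.
- move=> x; have [c [X [ac cx NX]]] := C x; exists c, X; split=> //.
  have N1 := open_nbhs_nbhs (conj (dom_open c) cx).
  by apply: filterS2 N1 NX => y cy [cX OX]; split=> //; exact: Os.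
Qed.

Lemma wider_oriented_mid g O g' O' : transverse_lorentzian F g -> time_orientation F g O ->
  wider_oriented F g O g' O' -> exists gm Om,
  wider_oriented F g O gm Om /\ wider_oriented F gm Om g' O'.
Proof.
move=> tg tO [tg' wd tO' OO'].
have [tm w1 w2] := mid_lorentzian tg tg' wd.
exists (mid_metric g g'), (wide_orientation O (mid_metric g g')).
have tOm := wide_time_orientation tm tO w1.
split; split=> //.
  move=> c x ac dx v Ov; exists v => //; apply: connected_component_refl.
  by apply: wider_causal w1 _ _ => //; exact: (orientation_causal tO ac dx).
move=> c x ac dx u [v Ov [A [Av As cA] Au]].
rewrite (orientation_component tO' ac dx (OO' c x ac dx v Ov)).
exists A => //; split=> //; apply: subset_trans As _; exact: wider_causal.
Qed.

End Orientation.

(** * Cones in the transverse coordinates, and freezing one of them at a point *)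

Section TransverseCone.
Context {R : realType} {p q : nat} {M : manifold R (p + q)} (F : foliation M).
Local Notation n := (p + q)%N.
Implicit Types (c d : chart R M n) (x y : M) (e : 'rV[R]_n) (w : 'rV[R]_q)
  (g : chart R M n -> M -> 'M[R]_n) (O : chart R M n -> M -> set 'rV[R]_n).

Definition transverse w : 'rV[R]_n := row_mx 0 w.

Lemma transverseD u w : transverse (u + w) = transverse u + transverse w.
Proof. by rewrite /transverse add_row_mx addr0. Qed.

Lemma transverseZ a w : transverse (a *: w) = a *: transverse w.
Proof. by rewrite /transverse scale_row_mx scaler0. Qed.

Lemma transverse_continuous : continuous transverse.
Proof.
have [+ _] : Ck 0 [set: 'rV[R]_q] transverse.
  apply: Ck_eq (mulmx_Ck 0 (row_mx 0 1%:M : 'M[R]_(q, p + q)) openT); first exact: openT.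
  by move=> w _; rewrite mul_mx_row mulmx0 mulmx1.
by move=> H w; exact: H.
Qed.

Lemma bil_transverse g c r x v u : transverse_lorentzian F g -> adapted F c r -> dom c x ->
  bil (g c x) v u = bil (g c x) (transverse (rsubmx v)) u.
Proof.
move=> tg adc dx.
have {1}-> : v = row_mx (lsubmx v) 0 + transverse (rsubmx v).
  by rewrite /transverse add_row_mx add0r addr0 hsubmxK.
rewrite bilDl {1}/bil (metric_vertical_row tg (adapted_atlas adc) dx) ?mul0mx ?mxE ?add0r//.
by apply/(vertical_adapted _ adc dx); rewrite row_mxKr.
Qed.

Lemma bil_transverse2 g c r x v : transverse_lorentzian F g -> adapted F c r -> dom c x ->
  bil (g c x) v v = bil (g c x) (transverse (rsubmx v)) (transverse (rsubmx v)).
Proof.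
move=> tg adc dx; have Gs := lorentzian_sym tg (adapted_atlas adc) dx.
rewrite (bil_transverse _ _ tg adc dx) (bilC _ _ Gs).
by rewrite (bil_transverse _ _ tg adc dx).
Qed.

Lemma kernel_adapted g c r x v : transverse_lorentzian F g -> adapted F c r -> dom c x ->
  form_ker (g c x) v <-> rsubmx v = 0.
Proof.
move=> tg adc dx; rewrite -(vertical_kernel _ tg (adapted_atlas adc) dx).
exact: (vertical_adapted _ adc dx).
Qed.

Lemma transverse_notker g c r x w : transverse_lorentzian F g -> adapted F c r -> dom c x ->
  w != 0 -> ~ form_ker (g c x) (transverse w).
Proof.
move=> tg adc dx w0 /(kernel_adapted _ tg adc dx); rewrite row_mxKr => /eqP.
by rewrite (negbTE w0).
Qed.

Lemma sphere_compact : compact [set w : 'rV[R]_q | `|w| = 1].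
Proof.
apply: (@subclosed_compact _ _ [set w : 'rV[R]_q | `|w - 0| <= 1]).
- rewrite (_ : [set _ | _] = (fun w => `|w|) @^-1` [set 1])//.
  apply: preimage_closed; first by move=> w _; exact: norm_continuous.
  exact: closed_eq.
- exact: compact_closed_ball.
- by move=> w /= w1; rewrite subr0 w1.
Qed.

(** Unlike a wedge, this contains 0; that makes it closed. *)
Definition form_cone (G : 'M[R]_n) e : set 'rV[R]_q :=
  [set w | bil G (transverse w) (transverse w) <= 0 /\ bil G (transverse w) e <= 0].

Lemma bil_quadratic_continuous (G : 'M[R]_n) :
  continuous (fun w => bil G (transverse w) (transverse w)).
Proof.
by move=> w; exact: (cvg_bil _ (cvg_cst G) (@transverse_continuous w) (@transverse_continuous w)).
Qed.

Lemma bil_linear_continuous (G : 'M[R]_n) e : continuous (fun w => bil G (transverse w) e).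
Proof.
by move=> w; exact: (cvg_bil _ (cvg_cst G) (@transverse_continuous w) (cvg_cst e)).
Qed.

Lemma form_cone_closed (G : 'M[R]_n) e : closed (form_cone G e).
Proof.
have -> : form_cone G e = (fun w => bil G (transverse w) (transverse w)) @^-1` [set t | t <= 0]
    `&` (fun w => bil G (transverse w) e) @^-1` [set t | t <= 0] by [].
apply: closedI; apply: preimage_closed; try exact: closed_le.
- by move=> w _; exact: bil_quadratic_continuous.
- by move=> w _; exact: bil_linear_continuous.
Qed.

Lemma form_cone_interior (G : 'M[R]_n) e w : bil G (transverse w) (transverse w) < 0 ->
  bil G (transverse w) e < 0 -> interior (form_cone G e) w.
Proof.
move=> h1 h2.
have N1 := cvg_lt0 (@bil_quadratic_continuous G w) h1.
have N2 := cvg_lt0 (@bil_linear_continuous G e w) h2.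
by apply: filterS2 N1 N2 => z /ltW ? /ltW.
Qed.

Lemma form_cone_scale (G : 'M[R]_n) e w t : 0 <= t -> form_cone G e w -> form_cone G e (t *: w).
Proof.
move=> t0 [h1 h2]; rewrite /form_cone /= transverseZ !bilZl !bilZr; split.
  by rewrite !mulr_ge0_le0.
by rewrite mulr_ge0_le0.
Qed.

Lemma interior_cone_scale (G : 'M[R]_n) e w t : 0 < t ->
  interior (form_cone G e) w -> interior (form_cone G e) (t *: w).
Proof.
move=> t0 iw.
have cs : t^-1 *: z @[z --> t *: w] --> t^-1 *: (t *: w) by exact: scaler_continuous.
rewrite scalerA mulVf ?gt_eqF// scale1r in cs.
have N : nbhs (t *: w) [set z | form_cone G e (t^-1 *: z)] := cs _ iw.
suff : nbhs (t *: w) (form_cone G e) by [].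
apply: filterS N => z /= /(form_cone_scale (ltW t0)).
by rewrite scalerA divff ?gt_eqF// scale1r.
Qed.

(* C is the projection to the transverse coordinates of the cone of gm at x: it
   is a fixed convex cone, while the cones of g and g' vary with y. *)
Lemma frozen_cone g O gm Om g' O' c r x :
  transverse_lorentzian F g -> time_orientation F g O ->
  wider_oriented F g O gm Om -> wider_oriented F gm Om g' O' ->
  adapted F c r -> dom c x ->
  exists (C : set 'rV[R]_q) (eps : R), [/\ 0 < eps, closed C,
    forall u w, C u -> C w -> C (u + w),
    forall t w, 0 <= t -> C w -> C (t *: w) &
    \forall y \near x, dom c y /\
      (forall v, O c y v -> interior C (rsubmx v)) /\
      (forall v w, C w -> w != 0 -> `|rsubmx v - w| < eps * `|w| -> O' c y v)].
Proof.
move=> tg tO [tm wm tOm Osub] [tg' w' tO' O'sub] adc dx.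
have ac := adapted_atlas adc.
have [e Ne] := orientation_near tg tO ac dx.
have [_ ee Oe Oc] := nbhs_singleton Ne.
have nke : ~ vertical F c x e by have [] := orientation_causal tO ac dx Oe.
have em : bil (gm c x) e e < 0 by apply: wm => //; exact: ltW.
have e' : bil (g' c x) e e < 0 by apply: w' => //; exact: ltW.
have sg := lorentzian_sym tg ac dx; have sm := lorentzian_sym tm ac dx.
have sg' := lorentzian_sym tg' ac dx.
have [_ _ Im _] := tm; have [_ _ I' _] := tg'.
have Wm u : ~ form_ker (g c x) u -> bil (g c x) u u <= 0 -> bil (gm c x) u u < 0.
  by move=> nk; apply: wm => // /(vertical_kernel _ tg ac dx).
have W' u : ~ form_ker (gm c x) u -> bil (gm c x) u u <= 0 -> bil (g' c x) u u < 0.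
  by move=> nk; apply: w' => // /(vertical_kernel _ tm ac dx).
pose C := form_cone (gm c x) e.
have cg := metric_continuous tg ac dx; have cg' := metric_continuous tg' ac dx.
(* First compactness argument, on the unit sphere: at x a direction either violates an inequality of
   the wedge of [g] strictly or is interior to [C], and each of these is stable under moving the
   point and the direction. So wedges of [g] near x project into the interior of [C]. *)
pose P1 y w := 0 < bil (g c y) (transverse w) (transverse w) \/
   (0 < bil (g c y) (transverse w) e \/ interior C w).
have near1 : \forall y \near x, [set w : 'rV[R]_q | `|w| = 1] `<=` P1 y.
  apply: ((compact_near_coveringP _).1 sphere_compact M (nbhs x) P1) => w /= w1.
  suff : filter_prod (nbhs w) (nbhs x) [set zi | P1 zi.2 zi.1] by [].
  have w0 : w != 0 by rewrite -normr_eq0 w1 oner_eq0.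
  have cz : transverse zi.1 @[zi --> filter_prod (nbhs w) (nbhs x)] --> transverse w.
    exact: (cvg_comp fst transverse cvg_fst (@transverse_continuous w)).
  have ci : g c zi.2 @[zi --> filter_prod (nbhs w) (nbhs x)] --> g c x.
    exact: (cvg_comp snd (g c) cvg_snd cg).
  have FP : Filter (filter_prod (nbhs w) (nbhs x)) by exact: filter_prod_filter.
  have cw2 := cvg_bil FP ci cz cz; have cw1 := cvg_bil FP ci cz (@cvg_cst _ e _ _ FP).
  have [h1|h1] := ltP 0 (bil (g c x) (transverse w) (transverse w)).
    have N : filter_prod (nbhs w) (nbhs x) [set zi | 0 < bil (g c zi.2) (transverse zi.1) (transverse zi.1)] := cvg_gt0 cw2 h1.
    by apply: filterS N => -[z i] /=; left.
  have [h2|h2] := ltP 0 (bil (g c x) (transverse w) e).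
    have N : filter_prod (nbhs w) (nbhs x) [set zi | 0 < bil (g c zi.2) (transverse zi.1) e] := cvg_gt0 cw1 h2.
    by apply: filterS N => -[z i] /=; right; left.
  have nk := transverse_notker tg adc dx w0.
  have h3 : bil (g c x) (transverse w) e < 0.
    rewrite lt_neqAle h2 andbT.
    by have [_ _ I _] := tg; exact: (causal_timelike_neq0 sg (I c x ac dx) ee nk h1).
  have [m1 m2] := wider_cone sg sm (Im c x ac dx) Wm ee h1 h3.
  have iC : \forall z \near w, interior C z.
    by apply/nbhs_interior; exact: form_cone_interior.
  have iC' : filter_prod (nbhs w) (nbhs x) [set zi | interior C zi.1].
    by apply: (cvg_fst (F := nbhs w) (G := nbhs x)); exact: iC.
  by apply: filterS iC' => -[z i] /=; right; right.
pose A := [set w : 'rV[R]_q | `|w| = 1] `&` C.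
have cA : compact A by apply: compact_closedI; [exact: sphere_compact|exact: form_cone_closed].
(* Second compactness argument, on the unit vectors of [C]: they are strictly future for [g'],
   uniformly under moving the point and perturbing the vector. The size of the admissible
   perturbation is [eps]. *)
pose P2 (i : M * 'rV[R]_q) w := bil (g' c i.1) (transverse (w + i.2)) (transverse (w + i.2)) < 0 /\
   bil (g' c i.1) (transverse (w + i.2)) e < 0.
pose F2 := filter_prod (nbhs x) (nbhs (0 : 'rV[R]_q)).
have near2 : \forall i \near F2, A `<=` P2 i.
  apply: ((compact_near_coveringP _).1 cA _ F2 P2) => w [/= w1 [h1 h2]].
  suff : filter_prod (nbhs w) F2 [set zi | P2 zi.2 zi.1] by [].
  have w0 : w != 0 by rewrite -normr_eq0 w1 oner_eq0.
  have nk := transverse_notker tm adc dx w0.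
  have h3 : bil (gm c x) (transverse w) e < 0.
    rewrite lt_neqAle h2 andbT.
    exact: (causal_timelike_neq0 sm (Im c x ac dx) em nk h1).
  have [m1 m2] := wider_cone sm sg' (I' c x ac dx) W' em h1 h3.
  set FF := filter_prod (nbhs w) F2; have FP : Filter FF by exact: filter_prod_filter.
  have cs : zi.1 + zi.2.2 @[zi --> FF] --> w + 0.
    exact: (cvgD cvg_fst (cvg_comp snd snd cvg_snd cvg_snd)).
  rewrite addr0 in cs.
  have cz : transverse (zi.1 + zi.2.2) @[zi --> FF] --> transverse w.
    exact: (cvg_comp (fun zi => zi.1 + zi.2.2) transverse cs (@transverse_continuous w)).
  have ci : g' c zi.2.1 @[zi --> FF] --> g' c x.
    exact: (cvg_comp (fun zi => zi.2.1) (g' c) (cvg_comp snd fst cvg_snd cvg_fst) cg').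
  have N1 : FF [set zi | bil (g' c zi.2.1) (transverse (zi.1 + zi.2.2)) (transverse (zi.1 + zi.2.2)) < 0] := cvg_lt0 (cvg_bil FP ci cz cz) m1.
  have N2 : FF [set zi | bil (g' c zi.2.1) (transverse (zi.1 + zi.2.2)) e < 0] := cvg_lt0 (cvg_bil FP ci cz (@cvg_cst _ e _ _ FP)) m2.
  by apply: filterS2 N1 N2 => -[z [y zeta]] /=.
have [eps eps0 near3] : exists2 eps : R, 0 < eps & \forall y \near x, forall zeta : 'rV[R]_q, `|zeta| < eps -> A `<=` P2 (y, zeta).
  have [[B1 B2] /= [n1 n2] BS] := near2.
  have [eps /= eps0 epsB] := (nbhs_ballP _ _).1 n2.
  exists eps => //; apply: filterS n1 => y By zeta ze.
  apply: (BS (y, zeta)); split=> //=; apply: epsB; rewrite -ball_normE /= sub0r normrN//.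
exists C, eps; split=> //.
- exact: form_cone_closed.
- move=> u w [u1 u2] [w1 w2]; rewrite /C /form_cone /= transverseD.
  exact: (cone_add sm (Im c x ac dx) em).
- by move=> t w; exact: form_cone_scale.
have near4 : \forall y \near x, bil (g' c y) e e < 0.
  exact: (cvg_lt0 (cvg_bil _ cg' (cvg_cst e) (cvg_cst e)) e').
have FX : Filter (nbhs x) by exact: nbhs_filter.
have N5 := @filterI _ _ FX _ _ (@filterI _ _ FX _ _ Ne near1) (@filterI _ _ FX _ _ near3 near4).
apply: filterS N5 => y [[[dy ey Oey Ocy] S1] [S2 e'y]].
split=> //; split.
  move=> v; rewrite Ocy => -[[nk vv] ve].
  have v0 : rsubmx v != 0.
    by apply/eqP => v0; apply: nk; apply/(kernel_adapted _ tg adc dy).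
  have nv0 : 0 < `|rsubmx v| by rewrite normr_gt0.
  pose w := `|rsubmx v|^-1 *: rsubmx v.
  have w1 : `|w| = 1 by rewrite normrZ normfV normr_id mulVf// gt_eqF.
  have vE : rsubmx v = `|rsubmx v| *: w by rewrite scalerA divff ?scale1r// gt_eqF.
  have := S1 w w1; rewrite /P1 /w !transverseZ !bilZl !bilZr.
  rewrite -(bil_transverse2 _ tg adc dy) -(bil_transverse _ _ tg adc dy).
  case=> [|[|]].
  - rewrite mulrA pmulr_rgt0; last by rewrite mulr_gt0// invr_gt0.
    by rewrite ltNge vv.
  - by rewrite pmulr_rgt0 ?invr_gt0// ltNge (ltW ve).
  - move=> iw; rewrite -[rsubmx v]scale1r -(divff (lt0r_neq0 nv0)) -scalerA.
    exact: interior_cone_scale.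
move=> v w Cw w0 vw.
have nw0 : 0 < `|w| by rewrite normr_gt0.
pose w1 := `|w|^-1 *: w; pose zeta := `|w|^-1 *: (rsubmx v - w).
have Aw1 : A w1.
  split; first by rewrite /w1 /= normrZ normfV normr_id mulVf// gt_eqF.
  by apply: form_cone_scale => //; rewrite invr_ge0 ltW.
have ze : `|zeta| < eps by rewrite normrZ normfV normr_id mulrC ltr_pdivrMr.
have := S2 zeta ze w1 Aw1; rewrite /P2 /=.
have -> : w1 + zeta = `|w|^-1 *: rsubmx v by rewrite /w1 /zeta -scalerDr addrC subrK.
rewrite !transverseZ !bilZl !bilZr.
rewrite -(bil_transverse2 _ tg' adc dy) -(bil_transverse _ _ tg' adc dy).
rewrite pmulr_rlt0 ?invr_gt0// pmulr_rlt0 ?invr_gt0// pmulr_rlt0 ?invr_gt0// => -[vv ve].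
have Oe' : O' c y e by apply: O'sub => //; apply: Osub.
rewrite (orientation_char tg' tO' ac dy e'y Oe' e'y); split=> //; split; last exact: ltW.
by apply: (@notker_of_neq0 _ _ _ _ _ e); rewrite lt_eqF.
Qed.

End TransverseCone.

Lemma connected_locally_constant (T : topologicalType) (S : set T) (Q : T -> Prop) (a b : T) :
  connected S -> (forall z, S z -> \forall z' \near z, S z' -> (Q z' <-> Q z)) ->
  S a -> S b -> Q a -> Q b.
Proof.
move=> cS loc Sa Sb Qa.
have E : S `&` Q = S.
  apply: cS; first by exists a.
    exists (interior [set z | S z -> Q z]); first exact: open_interior.
    apply/seteqP; split=> z [Sz H]; split=> //; last exact: (interior_subset H).
    by have := loc z Sz; apply: filterS => z' Hz' Sz'; apply/(Hz' Sz').
  exists (~` interior [set z | S z -> ~ Q z]); first exact/open_closedC/open_interior.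
  apply/seteqP; split=> z [Sz H]; split=> //.
    by move=> /interior_subset /(_ Sz).
  apply: contrapT => nQ; apply: H.
  by have := loc z Sz; apply: filterS => z' Hz' Sz' Qz'; apply/nQ/(Hz' Sz').
by move: Sb; rewrite -{1}E => -[].
Qed.

(** * The leaf space *)

Section LeafSpace.
Context {R : realType} {p q : nat} {M : manifold R (p + q)} (F : foliation M).
Local Notation n := (p + q)%N.
Implicit Types (c d : chart R M n) (x y z : M).

Lemma leaf_ofP x y : leaf_of F x = leaf_of F y <-> same_leaf F x y.
Proof.
split=> [E|H]; last by apply/eqmodP.
by apply/eqmodP.
Qed.

Lemma leaf_of_surj (L : leaf_space F) : exists x, leaf_of F x = L.
Proof. by exists (repr L); rewrite /leaf_of reprK. Qed.

Lemma leaf_of_continuous : continuous (leaf_of F).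
Proof. exact: pi_continuous. Qed.

(** A translation in coordinates carrying z to y; when these share a plaque it preserves plaques. It
    is meaningful only for z' near z, elsewhere the argument of [cinv] may leave the image of the
    chart. *)
Definition plaque_shift c y z z' : M := cinv c (c z' + (c y - c z)).

Lemma plaque_shiftP c r y z : adapted F c r -> dom c y -> dom c z ->
  rsubmx (c y) = rsubmx (c z) ->
  [/\ plaque_shift c y z z = y, {for z, continuous (plaque_shift c y z)} &
    \forall z' \near z, same_leaf F (plaque_shift c y z z') z'].
Proof.
move=> adc dy dz eyz.
have E : c z + (c y - c z) = c y by rewrite addrC subrK.
have c1 : c z' + (c y - c z) @[z' --> z] --> c y.
  by rewrite -[X in _ --> X]E; exact: (cvgD (cmap_continuous dz) (cvg_cst _)).
split.
- by rewrite /plaque_shift E cmapK.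
- apply: (@continuous_comp _ _ _ (fun z' => c z' + (c y - c z)) (cinv c)); first by suff : c z' + (c y - c z) @[z' --> z] --> c z + (c y - c z) by []; rewrite E.
  by rewrite E; exact: cinv_continuous.
have yr := adapted_norm adc dy.
have N1 : \forall z' \near z, `|c z' + (c y - c z)| < r.
  have N : nbhs (c y) [set w | `|w| < r] by apply: open_nbhs_nbhs; split=> //; exact: open_norm_lt0.
  exact: (c1 _ N).
have N2 := open_nbhs_nbhs (conj (dom_open c) dz).
apply: filterS2 N1 N2 => z' /(adapted_cinv adc)[d1 d2] dz'.
apply: (adapted_plaque adc) => //; rewrite /plaque_shift d2 linearD linearB /= eyz subrr addr0//.
Qed.

Definition saturation (B : set M) : set M := [set x | exists2 y, B y & same_leaf F y x].

(** Neighborhoods are carried from plaque to plaque by [plaque_shift]. This makes the projection to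
    the leaf space open, so that neighborhoods of a leaf can be built from a chart. *)
Lemma saturation_open (B : set M) : open B -> open (saturation B).
Proof.
move=> oB; rewrite openE => x [y By yx].
suff : nbhs x (saturation B) by [].
apply: (plaque_induction (P := fun z => nbhs z (saturation B)) _ yx); last first.
  have := open_nbhs_nbhs (conj oB By); apply: filterS => y' By'.
  by exists y' => //; exact: same_leaf_refl.
move=> x0; have [c [r [adc _ dx _]]] := adapted_exists F openT (I : [set: M] x0).
exists c, r; split=> // y1 z1 dy1 dz1 E N.
have [s1 s2 s3] := plaque_shiftP adc dy1 dz1 E.
have N' : nbhs z1 (plaque_shift c y1 z1 @^-1` saturation B) by apply: s2; rewrite s1.
apply: filterS2 N' s3 => z' [b Bb bz] sz; exists b => //.
exact: same_leaf_trans bz sz.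
Qed.

Lemma leaf_of_open (B : set M) : open B -> open (leaf_of F @` B).
Proof.
move=> oB; rewrite /open /= /quotient_open.
rewrite (_ : _ @^-1` _ = saturation B); first exact: saturation_open.
apply/seteqP; split=> x.
  by move=> [y By yx]; exists y => //; apply/leaf_ofP.
by move=> [y By yx]; exists y => //; apply/leaf_ofP.
Qed.

End LeafSpace.

(** * Invariance of the wedges along plaques and under vertical vectors *)

Section OrientationPlaque.
Context {R : realType} {p q : nat} {M : manifold R (p + q)} (F : foliation M).
Local Notation n := (p + q)%N.
Implicit Types (c d : chart R M n) (x y z : M)
  (g : chart R M n -> M -> 'M[R]_n) (O : chart R M n -> M -> set 'rV[R]_n).

Lemma adapted_segment c r x y : adapted F c r -> dom c x -> dom c y ->
  forall s, 0 <= s <= 1 -> `|(1 - s) *: c x + s *: c y| < r.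
Proof.
move=> adc dx dy s /andP[s0 s1].
apply: le_lt_trans (ler_normD _ _) _; rewrite !normrZ !ger0_norm ?subr_ge0//.
have := adapted_norm adc dx; have := adapted_norm adc dy.
set A := `|c x|; set B := `|c y| => Br Ar.
have [->|s1'] := eqVneq s 1; first by rewrite subrr mul0r add0r mul1r.
have s1s : s < 1 by rewrite lt_neqAle s1'.
apply: (@lt_le_trans _ _ ((1 - s) * r + s * r)); last by lra.
by apply: ltr_leD; [rewrite ltr_pM2l// subr_gt0|rewrite ler_wpM2l// ltW].
Qed.

(** The metric is constant on the plaque, so by [orientation_near] the wedge is locally constant on
    the segment joining the points, which is connected. *)
Lemma orientation_plaque g O c r x y : transverse_lorentzian F g -> time_orientation F g O ->
  adapted F c r -> dom c x -> dom c y -> rsubmx (c x) = rsubmx (c y) -> O c x = O c y.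
Proof.
move=> tg tO adc dx dy exy.
pose S := [set (1 - s) *: c x + s *: c y | s in `[(0:R), 1]].
have Sr w : S w -> [/\ `|w| < r, dom c (cinv c w) & rsubmx (c (cinv c w)) = rsubmx (c x)].
  move=> [s /= + <-]; rewrite in_itv/= => s01.
  have wr := adapted_segment adc dx dy s01; have [d1 d2] := adapted_cinv adc wr.
  by split=> //; rewrite d2 linearD !linearZ /= -exy -scalerDl subrK scale1r.
have Sx : S (c x).
  by exists 0; rewrite /= ?in_itv/= ?lexx ?ler01// subr0 scale1r scale0r addr0.
have Sy : S (c y).
  by exists 1; rewrite /= ?in_itv/= ?lexx ?ler01// subrr scale0r add0r scale1r.
suff : O c x = O c (cinv c (c y)) by rewrite cmapK.
apply: (connected_locally_constant (S := S) (Q := fun w => O c x = O c (cinv c w)) _ _ Sx Sy).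
- exact: rV_segment_connected.
- move=> w /Sr[wr dw ew].
  have [e Ne] := orientation_near tg tO (adapted_atlas adc) dw.
  have cw : {for w, continuous (cinv c)}.
    by apply: cinv_continuous_at; rewrite (adapted_cod adc).
  have N1 : nbhs w [set w' | [/\ dom c (cinv c w'), bil (g c (cinv c w')) e e < 0, O c (cinv c w') e &
    O c (cinv c w') = [set u | causal_set (g c (cinv c w')) u /\ bil (g c (cinv c w')) u e < 0]]] := cw _ Ne.
  apply: filterS N1 => w' [dw' _ _ Ow'] /Sr[_ _ ew'].
  have [_ _ _ Ow] := nbhs_singleton Ne.
  suff -> : O c (cinv c w') = O c (cinv c w) by [].
  by rewrite Ow' Ow (metric_plaque tg adc dw' dw) ?ew' ?ew.
- by rewrite cmapK.
Qed.

(** Vertical vectors are in the kernel of the form and do not change the inequalities that define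
    the wedge. This is what allows a vertical displacement to vary with time. *)
Lemma orientation_shift g O c r x v (w : 'rV[R]_p) : transverse_lorentzian F g ->
  time_orientation F g O -> adapted F c r -> dom c x -> O c x v -> O c x (v + row_mx w 0).
Proof.
move=> tg tO adc dx Ov; have ac := adapted_atlas adc.
have [e Ne] := orientation_near tg tO ac dx.
have [_ _ _ Ox] := nbhs_singleton Ne; move: Ov; rewrite Ox => -[[nk vv] ve].
have kw : row_mx w 0 *m g c x = 0.
  by apply: (metric_vertical_row tg ac dx); apply/(vertical_adapted _ adc dx); rewrite row_mxKr.
have B u : bil (g c x) (v + row_mx w 0) u = bil (g c x) v u.
  by rewrite bilDl {2}/bil kw mul0mx mxE addr0.
split; [split|].
- by move=> k; apply: nk => u; rewrite -B.
- by rewrite B (bilC _ _ (lorentzian_sym tg ac dx)) B.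
- by rewrite B.
Qed.

End OrientationPlaque.

(** * Causal curves *)

Section AffineTime.
Context {R : realType}.

Lemma Ck_affine (W : normedModType R) k (U : set R) (f : R -> W) (al be : R) : open U ->
  Ck k U f -> Ck k [set t | U (al * t + be)] (fun t => f (al * t + be)).
Proof.
move=> oU; have ca : continuous (fun t : R => al * t + be).
  by move=> t; exact: (cvgD (cvgM (cvg_cst al) cvg_id) (cvg_cst be)).
have oU' : open [set t | U (al * t + be)].
  by apply: (@open_comp _ _ (fun t : R => al * t + be)) => // t _; exact: ca.
elim: k f => [|k IH] f Cf.
  by split=> // t Ut; exact: (continuous_comp (ca t) (Cf.1 _ Ut)).
split; first by move=> t Ut; exact: (continuous_comp (ca t) (Cf.1 _ Ut)).
move=> v; have [_ /(_ v)[_ Cfv]] := Cf; have [_ /(_ 1)[df1 _]] := Cf.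
have da t : is_derive t v (fun t : R => al * t + be) (al * v).
  have -> : (fun t : R => al * t + be) = (fun t : R => be + t *: al).
    by apply/funext => s; rewrite addrC mulrC.
  have d1 : is_derive t 1 (fun t : R => be + t *: al) al.
    have d0 : derivable (id : R -> R) (be + t *: al) al by exact: derivable_id.
    by have := is_derive_line d0; rewrite derive_id.
  have [d2 D2] := d1; have [d3 D3] := derivable_scale_dir v d2.
  rewrite (_ : v *: (1 : R) = v) in d3 D3; last by rewrite -[LHS]/(v * 1) mulr1.
  by apply: DeriveDef; [exact: d3|rewrite D3 D2 mulrC].
have dc t : U (al * t + be) ->
    is_derive t v (fun t => f (al * t + be)) (al *: 'D_v f (al * t + be)).
  move=> Ut; have [d1 D1] := da t.
  apply: (is_derive_eq (derive_comp d1 ((derivable1_diffP _ _).1 (df1 _ Ut)))).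
  rewrite D1; have [_ /(_ v)[dfv _]] := Cf.
  by rewrite -[al * v]/(al *: v) (derivable_scale_dir al (dfv _ Ut)).2.
split; first by move=> t Ut; have [] := dc t Ut.
apply: Ck_eq (Ck_scale al oU' (IH _ Cfv)) => // t; rewrite inE => Ut.
by have [_ ->] := dc t Ut.
Qed.

Lemma open_itv_set (a b : R) : open [set t : R | a < t < b].
Proof.
rewrite (_ : [set _ | _] = [set t | a < t] `&` [set t | t < b]).
  by apply: openI; [exact: open_gt|exact: open_lt].
by apply/seteqP; split=> t /=; [move=> /andP[]|move=> [-> ->]].
Qed.

End AffineTime.

Section Curves.
Context {R : realType} {n : nat} {M : manifold R n}.
Implicit Types (c d : chart R M n) (tau : R -> M) (U : set R).

Lemma smooth_into_sub U U' tau : U' `<=` U -> smooth_into U tau -> smooth_into U' tau.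
Proof.
move=> sU [c1 s1]; split; first by move=> t /sU; exact: c1.
by move=> c ac k; apply: Ck_sub (s1 c ac k) => t [/sU Ut dt].
Qed.

Lemma smooth_into_chart_open U tau c : open U -> smooth_into U tau ->
  open (U `&` tau @^-1` dom c).
Proof.
move=> oU [ct _]; rewrite openE => t [Ut dt]; apply: filterI.
  by apply: open_nbhs_nbhs.
by apply: (ct t Ut); apply: open_nbhs_nbhs; split=> //; exact: dom_open.
Qed.

Lemma smooth_into_derivable U tau c t : open U -> smooth_into U tau -> atlas M c -> U t ->
  dom c (tau t) -> derivable (c \o tau) t 1.
Proof.
move=> oU st ac Ut dt; have [_ /(_ c ac 1%N)[_ /(_ 1)[+ _]]] := st; apply.
by split.
Qed.

Lemma derive1_chart U tau c d t : open U -> smooth_into U tau -> atlas M c -> atlas M d ->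
  U t -> dom c (tau t) -> dom d (tau t) ->
  derive1 (d \o tau) t = derive1 (c \o tau) t *m 'J (trans c d) (c (tau t)).
Proof.
move=> oU st ac ad Ut ct dt; rewrite !derive1E.
have dc := smooth_into_derivable oU st ac Ut ct.
have dT := trans_differentiable ac ad ct dt.
have N : \forall s \near t, (trans c d \o (c \o tau)) s = (d \o tau) s.
  have Wt : (U `&` tau @^-1` dom c) t by [].
  have := open_nbhs_nbhs (conj (smooth_into_chart_open (c := c) oU st) Wt).
  by apply: filterS => s [Us ds]; rewrite /= /trans /= cmapK.
rewrite -(near_eq_derive _ N); have [_ ->] := derive_comp dc dT.
by rewrite (deriveEjacobian _ dT).
Qed.

Lemma smooth_into_cinv U c (phi : R -> 'rV[R]_n) : open U -> atlas M c ->
  smooth_on U phi -> (forall t, U t -> [set c y | y in dom c] (phi t)) ->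
  smooth_into U (cinv c \o phi).
Proof.
move=> oU ac sp Up.
have cc t : U t -> {for t, continuous (cinv c \o phi)}.
  move=> Ut; apply: continuous_comp; first exact: ((sp 0%N).1 t Ut).
  exact: (cinv_continuous_at (Up t Ut)).
split=> // d ad k.
have oV : open (U `&` (cinv c \o phi) @^-1` dom d).
  rewrite openE => t [Ut dt]; apply: filterI; first by apply: open_nbhs_nbhs.
  by apply: (cc t Ut); apply: open_nbhs_nbhs; split=> //; exact: dom_open.
have Cp : Ck k (U `&` (cinv c \o phi) @^-1` dom d) phi by apply: Ck_sub (sp k) => t [].
have fU t : (U `&` (cinv c \o phi) @^-1` dom d) t -> cimg c (dom d) (phi t).
  by move=> [Ut dt]; apply/cimgP; split=> //; exact: Up.
have := Ck_comp_mx oV (cimg_open (c := c) (dom_open d)) fU Cp (trans_smooth ac ad k).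
exact.
Qed.

Lemma smooth_into_affine U tau (al be : R) : open U -> smooth_into U tau ->
  smooth_into [set t | U (al * t + be)] (fun t => tau (al * t + be)).
Proof.
move=> oU st; have [ct sc] := st; split.
  move=> t Ut; apply: (@continuous_comp _ _ _ (fun t : R => al * t + be) tau); last exact: ct.
  exact: (cvgD (cvgM (cvg_cst al) cvg_id) (cvg_cst be)).
move=> c ac k.
exact: (Ck_affine al be (smooth_into_chart_open (c := c) oU st) (sc c ac k)).
Qed.

Lemma derive1_affine (f : R -> 'rV[R]_n) (al be t : R) : derivable f (al * t + be) 1 ->
  derive1 (fun t => f (al * t + be)) t = al *: derive1 f (al * t + be).
Proof.
move=> df; rewrite !derive1E.
have -> : (fun t => f (al * t + be)) = (fun t => f (be + t *: al)).
  by apply/funext => s; rewrite addrC mulrC.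
have E : al * t + be = be + t *: al by rewrite addrC mulrC.
rewrite -derive_line E in df *.
have [_ <-] := derivable_scale_dir al df.
by rewrite -[al *: (1 : R)]/(al * 1) mulr1.
Qed.

End Curves.

Section FutureCurves.
Context {R : realType} {p q : nat} {M : manifold R (p + q)}.
Local Notation n := (p + q)%N.
Implicit Types (c d : chart R M n) (tau sigma : R -> M) (U : set R) (x y z : M)
  (O : chart R M n -> M -> set 'rV[R]_n).

Definition tangent_in O tau t := forall c, atlas M c -> dom c (tau t) ->
  O c (tau t) (derive1 (c \o tau) t).

Lemma tangent_in_chart O U tau t c : open U -> smooth_into U tau -> U t -> atlas M c ->
  dom c (tau t) ->
  (forall c d x, atlas M c -> atlas M d -> dom c x -> dom d x ->
        O d x = [set v *m 'J (trans c d) (c x) | v in O c x]) ->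
  O c (tau t) (derive1 (c \o tau) t) -> tangent_in O tau t.
Proof.
move=> oU st Ut ac ct T Oc d ad dt.
rewrite (derive1_chart oU st ac ad Ut ct dt) (T c d _ ac ad ct dt).
by eexists; first exact: Oc.
Qed.

Definition future_segment O x y := exists (tau : R -> M) (a b e : R),
  [/\ 0 < e /\ a < b, smooth_into [set t : R | a - e < t < b + e] tau,
    forall t, a <= t <= b -> tangent_in O tau t, tau a = x & tau b = y].

(** Causal curves as chains of smooth segments, each with its own parameter interval: easier to
    concatenate and to modify at an end than [future_curve], to which [future_reach_curve] leads
    back. *)
Inductive future_reach O : M -> M -> Prop :=
| FutureSegment x y : future_segment O x y -> future_reach O x y
| FutureStep x y z : future_reach O x y -> future_segment O y z -> future_reach O x z.

Lemma future_reach_trans O x y z : future_reach O x y -> future_reach O y z -> future_reach O x z.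
Proof.
move=> xy yz; elim: yz xy => {y z} [y z seg|y z w yz IH zw] xy; first exact: FutureStep seg.
exact: FutureStep (IH xy) zw.
Qed.

Lemma future_piece_segment O sigma a b : a < b -> future_piece O sigma a b ->
  future_segment O (sigma a) (sigma b).
Proof.
move=> ab [e [tau [e0 st E H]]]; exists tau, a, b, e; split=> //.
- by move=> t tab c ac dt; exact: H.
- by apply: E; rewrite lexx ltW.
- by apply: E; rewrite lexx ltW.
Qed.

Lemma future_curve_reach O sigma a b : future_curve O sigma a b ->
  future_reach O (sigma a) (sigma b).
Proof.
move=> [k [t [ta tb H]]]; rewrite -ta -tb.
have : forall j, (j <= k)%N -> future_reach O (sigma (t 0%N)) (sigma (t j.+1)).
  elim=> [|j IH] jk.
    by have [lt0 P0] := H 0%N jk; apply: FutureSegment; exact: future_piece_segment.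
  have [ltj Pj] := H j.+1 jk.
  by apply: FutureStep (IH (ltnW jk)) _; exact: future_piece_segment.
exact.
Qed.

Lemma future_piece_eq O sigma sigma' a b : (forall t, a <= t <= b -> sigma t = sigma' t) ->
  future_piece O sigma a b -> future_piece O sigma' a b.
Proof.
move=> E [e [tau [e0 st Et H]]]; exists e, tau; split=> // t tab.
by rewrite Et// E.
Qed.

Lemma future_reach_curve O x y : future_reach O x y -> exists sigma a b,
  [/\ future_curve O sigma a b, sigma a = x & sigma b = y].
Proof.
elim=> {x y} [x y [tau [a [b [e [[e0 ab] st H ta tb]]]]]|x y z _ [sigma [a [b [[k [t [t0 tk Ht]]] sa sb]]]] [tau [a2 [b2 [e [[e0 ab] st H ta tb]]]]]].
  exists tau, a, b; split=> //; exists 0%N, (fun i => if i == 0%N then a else b); split=> //.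
  move=> [|i]//= _; split=> //; exists e, tau; split=> //.
  by move=> t c tab; exact: H.
have tmono j : (j <= k.+1)%N -> t j <= b.
  have aux m : (m <= k.+1)%N -> t (k.+1 - m)%N <= b.
    elim: m => [|m IH] mk; first by rewrite subn0 tk.
    have E : (k.+1 - m.+1).+1 = (k.+1 - m)%N by rewrite -subSn// subSS.
    have [/ltW lt _] := Ht (k.+1 - m.+1)%N (leq_subr m k).
    by apply: le_trans lt _; rewrite E; apply: IH; exact: ltnW.
  by move=> jk; rewrite -(subKn jk); apply: aux; exact: leq_subr.
(* The new segment is shifted in time to start at b; at the joint the old curve is used, and both
   agree there. *)
pose sigma' s := if s <= b then sigma s else tau (s - b + a2).
pose b' := b + (b2 - a2); have bb' : b < b' by rewrite ltrDl subr_gt0.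
exists sigma', a, b'; split.
- pose t' i := if (i <= k.+1)%N then t i else b'.
  have t'1 i : (i <= k.+1)%N -> t' i = t i by rewrite /t' => ->.
  have t'2 : t' k.+2 = b' by rewrite /t' ltnn.
  exists k.+1, t'; split; [by rewrite t'1|exact: t'2|].
  move=> i; rewrite leq_eqVlt => /orP[/eqP ->|ik].
    rewrite t'2 t'1// tk; split=> //.
    have st' := smooth_into_affine 1 (a2 - b) (@open_itv_set R _ _) st.
    exists e, (fun s => tau (1 * s + (a2 - b))); split=> //.
    + apply: smooth_into_sub st' => s /=; rewrite mul1r /b' => /andP[s1 s2].
      by apply/andP; split; lra.
    + move=> s /andP[s1 s2]; rewrite /sigma' mul1r.
      case: ifP => sb'; last by congr (tau _); ring.
      have -> : s = b by apply/eqP; rewrite eq_le sb' s1.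
      by rewrite addrCA subrr addr0 ta sb.
    + move=> s c /andP[s1 s2] ac dt.
      have sab : a2 <= 1 * s + (a2 - b) <= b2.
        by apply/andP; split; move: s2; rewrite /b'; lra.
      have U1 : [set t : R | a2 - e < t < b2 + e] (1 * s + (a2 - b)).
        by move: sab => /andP[? ?] /=; apply/andP; split; lra.
      have dd := smooth_into_derivable (@open_itv_set R _ _) st ac U1 dt.
      have := derive1_affine dd; rewrite scale1r => E.
      by rewrite -[X in O c _ X]/(derive1 (fun s => (c \o tau) (1 * s + (a2 - b))) s) E; exact: H.
  rewrite ltnS in ik; have ik1 : (i <= k.+1)%N by exact: leq_trans ik _.
  have [lt P] := Ht i ik; rewrite !t'1//; split=> //.
  apply: future_piece_eq P => s /andP[_ s2]; rewrite /sigma' ifT//.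
  exact: le_trans s2 (tmono _ _).
- rewrite /sigma' ifT//; by rewrite -t0; exact: tmono.
- rewrite /sigma' ifF; last by apply/negbTE; rewrite -ltNge.
  by rewrite -tb; congr (tau _); rewrite /b'; ring.
Qed.

Lemma future_segment_sub O O' x y :
  (forall c x, atlas M c -> dom c x -> O c x `<=` O' c x) ->
  future_segment O x y -> future_segment O' x y.
Proof.
move=> OO [tau [a [b [e [e0 st H ta tb]]]]]; exists tau, a, b, e; split=> //.
by move=> t tab c ac dt; apply: OO => //; exact: H.
Qed.

Lemma future_reach_sub O O' x y :
  (forall c x, atlas M c -> dom c x -> O c x `<=` O' c x) ->
  future_reach O x y -> future_reach O' x y.
Proof.
move=> OO; elim=> {x y} [x y s|x y z _ IH s].
  by apply: FutureSegment; exact: future_segment_sub s.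
by apply: FutureStep IH _; exact: future_segment_sub s.
Qed.

Definition reversed O c x : set 'rV[R]_n := [set v | O c x (- v)].

Lemma future_segment_rev O x y : future_segment O x y -> future_segment (reversed O) y x.
Proof.
move=> [tau [a [b [e [[e0 ab] st H ta tb]]]]].
exists (fun s => tau (-1 * s + 0)), (- b), (- a), e; split.
- by split=> //; lra.
- have := smooth_into_affine (-1) 0 (@open_itv_set R _ _) st.
  by apply: smooth_into_sub => s /= /andP[s1 s2]; apply/andP; split; lra.
- move=> s /andP[s1 s2] c ac dt.
  have sab : a <= -1 * s + 0 <= b by apply/andP; split; lra.
  have U1 : [set t : R | a - e < t < b + e] (-1 * s + 0).
    by move: sab => /andP[? ?] /=; apply/andP; split; lra.
  have dd := smooth_into_derivable (@open_itv_set R _ _) st ac U1 dt.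
  have E := derive1_affine dd.
  rewrite /reversed /= -[X in O c _ (- X)]/(derive1 (fun s => (c \o tau) (-1 * s + 0)) s) E.
  by rewrite scaleN1r opprK; exact: H.
- by rewrite addr0 mulrNN mul1r.
- by rewrite addr0 mulrNN mul1r.
Qed.

Lemma future_reach_rev O x y : future_reach O x y -> future_reach (reversed O) y x.
Proof.
elim=> {x y} [x y s|x y z _ IH s].
  by apply: FutureSegment; exact: future_segment_rev.
apply: future_reach_trans IH; apply: FutureSegment; exact: future_segment_rev.
Qed.

End FutureCurves.

(** * Moving curves along the leaves, and the order between leaves *)

Section LeafOrder.
Context {R : realType} {p q : nat} {M : manifold R (p + q)} (F : foliation M).
Local Notation n := (p + q)%N.
Implicit Types (c d : chart R M n) (tau sigma : R -> M) (U : set R) (x y z : M)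
  (g : chart R M n -> M -> 'M[R]_n) (O : chart R M n -> M -> set 'rV[R]_n).

Lemma leaf_ltP O (L L' : leaf_space F) : leaf_lt F O L L' <->
  exists x y, [/\ leaf_of F x = L, leaf_of F y = L' & future_reach O x y].
Proof.
split=> [[sigma [a [b [H La Lb _]]]]|[x [y [xL yL' xy]]]].
  by exists (sigma a), (sigma b); split=> //; exact: future_curve_reach.
have [sigma [a [b [H sa sb]]]] := future_reach_curve xy.
by exists sigma, a, b; split=> //; rewrite /leaf_set /= ?sa ?sb.
Qed.

Lemma Ck_affine_line k U (w : 'rV[R]_n) (al be : R) : open U ->
  Ck k U (fun t : R => (al * t + be) *: w).
Proof.
move=> oU; apply/Ck_mxP => // i j.
apply: (@Ck_eq _ _ _ _ _ (fun t : R => (al * t + be) * w i j)) => //.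
  by move=> t _; rewrite mxE.
apply: Ck_mul => //; last exact: Ck_cst.
apply: Ck_add => //; last exact: Ck_cst.
by apply: Ck_mul => //; [exact: Ck_cst|exact: Ck_id].
Qed.

Lemma is_derive_affine_line (w : 'rV[R]_n) (al be t : R) :
  is_derive t 1 (fun t : R => (al * t + be) *: w) (al *: w).
Proof.
have -> : (fun t : R => (al * t + be) *: w) = (fun t : R => be *: w + t *: (al *: w)).
  by apply/funext => s; rewrite scalerDl addrC scalerA [s * al]mulrC.
have d0 : derivable (id : 'rV[R]_n -> 'rV[R]_n) (be *: w + t *: (al *: w)) (al *: w).
  exact: derivable_id.
by have := is_derive_line d0; rewrite derive_id.
Qed.

(* Moving a curve inside its plaques changes neither its leaves nor, since the
   wedges contain the vertical directions in their linearity space, its causal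
   character. *)
Lemma plaque_deformation g O c r U tau (al be : R) (w : 'rV[R]_n) :
  transverse_lorentzian F g -> time_orientation F g O -> adapted F c r ->
  open U -> smooth_into U tau -> (forall t, U t -> dom c (tau t)) -> rsubmx w = 0 ->
  (forall t, U t -> `|c (tau t) + (al * t + be) *: w| < r) ->
  let tau' t := cinv c (c (tau t) + (al * t + be) *: w) in
  [/\ smooth_into U tau', forall t, U t -> same_leaf F (tau t) (tau' t) &
    forall t, U t -> tangent_in O tau t -> tangent_in O tau' t].
Proof.
move=> tg tO adc oU st dU w0 Ur tau'; have ac := adapted_atlas adc.
have [_ T _] := tO.
pose psi t := c (tau t) + (al * t + be) *: w.
have Cct k : Ck k U (c \o tau).
  by apply: Ck_sub (st.2 c ac k) => t Ut; split=> //; exact: dU.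
have spsi : smooth_on U psi.
  by move=> k; apply: (Ck_add oU (Cct k)); exact: Ck_affine_line.
have Upsi t : U t -> [set c y | y in dom c] (psi t).
  by move=> Ut; rewrite (adapted_cod adc); exact: Ur.
have st' : smooth_into U tau' := smooth_into_cinv oU ac spsi Upsi.
have K t : U t -> dom c (tau' t) /\ c (tau' t) = psi t.
  by move=> /Upsi/cmap_cinv.
have rs t : U t -> rsubmx (c (tau t)) = rsubmx (c (tau' t)).
  by move=> /K[_ ->]; rewrite /psi linearD linearZ /= w0 scaler0 addr0.
split=> // t Ut.
  by apply: (adapted_plaque adc); [exact: dU|exact: (K t Ut).1|exact: rs].
move=> H; have [dt' _] := K t Ut; have dt := dU t Ut.
apply: (tangent_in_chart oU st' Ut ac dt' T).
rewrite -(orientation_plaque tg tO adc dt dt' (rs t Ut)).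
have N : \forall s \near t, psi s = (c \o tau') s.
  by have := open_nbhs_nbhs (conj oU Ut); apply: filterS => s /K[_ /= ->].
rewrite derive1E -(near_eq_derive _ N).
have dct := smooth_into_derivable oU st ac Ut dt.
have [dl Dl] := is_derive_affine_line w al be t.
have -> : 'D_1 psi t = 'D_1 (c \o tau) t + 'D_1 (fun t : R => (al * t + be) *: w) t.
  exact: (deriveD dct dl).
rewrite Dl -[w]hsubmxK w0 scale_row_mx scaler0.
by apply: (orientation_shift _ tg tO adc dt); rewrite -derive1E; exact: H.
Qed.

(** The last bit of the curve, inside the chart, is displaced by phi(t) w with w vertical, where phi
    is affine, 0 at b - eta and 1 at b. The corner at b - eta is harmless, the result being a chain
    of segments. *)
Lemma segment_end_move g O c r x y z : transverse_lorentzian F g -> time_orientation F g O ->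
  adapted F c r -> dom c y -> dom c z -> rsubmx (c y) = rsubmx (c z) ->
  future_segment O x y -> future_reach O x z.
Proof.
move=> tg tO adc dy dz eyz [tau [a [b [e [[e0 ab] st H ta tb]]]]].
pose w := c z - c y; have w0 : rsubmx w = 0 by rewrite /w linearB /= eyz subrr.
pose m := Num.max `|c y| `|c z|.
have mr : m < r by rewrite gt_max !(adapted_norm adc).
have m0 : 0 <= m by rewrite le_max normr_ge0.
have ym : `|c y| <= m by rewrite le_max lexx.
have zm : `|c z| <= m by rewrite le_max lexx orbT.
(* One third of the margin covers the variation of the curve near b, another the overshoot of phi
   outside [0, 1]; the rest keeps the inequality strict. *)
pose dl := (r - m) / 3; have dl0 : 0 < dl by rewrite divr_gt0// subr_gt0.
have oU := @open_itv_set R (a - e) (b + e); set U := [set t | _] in oU.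
have Ub : U b by rewrite /U /=; apply/andP; split; lra.
have Nb : nbhs b [set t | dom c (tau t) /\ `|c (tau t) - c y| < dl].
  have cb : {for b, continuous tau} := st.1 b Ub.
  have dtb : dom c (tau b) by rewrite tb.
  have N1 : nbhs b (tau @^-1` dom c).
    by apply: cb; apply: open_nbhs_nbhs; split=> //; exact: dom_open.
  have N2 : nbhs b [set t | `|(c \o tau) t - c y| < dl].
    have cc : {for b, continuous (c \o tau)}.
      by apply: continuous_comp; [exact: cb|exact: cmap_continuous].
    have N : nbhs ((c \o tau) b) [set w | `|w - c y| < dl].
      by apply: open_nbhs_nbhs; split; [exact: open_norm_lt|rewrite /= tb subrr normr0].
    exact: (cc _ N).
  by apply: filterS2 N1 N2 => t.
have [eta0 /= eta00 B] := (nbhs_ballP _ _).1 Nb.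
pose e1 := dl / (2 * (m + 1)).
have m1 : 0 < 2 * (m + 1) by lra.
have e10 : 0 < e1 by rewrite divr_gt0.
have e1m : 2 * e1 * m < dl.
  have : e1 * (2 * (m + 1)) = dl by rewrite /e1 divfK// gt_eqF.
  by lra.
pose eta := Num.min eta0 (Num.min e (b - a)) / 2.
have mn0 : 0 < Num.min eta0 (Num.min e (b - a)) by rewrite !lt_min eta00 e0 subr_gt0 ab.
have eta_gt0 : 0 < eta by rewrite divr_gt0.
have etaE : 2 * eta = Num.min eta0 (Num.min e (b - a)) by rewrite /eta; field.
have h1 : 2 * eta <= eta0 by rewrite etaE ge_min lexx.
have h2 : 2 * eta <= e by rewrite etaE !ge_min lexx orbT.
have h3 : 2 * eta <= b - a by rewrite etaE !ge_min lexx !orbT.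
(* The segment must extend smoothly past its ends; this extension is less than eta and small enough
   for phi to stay within e1 of [0, 1]. *)
pose e' := eta * (e1 / (1 + e1)).
have q0 : 0 < e1 / (1 + e1) by rewrite divr_gt0// addr_gt0.
have q1 : e1 / (1 + e1) < 1 by rewrite ltr_pdivrMr ?addr_gt0// mul1r ltrDr.
have q2 : e1 / (1 + e1) <= e1.
  by rewrite ler_pdivrMr ?addr_gt0// ler_peMr ?ltW// ltrDl.
have e'0 : 0 < e' by rewrite mulr_gt0.
have e'1 : e' < eta by rewrite /e' gtr_pMr.
have oU' := @open_itv_set R (b - eta - e') (b + e'); set U' := [set t | _] in oU'.
have U'U : U' `<=` U.
  by move=> t; rewrite /U /U' /= => /andP[t1 t2]; apply/andP; split; lra.
have U'B t : U' t -> dom c (tau t) /\ `|c (tau t) - c y| < dl.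
  rewrite /U' /= => /andP[t1 t2]; apply: B; rewrite -ball_normE /=.
  by rewrite ltr_norml; apply/andP; split; lra.
pose al := eta^-1; pose be := 1 - b / eta.
have phi t : U' t -> - e1 <= al * t + be <= 1 + e1.
  have E : al * t + be = 1 + (t - b) / eta by rewrite /al /be; field; rewrite gt_eqF.
  rewrite /U' /= E => /andP[t1 t2].
  have k1 : - (1 + e1) <= (t - b) / eta.
    rewrite ler_pdivlMr//; have : e' <= e1 * eta by rewrite /e' mulrC ler_wpM2r// ltW.
    by lra.
  have k2 : (t - b) / eta <= e1.
    rewrite ler_pdivrMr//; have : e' <= e1 * eta by rewrite /e' mulrC ler_wpM2r// ltW.
    by lra.
  by apply/andP; split; lra.
have Ur t : U' t -> `|c (tau t) + (al * t + be) *: w| < r.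
  move=> Ut; have [_ ty] := U'B t Ut; have := phi t Ut; set f := al * t + be => /andP[f1 f2].
  have -> : c (tau t) + f *: w = (c (tau t) - c y) + ((1 - f) *: c y + f *: c z).
    by rewrite /w; apply/rowP => i; rewrite !mxE; ring.
  apply: le_lt_trans (ler_normD _ _) _.
  have : `|(1 - f) *: c y + f *: c z| <= (1 + 2 * e1) * m.
    apply: le_trans (ler_normD _ _) _; rewrite !normrZ.
    apply: (@le_trans _ _ (`|1 - f| * m + `|f| * m)).
      by apply: lerD; rewrite ler_wpM2l.
    rewrite -mulrDl ler_wpM2r//.
    by have [|] := ger0P (1 - f); have [|] := ger0P f; lra.
  move: ty mr e1m; rewrite /dl; lra.
have [st' _ tan'] := plaque_deformation tg tO adc oU' (smooth_into_sub U'U st)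
  (fun t Ut => (U'B t Ut).1) w0 Ur.
set tau' := fun t => _ in st' tan'.
apply: (@FutureStep _ _ _ _ _ _ (tau (b - eta))).
  apply: FutureSegment; exists tau, a, (b - eta), e; split=> //.
  - by split=> //; lra.
  - by apply: smooth_into_sub st => t /= /andP[t1 t2]; apply/andP; split; lra.
  - by move=> t /andP[t1 t2]; apply: H; apply/andP; split; lra.
exists tau', (b - eta), b, e'; split=> //.
- by split=> //; lra.
- move=> t /andP[t1 t2]; apply: tan'; last by apply: H; apply/andP; split; lra.
  by rewrite /U' /=; apply/andP; split; lra.
- rewrite /tau' (_ : al * (b - eta) + be = 0).
    rewrite scale0r addr0 cmapK//; apply: (U'B _ _).1.
    by rewrite /U' /=; apply/andP; split; lra.
  by rewrite /al /be; field; rewrite gt_eqF.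
- rewrite /tau' (_ : al * b + be = 1).
    by rewrite scale1r tb /w addrC subrK cmapK.
  by rewrite /al /be; field; rewrite gt_eqF.
Qed.

Lemma future_reach_leaf g O x y z : transverse_lorentzian F g -> time_orientation F g O ->
  future_reach O x y -> same_leaf F y z -> future_reach O x z.
Proof.
move=> tg tO xy yz; apply: (plaque_induction (P := future_reach O x) _ yz xy) => x0.
have [c [r [adc _ dx _]]] := adapted_exists F openT (I : [set: M] x0).
exists c, r; split=> // y1 z1 dy dz E xy1; case: xy1 dy E => {y1} [x1 y1|x1 y1 z2] H.
  by move=> dy E; exact: (segment_end_move tg tO adc dy dz E).
move=> s dy E; apply: future_reach_trans H _.
exact: (segment_end_move tg tO adc dy dz E).
Qed.

Lemma leaf_lt_trans g O (L1 L2 L3 : leaf_space F) : transverse_lorentzian F g ->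
  time_orientation F g O -> leaf_lt F O L1 L2 -> leaf_lt F O L2 L3 -> leaf_lt F O L1 L3.
Proof.
move=> tg tO /leaf_ltP[x [y [xL yL xy]]] /leaf_ltP[y' [z [yL' zL yz]]].
apply/leaf_ltP; exists x, z; split=> //; apply: future_reach_trans yz.
by apply: (future_reach_leaf tg tO xy); apply/leaf_ofP; rewrite yL yL'.
Qed.

(** A germ through z in the same leaves as [sigma] at each time. The tangent condition at the single
    time t0 suffices to continue a curve inside the cone, and it passes along a whole leaf by
    [plaque_induction]. *)
Definition germ_follows O sigma t0 z := exists tau eta, [/\ 0 < eta,
  smooth_into [set t : R | t0 - eta < t < t0 + eta] tau, tau t0 = z, tangent_in O tau t0 &
  forall t, t0 - eta < t < t0 + eta -> same_leaf F (sigma t) (tau t)].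

Lemma germ_follows_leaf g O sigma t0 y z : transverse_lorentzian F g ->
  time_orientation F g O -> germ_follows O sigma t0 y -> same_leaf F y z ->
  germ_follows O sigma t0 z.
Proof.
move=> tg tO gy yz; apply: (plaque_induction (P := germ_follows O sigma t0) _ yz gy) => x0.
have [c [r [adc _ dx _]]] := adapted_exists F openT (I : [set: M] x0).
exists c, r; split=> // y1 z1 dy dz E [tau [eta [eta0 st ty tt fl]]].
pose w := c z1 - c y1; have w0 : rsubmx w = 0 by rewrite /w linearB /= E subrr.
have Ut0 : t0 - eta < t0 < t0 + eta by apply/andP; split; lra.
have Nb : nbhs t0 [set t | dom c (tau t) /\ `|c (tau t) + w| < r].
  have cb : {for t0, continuous tau} := st.1 t0 Ut0.
  have dtb : dom c (tau t0) by rewrite ty.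
  have N1 : nbhs t0 (tau @^-1` dom c).
    by apply: cb; apply: open_nbhs_nbhs; split=> //; exact: dom_open.
  have cc : (c \o tau) t + w @[t --> t0] --> (c \o tau) t0 + w.
    have cc : {for t0, continuous (c \o tau)}.
      by apply: continuous_comp; [exact: cb|exact: cmap_continuous].
    exact: (cvgD cc (cvg_cst w)).
  have N : nbhs ((c \o tau) t0 + w) [set u | `|u| < r].
    apply: open_nbhs_nbhs; split; first exact: open_norm_lt0.
    by rewrite /= ty /w addrC subrK; exact: (adapted_norm adc).
  have N2 : nbhs t0 [set t | `|(c \o tau) t + w| < r] := cc _ N.
  by apply: filterS2 N1 N2 => t.
have [e1 /= e10 B] := (nbhs_ballP _ _).1 Nb.
pose e2 := Num.min eta e1; have e20 : 0 < e2 by rewrite lt_min eta0.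
have e2eta : e2 <= eta by rewrite ge_min lexx.
have e2e1 : e2 <= e1 by rewrite ge_min lexx orbT.
have oU := @open_itv_set R (t0 - e2) (t0 + e2); set U := [set t | _] in oU.
have sU : U `<=` [set t : R | t0 - eta < t < t0 + eta].
  by rewrite /U => t /= /andP[t1 t2]; apply/andP; split; lra.
have UB t : U t -> dom c (tau t) /\ `|c (tau t) + w| < r.
  rewrite /U /= => /andP[t1 t2]; apply: B; rewrite -ball_normE /=.
  by rewrite ltr_norml; apply/andP; split; lra.
(* A constant displacement, written in the affine form expected by [plaque_deformation]. *)
have Ur t : U t -> `|c (tau t) + (0 * t + 1) *: w| < r.
  by move=> /UB[_]; rewrite mul0r add0r scale1r.
have [st' sl' tan'] := plaque_deformation tg tO adc oU (smooth_into_sub sU st)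
  (fun t Ut => (UB t Ut).1) w0 Ur.
have U0 : U t0 by rewrite /U /=; apply/andP; split; lra.
eexists; exists e2; split; [exact: e20|exact: st'| |exact: (tan' t0 U0)|].
  by rewrite /= mul0r add0r scale1r ty /w addrC subrK cmapK.
move=> t Ut; apply: same_leaf_trans (sl' t Ut); apply: fl; exact: sU.
Qed.

Lemma reversed_time_orientation g O : transverse_lorentzian F g -> time_orientation F g O ->
  time_orientation F g (reversed O).
Proof.
move=> tg [H T C].
have cN c x v : causal_vectors F g c x v -> causal_vectors F g c x (v *m (-1)%:M).
  rewrite mul_mx_scalar scaleN1r => -[nv vv]; split; last first.
    by rewrite -scaleN1r bilZl bilZr !mulN1r opprK.
  move=> [N [f [cf [z [b [w [fz ab bz vE]]]]]]]; apply: nv.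
  exists N, f; split=> //; exists z, b, (- w); split=> //.
  by rewrite mulNmx -vE opprK.
have N1 (v : 'rV[R]_n) : v *m (-1)%:M = - v by rewrite mul_mx_scalar scaleN1r.
split.
- move=> c x ac dx; have [v cv E] := H c x ac dx; exists (- v); first by rewrite -N1; exact: cN.
  apply/seteqP; split=> u; rewrite /reversed /= E => Hu.
    by have := connected_component_mulmx (cN c x) Hu; rewrite !N1 opprK.
  by have := connected_component_mulmx (cN c x) Hu; rewrite !N1 opprK.
- move=> c d x ac ad cx dx; apply/seteqP; split=> u; rewrite /reversed /=.
    rewrite (T c d x ac ad cx dx) => -[v Ov vE]; exists (- v); rewrite ?opprK//.
    by rewrite mulNmx vE opprK.
  move=> [v Ov <-]; rewrite (T c d x ac ad cx dx); exists (- v) => //.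
  by rewrite mulNmx.
- move=> x; have [c [X [ac cx NX]]] := C x; exists c, (fun y => - X y); split=> //.
  apply: filterS NX => y [cX OX]; split; last by rewrite /reversed /= opprK.
  exact: (cvgN cX).
Qed.

Lemma reversed_wider_oriented g O g' O' : transverse_lorentzian F g' ->
  wider_oriented F g O g' O' -> wider_oriented F g (reversed O) g' (reversed O').
Proof.
move=> tg' [t1 w1 to1 s1]; split=> //; first exact: reversed_time_orientation.
by move=> c x ac dx v; exact: s1.
Qed.

Lemma reversedK O : reversed (reversed O) = O.
Proof.
apply/funext => c; apply/funext => x; apply/seteqP.
by split=> v; rewrite /reversed /= opprK.
Qed.

Lemma leaf_lt_rev O (L L' : leaf_space F) : leaf_lt F O L L' -> leaf_lt F (reversed O) L' L.
Proof.
move=> /leaf_ltP[x [y [xL yL xy]]]; apply/leaf_ltP; exists y, x; split=> //.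
exact: future_reach_rev.
Qed.

End LeafOrder.

(** * Leaving a transverse disc *)

Section PushOut.
Context {R : realType} {p q : nat} {M : manifold R (p + q)} (F : foliation M).
Local Notation n := (p + q)%N.
Implicit Types (c d : chart R M n) (tau : R -> M) (x y z : M)
  (g : chart R M n -> M -> 'M[R]_n) (O : chart R M n -> M -> set 'rV[R]_n).

Definition slice c (u : 'rV[R]_q) : M := cinv c (row_mx 0 u).

Lemma row_mx0_norm (u : 'rV[R]_q) : `|(row_mx 0 u : 'rV[R]_n)| <= `|u|.
Proof.
apply/rV_norm_le => // i; rewrite mxE; case: splitP => j _; last exact: rV_norm_ge.
by rewrite mxE normr0.
Qed.

Lemma rsubmx_norm (v : 'rV[R]_n) : `|rsubmx v| <= `|v|.
Proof. by apply/rV_norm_le => // i; rewrite mxE; exact: rV_norm_ge. Qed.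

Lemma sliceP c r u : adapted F c r -> `|u| < r ->
  dom c (slice c u) /\ c (slice c u) = row_mx 0 u.
Proof.
by move=> adc ur; apply: (adapted_cinv adc); apply: le_lt_trans (row_mx0_norm u) ur.
Qed.

Lemma slice_leaf c r y : adapted F c r -> dom c y ->
  same_leaf F y (slice c (rsubmx (c y))).
Proof.
move=> adc dy; have ur := le_lt_trans (rsubmx_norm (c y)) (adapted_norm adc dy).
have [d1 d2] := sliceP adc ur.
by apply: (adapted_plaque adc) => //; rewrite d2 row_mxKr.
Qed.

Lemma slice_continuous c r u : adapted F c r -> `|u| < r -> {for u, continuous (slice c)}.
Proof.
move=> adc ur; apply: (@continuous_comp _ _ _ (@transverse R p q) (cinv c)).
  exact: transverse_continuous.
apply: cinv_continuous_at; rewrite (adapted_cod adc).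
exact: le_lt_trans (row_mx0_norm u) ur.
Qed.

(** Continuous induction on the time during which the leaf of the curve meets the truncated cone.
    The first alternative has the form of the hypothesis, so that segments can be chained in
    [reach_push]. *)
Lemma segment_push O c r0 r (C : set 'rV[R]_q) u0 g x y : hausdorff_space (leaf_space F) ->
  transverse_lorentzian F g -> time_orientation F g O -> adapted F c r0 -> r < r0 ->
  closed C -> (forall u w, C u -> C w -> C (u + w)) ->
  (forall t w, 0 <= t -> C w -> C (t *: w)) ->
  (forall u v, `|u| <= r -> O c (slice c u) v -> interior C (rsubmx v)) ->
  future_segment O x y ->
  (exists u, [/\ `|u| <= r, C (u - u0) & leaf_of F x = leaf_of F (slice c u)]) ->
  (exists u, [/\ `|u| <= r, C (u - u0) & leaf_of F y = leaf_of F (slice c u)]) \/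
  (exists u z, [/\ `|u| = r, C (u - u0), leaf_of F z = leaf_of F (slice c u) &
     future_reach O z y]).
Proof.
move=> hH tg tO adc rr0 clC addC scC intC [tau [a [b [e [[e0 ab] st H ta tb]]]]] xK.
pose K := [set u : 'rV[R]_q | `|u| <= r] `&` (fun u => u - u0) @^-1` C.
have cK : compact K.
  apply: compact_closedI.
    rewrite (_ : [set _ | _] = [set u : 'rV[R]_q | `|u - 0| <= r]); first exact: compact_closed_ball.
    by apply/seteqP; split=> u /=; rewrite subr0.
  by apply: preimage_closed => // u _; exact: (cvgB cvg_id (cvg_cst u0)).
pose I := (leaf_of F \o slice c) @` K.
have clI : closed I.
  apply: compact_closed => //; apply: continuous_compact => //.
  apply: continuous_in_subspaceT => u; rewrite inE => -[ur _].
  apply: continuous_comp; last exact: leaf_of_continuous.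
  by apply: (slice_continuous adc); exact: le_lt_trans ur rr0.
(* [S] need not be an interval; only its last element matters. The supremum belongs to [S] because
   [I] is closed. *)
pose S := [set t : R | a <= t <= b /\ I (leaf_of F (tau t))].
have Sa : S a.
  split; first by rewrite lexx ltW.
  by rewrite ta; have [u [ur uC ->]] := xK; exists u.
have supS : has_sup S by split; [exists a|exists b => t [/andP[]]].
pose ts := sup S.
have ats : a <= ts by exact: (ub_le_sup supS.2 Sa).
have tsb : ts <= b by apply: ge_sup; [exists a|move=> t [/andP[]]].
have Uts t : a <= t <= b -> [set t : R | a - e < t < b + e] t.
  by move=> /andP[t1 t2] /=; apply/andP; split; lra.
have Its : I (leaf_of F (tau ts)).
  apply: contrapT => nI.
  have ct : {for ts, continuous (leaf_of F \o tau)}.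
    apply: continuous_comp; last exact: leaf_of_continuous.
    by apply: (st.1 ts); apply: Uts; rewrite ats.
  have N : nbhs ts [set t | ~ I (leaf_of F (tau t))].
    exact: (ct _ (open_nbhs_nbhs (conj (closed_openC clI) nI))).
  have [d /= d0 dB] := (nbhs_ballP _ _).1 N.
  have [t St tts] := sup_adherent d0 supS.
  have tle : t <= ts by exact: (ub_le_sup supS.2 St).
  apply: (dB t _ St.2); rewrite -ball_normE /= ger0_norm ?subr_ge0//.
  by move: tts; rewrite -/ts; lra.
have [tsE|tsn] := eqVneq ts b.
  left; move: Its; rewrite tsE tb => -[u [ur uC] E].
  by exists u.
have {tsn}tslt : ts < b by rewrite lt_neqAle tsn.
right; have [u [ur uC] uE] := Its; rewrite /= in uE.
have [urE|urn] := eqVneq `|u| r.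
  exists u, (tau ts); split=> //; apply: FutureSegment; exists tau, ts, b, e; split=> //.
    by apply: smooth_into_sub st => t /= /andP[t1 t2]; apply/andP; split; lra.
  by move=> t /andP[t1 t2]; apply: H; apply/andP; split; lra.
exfalso.
have {urn ur}ur : `|u| < r by rewrite lt_neqAle urn.
have ur0 : `|u| < r0 by exact: lt_trans ur rr0.
have tsab : a <= ts <= b by rewrite ats.
have [d1 d2] := sliceP adc ur0.
have germ0 : germ_follows F O tau ts (tau ts).
  exists tau, e; split; [exact: e0| |by []|exact: H|by move=> t _; exact: same_leaf_refl].
  by apply: smooth_into_sub st => t /= /andP[t1 t2]; apply/andP; split; lra.
have sl : same_leaf F (tau ts) (slice c u) by apply/leaf_ofP.
have [tau2 [eta [eta0 st2 E2 tan2 fol]]] := germ_follows_leaf tg tO germ0 sl.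
have oU2 := @open_itv_set R (ts - eta) (ts + eta).
have U2 : [set t : R | ts - eta < t < ts + eta] ts by apply/andP; move: eta0 => ?; split; lra.
have ac := adapted_atlas adc.
have dts : dom c (tau2 ts) by rewrite E2.
have dd := smooth_into_derivable oU2 st2 ac U2 dts.
have vC : interior C (rsubmx ('D_1 (c \o tau2) ts)).
  apply: (intC u) => //; first exact: ltW.
  by rewrite -E2 -derive1E; exact: tan2.
(* The velocity of the moved germ is interior to [C], hence so are the difference quotients close to
   it in [C]; multiplying by a positive h gives the increment itself. *)
have N1 : \forall h \near (0:R)^', C (rsubmx (h^-1 *: ((c \o tau2) (h *: 1 + ts) - (c \o tau2) ts))).
  have L : h^-1 *: ((c \o tau2) (h *: 1 + ts) - (c \o tau2) ts) @[h --> (0:R)^'] --> 'D_1 (c \o tau2) ts.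
    exact: dd.
  exact: (cvg_comp _ _ L (@rsubmx_continuous R p q _) _ vC).
have ct2 : {for ts, continuous tau2} := st2.1 ts U2.
have N2 : \forall t \near ts, dom c (tau2 t) /\ `|rsubmx (c (tau2 t))| < r.
  have M1 : nbhs ts (tau2 @^-1` dom c).
    by apply: ct2; apply: open_nbhs_nbhs; split=> //; exact: dom_open.
  have cc : {for ts, continuous (rsubmx \o (c \o tau2))}.
    apply: continuous_comp; last exact: rsubmx_continuous.
    by apply: continuous_comp; [exact: ct2|exact: cmap_continuous].
  have N : nbhs ((rsubmx \o (c \o tau2)) ts) [set w : 'rV[R]_q | `|w| < r].
    apply: open_nbhs_nbhs; split; first exact: open_norm_lt0.
    by rewrite /= E2 d2 row_mxKr.
  have M2 : nbhs ts [set t | `|rsubmx (c (tau2 t))| < r] := cc _ N.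
  by apply: filterS2 M1 M2 => t.
have [h1 /= h10 B1] := (nbhs_ballP _ _).1 N1.
have [h2 /= h20 B2] := (nbhs_ballP _ _).1 N2.
pose h := Num.min (Num.min h1 h2) (Num.min eta (b - ts)) / 2.
have hm0 : 0 < Num.min (Num.min h1 h2) (Num.min eta (b - ts)).
  by rewrite !lt_min h10 h20 eta0 subr_gt0.
have h0 : 0 < h by rewrite divr_gt0.
have hE : 2 * h = Num.min (Num.min h1 h2) (Num.min eta (b - ts)) by rewrite /h; field.
have hh1 : 2 * h <= h1 by rewrite hE !ge_min lexx.
have hh2 : 2 * h <= h2 by rewrite hE !ge_min lexx !orbT.
have hh3 : 2 * h <= eta by rewrite hE !ge_min lexx !orbT.
have hh4 : 2 * h <= b - ts by rewrite hE !ge_min lexx !orbT.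
have [dt ut] : dom c (tau2 (ts + h)) /\ `|rsubmx (c (tau2 (ts + h)))| < r.
  apply: B2; rewrite -ball_normE /= opprD addNKr normrN gtr0_norm//; lra.
have Ch : C (rsubmx (h^-1 *: ((c \o tau2) (h *: 1 + ts) - (c \o tau2) ts))).
  apply: B1; last by rewrite gt_eqF.
  by rewrite -ball_normE /= sub0r normrN gtr0_norm//; lra.
set u' := rsubmx (c (tau2 (ts + h))) in ut.
have Cu' : C (u' - u).
  have := scC h _ (ltW h0) Ch; rewrite linearZ /= scalerA divff ?gt_eqF// scale1r.
  rewrite linearB /= E2 d2 row_mxKr.
  rewrite [h *: 1](mulr1 h) (addrC h).
  exact.
(* A later time in [S], against the choice of the supremum: the new increment and the old one add up
   in [C], and the moved germ is in the leaf of the original curve. *)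
have Sh : S (ts + h).
  split; first by apply/andP; split; lra.
  exists u'; first split; first exact: ltW.
    by rewrite /= -(subrK u u') -addrA; apply: addC.
  rewrite /=; apply/leaf_ofP; apply: same_leafC.
  apply: same_leaf_trans (slice_leaf adc dt); apply: fol.
  by apply/andP; split; lra.
have := ub_le_sup supS.2 Sh; rewrite -/ts; lra.
Qed.

Lemma reach_push O c r0 r (C : set 'rV[R]_q) u0 g x y : hausdorff_space (leaf_space F) ->
  transverse_lorentzian F g -> time_orientation F g O -> adapted F c r0 -> r < r0 ->
  closed C -> (forall u w, C u -> C w -> C (u + w)) ->
  (forall t w, 0 <= t -> C w -> C (t *: w)) ->
  (forall u v, `|u| <= r -> O c (slice c u) v -> interior C (rsubmx v)) ->
  future_reach O x y ->
  (exists u, [/\ `|u| <= r, C (u - u0) & leaf_of F x = leaf_of F (slice c u)]) ->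
  (exists u, [/\ `|u| <= r, C (u - u0) & leaf_of F y = leaf_of F (slice c u)]) \/
  (exists u z, [/\ `|u| = r, C (u - u0), leaf_of F z = leaf_of F (slice c u) &
     future_reach O z y]).
Proof.
move=> hH tg tO adc rr0 clC addC scC intC; elim=> {x y} [x y s|x y z _ IH s] xK.
  exact: (segment_push hH tg tO adc rr0 clC addC scC intC s xK).
have [yK|[u [w [ur uC wu wy]]]] := IH xK.
  exact: (segment_push hH tg tO adc rr0 clC addC scC intC s yK).
by right; exists u, w; split=> //; exact: FutureStep wy s.
Qed.

(** The factor 2 leaves room for extending the parameter beyond [0, 1]. *)
Lemma straight_segment g O c r u : transverse_lorentzian F g -> time_orientation F g O ->
  adapted F c r -> 2 * `|u| < r ->
  (forall t, 0 <= t <= 1 -> O c (slice c (t *: u)) (row_mx 0 u)) ->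
  future_segment O (slice c 0) (slice c u).
Proof.
move=> tg tO adc ur H; have ac := adapted_atlas adc.
pose w : 'rV[R]_n := row_mx 0 u.
pose phi (t : R) : 'rV[R]_n := (1 * t + 0) *: w.
have phiE t : phi t = row_mx 0 (t *: u).
  by rewrite /phi mul1r addr0 /w scale_row_mx scaler0.
have oU := @open_itv_set R (0 - 2^-1) (1 + 2^-1); set U := [set t | _] in oU.
have tr t : U t -> `|t *: u| < r.
  rewrite /U /= => /andP[t1 t2]; rewrite normrZ; apply: le_lt_trans ur.
  by rewrite ler_wpM2r// ler_norml; apply/andP; split; lra.
have Uphi t : U t -> [set c y | y in dom c] (phi t).
  move=> /tr Ut; rewrite (adapted_cod adc) phiE.
  exact: le_lt_trans (row_mx0_norm _) Ut.
have sphi : smooth_on U phi by move=> k; exact: Ck_affine_line.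
have st := smooth_into_cinv oU ac sphi Uphi.
have [_ T _] := tO.
have h0 : 0 < 2^-1 :> R by rewrite invr_gt0 ltr0n.
exists (cinv c \o phi), 0, 1, 2^-1; split; [by split; [exact: h0|exact: ltr01]|exact: st| | |].
- move=> t t01.
  have Ut : U t by move: t01; rewrite /U /= => /andP[t1 t2]; apply/andP; split; lra.
  have [dt ct] := cmap_cinv (Uphi t Ut).
  apply: (tangent_in_chart oU st Ut ac dt T).
  have N : \forall s \near t, phi s = (c \o (cinv c \o phi)) s.
    have := open_nbhs_nbhs (conj oU Ut); apply: filterS => s Us.
    by have [_ /= ->] := cmap_cinv (Uphi s Us).
  rewrite derive1E -(near_eq_derive _ N).
  have [_ ->] := is_derive_affine_line w 1 0 t.
  by rewrite scale1r /= phiE; exact: H.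
- by rewrite /= phiE scale0r.
- by rewrite /= phiE scale1r.
Qed.

(* A curve issued near L must leave a small transverse ball through its
   boundary sphere, at a point that a straight segment joins to L. *)
Lemma push_out g O gm Om g' O' (L : leaf_space F) (V : set (leaf_space F)) :
  hausdorff_space (leaf_space F) ->
  transverse_lorentzian F g -> time_orientation F g O ->
  wider_oriented F g O gm Om -> wider_oriented F gm Om g' O' -> open V -> V L ->
  exists2 W : set (leaf_space F), nbhs L W &
    forall P L', W P -> ~ V L' -> leaf_lt F O P L' -> leaf_lt F O' L L'.
Proof.
move=> hH tg tO wm w' oV VL; have [x xL] := leaf_of_surj L.
have [tm _ _ Osub] := wm; have [tg' _ tO' O'sub] := w'.
pose B := leaf_of F @^-1` V.
have oB : open B by apply: open_comp => // y _; exact: leaf_of_continuous.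
have Bx : B x by rewrite /B /= xL.
have [c [r0 [adc cB dx cx0]]] := adapted_exists F oB Bx.
have ac := adapted_atlas adc.
have [C [eps [eps0 clC addC scC NC]]] := frozen_cone tg tO wm w' adc dx.
have [rho [rho0 rhor0 rhoN]] : exists rho : R, [/\ 0 < rho, rho <= r0 &
   forall w : 'rV[R]_n, `|w| < rho -> dom c (cinv c w) /\
      (forall v, O c (cinv c w) v -> interior C (rsubmx v)) /\
      (forall v u, C u -> u != 0 -> `|rsubmx v - u| < eps * `|u| -> O' c (cinv c w) v)].
  have ci : {for 0 : 'rV[R]_n, continuous (cinv c)} by rewrite -cx0; exact: cinv_continuous.
  have c0x : cinv c 0 = x by rewrite -cx0 cmapK.
  have N : nbhs (0 : 'rV[R]_n) [set w | dom c (cinv c w) /\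
      (forall v, O c (cinv c w) v -> interior C (rsubmx v)) /\
      (forall v u, C u -> u != 0 -> `|rsubmx v - u| < eps * `|u| -> O' c (cinv c w) v)].
    have NC' := NC; rewrite -c0x in NC'.
    exact: (ci _ NC').
  have [d /= d0 dB] := (nbhs_ballP _ _).1 N.
  exists (Num.min d r0); split; first by rewrite lt_min d0 (adapted_gt0 adc).
    by rewrite ge_min lexx orbT.
  move=> w; rewrite lt_min => /andP[wd _]; apply: dB.
  by rewrite -ball_normE /= sub0r normrN.
(* The radius must satisfy r < rho for the cone estimates and 2 r < r0 for [straight_segment]. *)
pose r := rho / 3; have r_gt0 : 0 < r by rewrite divr_gt0.
have rr0 : r < r0 by rewrite /r; lra.
have intC u v : `|u| <= r -> O c (slice c u) v -> interior C (rsubmx v).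
  move=> ur; have := rhoN (row_mx 0 u) => /(_ _)[|_ [H _]]; last exact: H.
  by apply: le_lt_trans (row_mx0_norm u) _; rewrite /r in ur; lra.
have C0 : C 0.
  have [e Ne] := orientation_near tg tO ac dx.
  have [_ _ Oe _] := nbhs_singleton Ne.
  have [_ [Hi _]] := nbhs_singleton NC.
  by rewrite -(scale0r (rsubmx e)); apply: scC => //; apply: interior_subset; exact: Hi.
(* If u0 has norm below dl and u has norm r, then u - u0 has norm above r/2, and u0 is smaller than
   eps times it. *)
pose dl := Num.min (r / 2) (eps * r / 2).
have er0 : 0 < eps * r by rewrite mulr_gt0.
have dl0 : 0 < dl by rewrite lt_min !divr_gt0.
have dl1 : dl <= r / 2 by rewrite ge_min lexx.
have dl2 : dl <= eps * r / 2 by rewrite ge_min lexx orbT.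
pose W := leaf_of F @` (dom c `&` c @^-1` [set w | `|w| < dl]).
exists W.
  apply: open_nbhs_nbhs; split.
    by apply: leaf_of_open; apply: chart_preimage_open; exact: open_norm_lt0.
  by exists x => //; split=> //=; rewrite cx0 normr0.
move=> P L' [y [dy /= ydl] yP] VL' /leaf_ltP[x1 [y1 [x1P y1L' x1y1]]].
pose u0 := rsubmx (c y).
have u0dl : `|u0| < dl by exact: le_lt_trans (rsubmx_norm _) ydl.
have x1K : exists u, [/\ `|u| <= r, C (u - u0) & leaf_of F x1 = leaf_of F (slice c u)].
  exists u0; split; [lra|by rewrite subrr|].
  by rewrite x1P -yP; apply/leaf_ofP; exact: (slice_leaf adc dy).
have [[u [ur _ y1u]]|[u [z [ur uC zu zy1]]]] :=
  reach_push hH tg tO adc rr0 clC addC scC intC x1y1 x1K.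
  (* Still being in the disc at the end is impossible: the chart was taken inside the preimage of
     [V]. *)
  exfalso; apply: VL'; rewrite -y1L' y1u; apply: cB.
  by have [] := sliceP adc (le_lt_trans ur rr0).
apply/leaf_ltP; exists x, y1; split=> //.
have zy1' : future_reach O' z y1.
  apply: future_reach_sub zy1 => d x' ad dx'; apply: subset_trans (O'sub d x' ad dx').
  exact: Osub.
apply: future_reach_trans zy1'.
apply: (@future_reach_leaf _ _ _ _ _ g' O' x (slice c u) z tg' tO'); last first.
  by apply/leaf_ofP.
have sx : slice c 0 = x by rewrite /slice row_mx0 -cx0 cmapK.
apply: FutureSegment; rewrite -sx.
apply: (straight_segment tg' tO' adc); first by rewrite ur /r; lra.
move=> t /andP[t0 t1].
have [|_ [_ H]] := rhoN (row_mx 0 (t *: u)).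
  apply: le_lt_trans (row_mx0_norm _) _; rewrite normrZ ger0_norm// ur.
  by apply: (@le_lt_trans _ _ r); [rewrite ler_piMl// ltW|rewrite /r; lra].
have uu0 : r / 2 < `|u - u0|.
  have : `|u| <= `|u - u0| + `|u0| by rewrite -{1}(subrK u0 u) ler_normD.
  by rewrite ur; lra.
(* The direction u of the segment from [L] differs from u - u0, which is in the cone, by exactly
   u0. *)
apply: (H _ (u - u0)) => //.
  by rewrite -normr_gt0; apply: lt_trans uu0; rewrite divr_gt0.
rewrite row_mxKr opprB addrC subrK; apply: lt_le_trans u0dl _.
apply: le_trans dl2 _; rewrite -mulrA ler_wpM2l//; exact: ltW.
Qed.

End PushOut.

(** * Closedness of the Seifert relation and the comparison with K+ *)

Section Seifert.
Context {R : realType} {p q : nat} {M : manifold R (p + q)} (F : foliation M).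
Local Notation n := (p + q)%N.
Implicit Types (g : chart R M n -> M -> 'M[R]_n) (O : chart R M n -> M -> set 'rV[R]_n).

Lemma leaf_lt_wider g O g' O' (L L' : leaf_space F) : wider_oriented F g O g' O' ->
  leaf_lt F O L L' -> leaf_lt F O' L L'.
Proof.
move=> [_ _ _ OO] /leaf_ltP[x [y [xL yL xy]]]; apply/leaf_ltP; exists x, y; split=> //.
exact: future_reach_sub xy.
Qed.

Lemma seifert_closed g O : hausdorff_space (leaf_space F) ->
  transverse_lorentzian F g -> time_orientation F g O -> closed (seifert F g O).
Proof.
move=> hH tg tO [L L'] clz g' O' w.
have [->|/eqP LL'] := pselect (L = L'); first by right.
left; have := hH; rewrite open_hausdorff => /(_ _ _ LL')[[V V'] /= [VL VL'] [oV oV' VV']].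
have {}VL : V L by rewrite inE in VL.
have {}VL' : V' L' by rewrite inE in VL'.
have [gc [Oc [wc wc']]] := wider_oriented_mid tg tO w.
have [tgc _ tOc _] := wc.
have [ga [Oa [wa wac]]] := wider_oriented_mid tg tO wc.
have [tga _ tOa _] := wa.
have [gb [Ob [wb wbc]]] := wider_oriented_mid tga tOa wac.
have [gd [Od [wd wd']]] := wider_oriented_mid tgc tOc wc'.
have [tgd _ _ _] := wd; have [tg' _ _ _] := wd'.
have [W NW pW] := push_out hH tga tOa wb wbc oV VL.
have [W' NW' pW'] := push_out hH tgc (reversed_time_orientation tgc tOc)
  (reversed_wider_oriented tgd wd) (reversed_wider_oriented tg' wd') oV' VL'.
(* The neighborhoods do two jobs: [W] and [W'] make the pushes possible, while the disjoint [V] and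
   [V'] ensure that P and P' differ and that each curve ends outside the disc it starts in. *)
have N : nbhs (L, L') ((W `&` V) `*` (W' `&` V')).
  exists (W `&` V, W' `&` V') => //=; split.
    exact: filterI NW (open_nbhs_nbhs (conj oV VL)).
  exact: filterI NW' (open_nbhs_nbhs (conj oV' VL')).
have [[P P'] [/= S [[WP VP] [WP' VP']]]] := clz _ N.
have nVV' X : V X -> V' X -> False.
  by move=> v1 v2; have : (V `&` V') X by []; rewrite (eqP VV').
have [PP'|PP'] : Jplus F Oa (P, P') := S _ _ wa; last first.
  by exfalso; apply: (nVV' P) => //; rewrite [P]PP'.
have LP' : leaf_lt F Oc L P' by apply: (pW P) => // /nVV'; exact.
(* The second push starts from the relation just obtained: reversed in time, it goes from P', close
   to L', to L itself, which is outside [V']. *)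
have L'L := pW' P' L WP' (fun v => nVV' L VL v) (leaf_lt_rev LP').
by have := leaf_lt_rev L'L; rewrite reversedK.
Qed.

(** K+ is the smallest closed transitive relation containing the causal one. Transitivity of the
    Seifert relation is that of each of the relations it intersects, by [leaf_lt_trans]. *)
Lemma Kplus_seifert g O : hausdorff_space (leaf_space F) ->
  transverse_lorentzian F g -> time_orientation F g O -> Kplus F O `<=` seifert F g O.
Proof.
move=> hH tg tO z; apply.
- exact: seifert_closed.
- move=> x y t xy yt g' O' w; have [tg' _ tO' _] := w.
  have [/= lxy|/= ->] := xy _ _ w; last exact: (yt _ _ w).
  have [/= lyt|/= <-] := yt _ _ w; last by left.
  by left; exact: leaf_lt_trans tg' tO' lxy lyt.
- move=> [x y] [/= xy|/= ->] g' O' w; last by right.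
  by left; exact: leaf_lt_wider w xy.
Qed.

End Seifert.

Theorem theorem7p1 (R : realType) (p q : nat)
  (hn : (3 <= p + q)%N) (hq : (2 <= q)%N)
  (M : manifold R (p + q)) (hM : connected [set: M])
  (F : foliation M)
  (g : chart R M (p + q) -> M -> 'M[R]_(p + q))
  (O : chart R M (p + q) -> M -> set 'rV[R]_(p + q))
  (hg : transverse_lorentzian F g)
  (hO : time_orientation F g O)
  (hreg : causally_leaf_regular F O)
  (hH : hausdorff_space (leaf_space F)) :
  closed (seifert F g O) /\
  (stably_causal F g O -> K_causal F O).
Proof.
split=> [|[g' [? [w ncycle]]] x y xy yx]; first exact: seifert_closed.
(* It is enough to show x = y: otherwise both strict relations hold for the wider causal metric, and
   they compose to a forbidden cycle. *)
apply: subset_closure => /=; have [tg' _ tO' _] := w.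
have [/= lxy|//] := Kplus_seifert hH hg hO xy w.
have [/= lyx|//] := Kplus_seifert hH hg hO yx w.
by case: (ncycle x); exact: leaf_lt_trans tg' tO' lxy lyx.
Qed.
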